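(* Consider the broadcast channel with cognitive relays (BCCR) with common message, with transition probability function $\mathbb{P}(y_1,y_2|x_1,x_B,x_2)$. Let $\mathcal{P}^{BCCR}$ be the set of all joint distributions $P_{QW_1U_1W_2V_2W_BU_BV_BX_1X_2X_B}$ that factorize as $$P_Q\,P_{W_1U_1X_1|Q}\,P_{W_2V_2X_2|Q}\,P_{W_BU_BV_B|W_1U_1W_2V_2Q}\,P_{X_B|X_1X_2V_BU_BW_BU_1W_1V_2W_2Q}.$$ For a given member of $\mathcal{P}^{BCCR}$, with $Y_1,Y_2$ generated from $X_1,X_B,X_2$ through the channel, set $$\eta_0 = I(U_1,V_2;W_B|W_1,W_2,Q),\quad \eta_1 = I(V_2;U_B|U_1,W_1,W_2,W_B,Q),\quad \eta_2 = I(U_1;V_B|V_2,W_1,W_2,W_B,Q),$$ $$\theta_1 = I(U_1;W_B|W_1,W_2,Q),\qquad \theta_2 = I(V_2;W_B|W_1,W_2,Q).$$ Let $\mathfrak{R}_i^{F\to BCCR_{cm}}$ be the union, over all members of $\mathcal{P}^{BCCR}$, of the sets of triples $(R_0,R_1,R_2)\in\mathbb{R}_+^3$ for which there exist $(B_0,B_1,B_2,R_{10},R_{11},R_{20},R_{22})\in\mathbb{R}_+^7$ such that $R_1=R_{10}+R_{11}$, $R_2=R_{20}+R_{22}$, and all of the following hold: $$\begin{aligned} B_0 &> \eta_0,\\ B_0+B_1 &> \eta_0+\eta_1,\\ B_0+B_2 &> \eta_0+\eta_2,\\ B_0+B_1+B_2 &> \eta_0+\eta_1+\eta_2+I(U_B;V_B|U_1,V_2,W_1,W_2,W_B,Q),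 \end{aligned}$$ $$\begin{aligned} R_{11}+B_1 &< I(U_1,U_B;Y_1|W_1,W_2,W_B,Q)+\theta_1,\\ R_0+B_0+B_1 &< I(W_B,U_B;Y_1|W_1,W_2,U_1,Q)+\theta_1,\\ R_{20}+R_0+B_0+B_1 &< I(W_2,W_B,U_B;Y_1|W_1,U_1,Q)+\theta_1,\\ R_0+B_0+R_{11}+B_1 &< I(U_1,W_B,U_B;Y_1|W_1,W_2,Q)+\theta_1,\\ R_{20}+R_0+B_0+R_{11}+B_1 &< I(U_1,W_2,W_B,U_B;Y_1|W_1,Q)+\theta_1,\\ R_{10}+R_0+B_0+R_{11}+B_1 &< I(W_1,U_1,W_B,U_B;Y_1|W_2,Q)+\theta_1,\\ R_{10}+R_{20}+R_0+B_0+R_{11}+B_1 &< I(W_1,U_1,W_2,W_B,U_B;Y_1|Q)+\theta_1, \end{aligned}$$ $$\begin{aligned} R_{22}+B_2 &< I(V_2,V_B;Y_2|W_1,W_2,W_B,Q)+\theta_2,\\ R_0+B_0+B_2 &< I(W_B,V_B;Y_2|W_1,W_2,V_2,Q)+\theta_2,\\ R_{10}+R_0+B_0+B_2 &< I(W_1,W_B,V_B;Y_2|W_2,V_2,Q)+\theta_2,\\ R_0+B_0+R_{22}+B_2 &< I(V_2,W_B,V_B;Y_2|W_1,W_2,Q)+\theta_2,\\ R_{10}+R_0+B_0+R_{22}+B_2 &< I(W_1,V_2,W_B,V_B;Y_2|W_2,Q)+\theta_2,\\ R_{20}+R_0+B_0+R_{22}+B_2 &< I(W_2,V_2,W_B,V_B;Y_2|W_1,Q)+\theta_2,\\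 R_{10}+R_{20}+R_0+B_0+R_{22}+B_2 &< I(W_1,V_2,W_2,W_B,V_B;Y_2|Q)+\theta_2. \end{aligned}$$ Then $\mathfrak{R}_i^{F\to BCCR_{cm}}$ is an inner bound on the capacity region of the network, i.e. every $(R_0,R_1,R_2)\in\mathfrak{R}_i^{F\to BCCR_{cm}}$ is achievable.
   Context: The BCCR with common message is a discrete memoryless network with three transmitters, with inputs $X_1,X_B,X_2$, and two receivers, with outputs $Y_1,Y_2$, all over finite alphabets $\mathcal{X}_1,\mathcal{X}_B,\mathcal{X}_2,\mathcal{Y}_1,\mathcal{Y}_2$. It is described by a conditional probability function $\mathbb{P}(y_1,y_2|x_1,x_B,x_2)$, used memorylessly $n$ times without feedback. There are three independent messages $M_0,M_1,M_2$, where $M_j$ is uniform on a set of size $\lceil 2^{nR_j}\rceil$. The broadcasting transmitter $X_B$ knows $(M_0,M_1,M_2)$; the relay transmitter $X_1$ knows only $M_1$; the relay transmitter $X_2$ knows only $M_2$. A length-$n$ code consists of encoders $x_1^n(M_1)$, $x_2^n(M_2)$, $x_B^n(M_0,M_1,M_2)$ and two decoders: receiver $Y_1$ estimates $(M_0,M_1)$ from $Y_1^n$ and receiver $Y_2$ estimates $(M_0,M_2)$ from $Y_2^n$. An error occurs if any of these estimates is wrong. A triple $(R_0,R_1,R_2)\in\mathbb{R}_+^3$ is achievable if there is a sequence of length-$n$ codes with these rates whose average error probability tends to $0$ as $n\to\infty$. The capacity region is the closure of the set of achievable triples; an inner bound is a subset of it consisting of achievable rates. $\mathbb{R}_+$ denotes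 the nonnegative reals. The auxiliary random variables $Q,W_1,U_1,W_2,V_2,W_B,U_B,V_B$ take values in arbitrary finite sets, and for each element of $\mathcal{P}^{BCCR}$ the outputs satisfy that $(Y_1,Y_2)$ is conditionally independent of the auxiliary variables given $(X_1,X_B,X_2)$, with conditional law $\mathbb{P}(y_1,y_2|x_1,x_B,x_2)$. $I(\cdot;\cdot|\cdot)$ is conditional mutual information (logarithms to base 2). *)

(* Defs.v *)
From mathcomp Require Import all_boot all_order all_algebra.
From mathcomp Require Import all_classical all_reals all_analysis.

Set Implicit Arguments.
Unset Strict Implicit.
Unset Printing Implicit Defensive.

Import Order.TTheory GRing.Theory Num.Theory.
Import numFieldNormedType.Exports.

Local Open Scope classical_set_scope.
Local Open Scope ring_scope.

Record fdist (R : realType) (T : finType) := FDist {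
  pmf :> T -> R ;
  pmf_ge0 : forall t, 0 <= pmf t ;
  pmf_sum1 : \sum_t pmf t = 1 }.

Section Information.
Variable R : realType.

Definition log2 (x : R) : R := ln x / ln 2.

Variables (T : finType) (P : fdist R T).

Definition prv (A : finType) (X : T -> A) (a : A) : R :=
  \sum_(t | X t == a) P t.

Definition pairrv (A B : Type) (X : T -> A) (Y : T -> B) (t : T) : A * B :=
  (X t, Y t).

(* Terms with p(a,b,c) = 0 vanish, which is the convention 0 log 0 = 0; when
   p(a,b,c) > 0 the three marginals in the logarithm are positive. *)
Definition cond_mutual_info (A B C : finType)
    (X : T -> A) (Y : T -> B) (Z : T -> C) : R :=
  \sum_(a : A) \sum_(b : B) \sum_(c : C)
    prv (pairrv (pairrv X Y) Z) (a, b, c) *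
    log2 (prv (pairrv (pairrv X Y) Z) (a, b, c) * prv Z c /
          (prv (pairrv X Z) (a, c) * prv (pairrv Y Z) (b, c))).

End Information.

Notation "[% X , Y , .. , Z ]" := (pairrv .. (pairrv X Y) .. Z)
  (at level 0, format "[%  X ,  Y ,  .. ,  Z ]").

Definition channel (R : realType) (X1 XB X2 Y1 Y2 : finType) :=
  X1 -> XB -> X2 -> fdist R (Y1 * Y2)%type.

Section Coding.
Variables (R : realType) (X1 XB X2 Y1 Y2 : finType).
Variable W : channel R X1 XB X2 Y1 Y2.

(* The ceiling is a positive integer, so the absolute value only casts it
   from int to nat. *)
Definition message (n : nat) (r : R) : finType :=
  'I_(absz (Num.ceil (2 `^ (n%:R * r)))).

Record code (n : nat) (r0 r1 r2 : R) := Code {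
  enc1 : message n r1 -> {ffun 'I_n -> X1} ;
  enc2 : message n r2 -> {ffun 'I_n -> X2} ;
  encB : message n r0 -> message n r1 -> message n r2 -> {ffun 'I_n -> XB} ;
  dec1 : {ffun 'I_n -> Y1} -> message n r0 * message n r1 ;
  dec2 : {ffun 'I_n -> Y2} -> message n r0 * message n r2 }.

Definition channel_n (n : nat) (x1 : {ffun 'I_n -> X1})
    (xB : {ffun 'I_n -> XB}) (x2 : {ffun 'I_n -> X2})
    (y1 : {ffun 'I_n -> Y1}) (y2 : {ffun 'I_n -> Y2}) : R :=
  \prod_(i < n) W (x1 i) (xB i) (x2 i) (y1 i, y2 i).

Definition error_prob (n : nat) (r0 r1 r2 : R) (c : code n r0 r1 r2) : R :=
  (\sum_(m0 : message n r0) \sum_(m1 : message n r1) \sum_(m2 : message n r2)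
     \sum_(y1 : {ffun 'I_n -> Y1})
     \sum_(y2 : {ffun 'I_n -> Y2} |
            (dec1 c y1 != (m0, m1)) || (dec2 c y2 != (m0, m2)))
       channel_n (enc1 c m1) (encB c m0 m1 m2) (enc2 c m2) y1 y2)
  / (#|message n r0| * #|message n r1| * #|message n r2|)%N%:R.

(* Triples are ordered (R_0, R_1, R_2). *)
Definition achievable : set (R * R * R) :=
  [set r | let: (r0, r1, r2) := r in
     [/\ 0 <= r0, 0 <= r1, 0 <= r2 &
       exists c : forall n, code n r0 r1 r2,
         (fun n => error_prob (c n)) @ \oo --> (0 : R)]].

Definition capacity_region : set (R * R * R) := closure achievable.

Definition inner_bound (S : set (R * R * R)) : Prop :=
  S `<=` capacity_region /\ S `<=` achievable.

End Coding.

Section Region.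
Variables (R : realType) (X1 XB X2 Y1 Y2 : finType).
Variable W : channel R X1 XB X2 Y1 Y2.
Variables (Q W1 U1 W2 V2 WB UB VB : finType).

Definition joint_space : finType :=
  (Q * W1 * U1 * W2 * V2 * WB * UB * VB * X1 * X2 * XB)%type.

(* Existence of kernels defined at every conditioning value is equivalent to
   the factorization into conditional laws of P: the kernels are unconstrained
   at conditioning values of probability zero. *)
Definition P_BCCR (P : fdist R joint_space) : Prop :=
  exists (pQ : fdist R Q)
         (p1 : Q -> fdist R (W1 * U1 * X1)%type)
         (p2 : Q -> fdist R (W2 * V2 * X2)%type)
         (pB : W1 -> U1 -> W2 -> V2 -> Q -> fdist R (WB * UB * VB)%type)
         (pXB : X1 -> X2 -> VB -> UB -> WB -> U1 -> W1 -> V2 -> W2 -> Q ->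
                fdist R XB),
  forall q w1 u1 w2 v2 wB uB vB x1 x2 xB,
    P (q, w1, u1, w2, v2, wB, uB, vB, x1, x2, xB) =
    pQ q * p1 q (w1, u1, x1) * p2 q (w2, v2, x2) *
    pB w1 u1 w2 v2 q (wB, uB, vB) *
    pXB x1 x2 vB uB wB u1 w1 v2 w2 q xB.

Definition sample_space : finType := (joint_space * (Y1 * Y2))%type.

Definition output_law (s : joint_space) : fdist R (Y1 * Y2)%type :=
  let: (_, _, _, _, _, _, _, _, x1, x2, xB) := s in W x1 xB x2.

Section WithOutputs.
Variable P : fdist R joint_space.

Definition with_outputs_pmf (t : sample_space) : R :=
  P t.1 * output_law t.1 t.2.

Lemma with_outputs_ge0 t : 0 <= with_outputs_pmf t.
Proof. by rewrite mulr_ge0 ?pmf_ge0. Qed.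

Lemma with_outputs_sum1 : \sum_t with_outputs_pmf t = 1.
Proof.
rewrite -(pair_bigA _ (fun s y => P s * output_law s y)) /=.
rewrite -[RHS](pmf_sum1 P); apply: eq_bigr => s _.
by rewrite -mulr_sumr pmf_sum1 mulr1.
Qed.

Definition with_outputs : fdist R sample_space :=
  FDist with_outputs_ge0 with_outputs_sum1.

End WithOutputs.

Definition rvQ (t : sample_space) : Q :=
  let: (q, _, _, _, _, _, _, _, _, _, _, _) := t in q.
Definition rvW1 (t : sample_space) : W1 :=
  let: (_, w1, _, _, _, _, _, _, _, _, _, _) := t in w1.
Definition rvU1 (t : sample_space) : U1 :=
  let: (_, _, u1, _, _, _, _, _, _, _, _, _) := t in u1.
Definition rvW2 (t : sample_space) : W2 :=
  let: (_, _, _, w2, _, _, _, _, _, _, _, _) := t in w2.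
Definition rvV2 (t : sample_space) : V2 :=
  let: (_, _, _, _, v2, _, _, _, _, _, _, _) := t in v2.
Definition rvWB (t : sample_space) : WB :=
  let: (_, _, _, _, _, wB, _, _, _, _, _, _) := t in wB.
Definition rvUB (t : sample_space) : UB :=
  let: (_, _, _, _, _, _, uB, _, _, _, _, _) := t in uB.
Definition rvVB (t : sample_space) : VB :=
  let: (_, _, _, _, _, _, _, vB, _, _, _, _) := t in vB.
Definition rvY1 (t : sample_space) : Y1 := t.2.1.
Definition rvY2 (t : sample_space) : Y2 := t.2.2.

Variable P : fdist R joint_space.

Local Notation "`I( X ; Y | Z )" :=
  (cond_mutual_info (with_outputs P) X Y Z)
  (at level 0, X at level 99, Y at level 99, Z at level 99).

Definition eta0 : R := `I([% rvU1, rvV2]; rvWB | [% rvW1, rvW2, rvQ]).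
Definition eta1 : R := `I(rvV2; rvUB | [% rvU1, rvW1, rvW2, rvWB, rvQ]).
Definition eta2 : R := `I(rvU1; rvVB | [% rvV2, rvW1, rvW2, rvWB, rvQ]).
Definition theta1 : R := `I(rvU1; rvWB | [% rvW1, rvW2, rvQ]).
Definition theta2 : R := `I(rvV2; rvWB | [% rvW1, rvW2, rvQ]).

Definition binning_constraints (b0 b1 b2 : R) : Prop :=
  b0 > eta0 /\
  b0 + b1 > eta0 + eta1 /\
  b0 + b2 > eta0 + eta2 /\
  b0 + b1 + b2 > eta0 + eta1 + eta2 +
    `I(rvUB; rvVB | [% rvU1, rvV2, rvW1, rvW2, rvWB, rvQ]).

Definition decoding_constraints1 (r0 r10 r11 r20 b0 b1 : R) : Prop :=
  r11 + b1 <
    `I([% rvU1, rvUB]; rvY1 | [% rvW1, rvW2, rvWB, rvQ]) + theta1 /\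
  r0 + b0 + b1 <
    `I([% rvWB, rvUB]; rvY1 | [% rvW1, rvW2, rvU1, rvQ]) + theta1 /\
  r20 + r0 + b0 + b1 <
    `I([% rvW2, rvWB, rvUB]; rvY1 | [% rvW1, rvU1, rvQ]) + theta1 /\
  r0 + b0 + r11 + b1 <
    `I([% rvU1, rvWB, rvUB]; rvY1 | [% rvW1, rvW2, rvQ]) + theta1 /\
  r20 + r0 + b0 + r11 + b1 <
    `I([% rvU1, rvW2, rvWB, rvUB]; rvY1 | [% rvW1, rvQ]) + theta1 /\
  r10 + r0 + b0 + r11 + b1 <
    `I([% rvW1, rvU1, rvWB, rvUB]; rvY1 | [% rvW2, rvQ]) + theta1 /\
  r10 + r20 + r0 + b0 + r11 + b1 <
    `I([% rvW1, rvU1, rvW2, rvWB, rvUB]; rvY1 | rvQ) + theta1.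

Definition decoding_constraints2 (r0 r10 r20 r22 b0 b2 : R) : Prop :=
  r22 + b2 <
    `I([% rvV2, rvVB]; rvY2 | [% rvW1, rvW2, rvWB, rvQ]) + theta2 /\
  r0 + b0 + b2 <
    `I([% rvWB, rvVB]; rvY2 | [% rvW1, rvW2, rvV2, rvQ]) + theta2 /\
  r10 + r0 + b0 + b2 <
    `I([% rvW1, rvWB, rvVB]; rvY2 | [% rvW2, rvV2, rvQ]) + theta2 /\
  r0 + b0 + r22 + b2 <
    `I([% rvV2, rvWB, rvVB]; rvY2 | [% rvW1, rvW2, rvQ]) + theta2 /\
  r10 + r0 + b0 + r22 + b2 <
    `I([% rvW1, rvV2, rvWB, rvVB]; rvY2 | [% rvW2, rvQ]) + theta2 /\
  r20 + r0 + b0 + r22 + b2 <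
    `I([% rvW2, rvV2, rvWB, rvVB]; rvY2 | [% rvW1, rvQ]) + theta2 /\
  r10 + r20 + r0 + b0 + r22 + b2 <
    `I([% rvW1, rvV2, rvW2, rvWB, rvVB]; rvY2 | rvQ) + theta2.

Definition region_at : set (R * R * R) :=
  [set r | let: (r0, r1, r2) := r in
     [/\ 0 <= r0, 0 <= r1, 0 <= r2 &
       exists b0 b1 b2 r10 r11 r20 r22 : R,
         (0 <= b0 /\ 0 <= b1 /\ 0 <= b2 /\
          0 <= r10 /\ 0 <= r11 /\ 0 <= r20 /\ 0 <= r22) /\
         r1 = r10 + r11 /\
         r2 = r20 + r22 /\
         binning_constraints b0 b1 b2 /\
         decoding_constraints1 r0 r10 r11 r20 b0 b1 /\
         decoding_constraints2 r0 r10 r20 r22 b0 b2]].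

End Region.

Definition rate_region (R : realType) (X1 XB X2 Y1 Y2 : finType)
    (W : channel R X1 XB X2 Y1 Y2) : set (R * R * R) :=
  [set r | exists (Q W1 U1 W2 V2 WB UB VB : finType)
      (P : fdist R (joint_space X1 XB X2 Q W1 U1 W2 V2 WB UB VB)),
      P_BCCR P /\ region_at W P r].

(* Main.v *)
(** Random superposition coding with binning, where typicality is replaced by weights
    and change of measure. Given the codebooks, the broadcasting transmitter sends, for
    each message triple, the input word that minimizes the error probability. This is at
    most the error averaged over the bin cells [(b0, b1, b2)], each weighted by the
    likelihood ratio [om] of the target law of [(WB, UB, VB)] to the law of the codebook,
    followed by a random choice of [XB]. In the ensemble average each weighted cell is
    distributed as the true single-letter variables, up to truncation, and all other
    codewords are drawn afresh; so the receivers face seven kinds of confusion each, which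
    give the decoding constraints. The binning constraints are what makes the total weight
    of the cells concentrate around [1], by a second moment computation. Exponential
    Markov bounds turn the conditions on expected log-likelihood ratios, that is on
    mutual informations, into exponentially small probabilities. *)

Require Import Defs.
From mathcomp Require Import all_boot all_order all_algebra.
From mathcomp Require Import all_classical all_reals all_analysis.
From mathcomp Require Import ring lra.

Set Implicit Arguments.
Unset Strict Implicit.
Unset Printing Implicit Defensive.

Import Order.TTheory GRing.Theory Num.Theory.
Import numFieldNormedType.Exports.
(* Re-imported because mathcomp-analysis shadows [pmf_ge0]. *)
Import Defs.

Local Open Scope ring_scope.

(** * Expectations over finite laws and random codebooks *)

(** The obstacle is that the target law of [(WB, UB, VB)] depends on both relay codewords at once,
    whereas a codebook can draw [WB] only given [(W1, W2)], [UB] only given [(W1, W2, WB, U)] and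
    [VB] only given [(W1, W2, WB, V)]. Under the target law the likelihood ratios for [WB],
    [(WB, UB)], [(WB, VB)] and [(WB, UB, VB)] have expected logarithms [eta0], [eta0 + eta1],
    [eta0 + eta2] and the full sum including the information between [UB] and [VB]; these are the
    four binning bounds, one for each way in which two cells can share codewords. The same mismatch
    produces [theta1] and [theta2]: given [(W1, W2)] the codebook draws [WB] independently of [U],
    so a receiver that tests the target law against the codebook law gains [I(U1; WB | W1, W2, Q)].
    The error bound is one-shot. Words of length [n] are its letters, and the product structure
    serves only to evaluate its terms. The time-sharing word is a fixed parameter of every codebook;
    the tail bounds hold on average over it, so it is selected last. *)

Section Expectation.
Variable R : realType.

Lemma le_of_eq (x y : R) : x = y -> x <= y.
Proof. by move=> ->. Qed.

Definition Ex (T : finType) (p : fdist R T) (f : T -> R) : R :=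
  \sum_t p t * f t.

Section Basic.
Variables (T : finType) (p : fdist R T).
Implicit Types (f g : T -> R) (a : R).

Lemma eq_Ex f g : f =1 g -> Ex p f = Ex p g.
Proof. by move=> fg; apply: eq_bigr => t _; rewrite fg. Qed.

Lemma Ex_ge0 f : (forall t, 0 <= f t) -> 0 <= Ex p f.
Proof. by move=> f0; apply: sumr_ge0 => t _; rewrite mulr_ge0 ?pmf_ge0 ?f0. Qed.

Lemma le_Ex_supp f g : (forall t, 0 < p t -> f t <= g t) -> Ex p f <= Ex p g.
Proof.
move=> fg; apply: ler_sum => t _.
have := pmf_ge0 p t; rewrite le_eqVlt => /predU1P[<-|pt]; first by rewrite !mul0r.
by rewrite ler_pM2l // fg.
Qed.

Lemma le_Ex f g : (forall t, f t <= g t) -> Ex p f <= Ex p g.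
Proof. by move=> fg; apply: le_Ex_supp. Qed.

Lemma Ex_cst a : Ex p (fun=> a) = a.
Proof. by rewrite /Ex -mulr_suml pmf_sum1 mul1r. Qed.

Lemma Ex_le_cst f a : (forall t, f t <= a) -> Ex p f <= a.
Proof. by move=> fa; rewrite -[leRHS]Ex_cst; exact: le_Ex. Qed.

Lemma ExD f g : Ex p (fun t => f t + g t) = Ex p f + Ex p g.
Proof. by rewrite /Ex -big_split; apply: eq_bigr => t _; rewrite mulrDr. Qed.

Lemma ExZl a f : Ex p (fun t => a * f t) = a * Ex p f.
Proof. by rewrite /Ex mulr_sumr; apply: eq_bigr => t _; rewrite mulrCA. Qed.

Lemma ExZr a f : Ex p (fun t => f t * a) = Ex p f * a.
Proof. by rewrite /Ex mulr_suml; apply: eq_bigr => t _; rewrite mulrA. Qed.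

Lemma Ex_sum (I : Type) (r : seq I) (P : pred I) (F : I -> T -> R) :
  Ex p (fun t => \sum_(i <- r | P i) F i t) = \sum_(i <- r | P i) Ex p (F i).
Proof. by rewrite /Ex exchange_big; apply: eq_bigr => t _; rewrite mulr_sumr. Qed.

Lemma pmf_inhabited : exists t : T, 0 < p t.
Proof.
apply/not_existsP => p0; have := pmf_sum1 p; rewrite big1 => [/esym/eqP|t _].
  by rewrite oner_eq0.
by apply: le_anti; rewrite pmf_ge0 andbT leNgt; apply/negP/p0.
Qed.

Lemma Ex_exists_le f r : Ex p f <= r -> exists t, f t <= r.
Proof.
move=> Er; apply/not_existsP => fgt.
have {}fgt t : r < f t by rewrite ltNge; apply/negP/fgt.
have [t pt] := pmf_inhabited.
move: Er; rewrite leNgt -{1}(Ex_cst r) => /negP; apply.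
rewrite /Ex (bigD1 t) // [X in _ < X](bigD1 t) //= ltr_leD //.
  by rewrite ltr_pM2l.
by apply: ler_sum => u _; rewrite ler_wpM2l ?pmf_ge0 // ltW.
Qed.

End Basic.

Lemma Ex_swap (S T : finType) (p : fdist R S) (q : fdist R T) (f : S -> T -> R) :
  Ex p (fun s => Ex q (f s)) = Ex q (fun t => Ex p (f^~ t)).
Proof.
rewrite {1}/Ex; under eq_bigr do rewrite -ExZl.
by rewrite -Ex_sum.
Qed.

Section Family.
Variables (I A : finType) (k : I -> fdist R A).

Definition fam_pmf (c : {ffun I -> A}) : R := \prod_i k i (c i).

Lemma fam_pmf_ge0 c : 0 <= fam_pmf c.
Proof. by apply: prodr_ge0 => i _; exact: pmf_ge0. Qed.

Lemma fam_pmf_sum1 : \sum_c fam_pmf c = 1.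
Proof.
rewrite /fam_pmf -(bigA_distr_bigA (fun i a => k i a)).
by rewrite big1 // => i _; exact: pmf_sum1.
Qed.

(** Independent entries whose law may depend on the index. This models one layer of a codebook given
    the layers above it, and also a word of length [n]. *)
Definition fam : fdist R {ffun I -> A} := FDist fam_pmf_ge0 fam_pmf_sum1.

Lemma fam_gt0 (c : {ffun I -> A}) i : 0 < fam c -> 0 < k i (c i).
Proof.
rewrite lt0r => /andP[/prodf_neq0/(_ i isT) ki _].
by rewrite lt0r ki pmf_ge0.
Qed.

Lemma Ex_fam_prod (f : I -> A -> R) :
  Ex fam (fun c => \prod_i f i (c i)) = \prod_i Ex (k i) (f i).
Proof.
rewrite /Ex /=; under eq_bigr do rewrite /fam_pmf -big_split /=.
by rewrite -(bigA_distr_bigA (fun i a => k i a * f i a)).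
Qed.

Lemma Ex_fam2M i j (f g : A -> R) : i != j ->
  Ex fam (fun c => f (c i) * g (c j)) = Ex (k i) f * Ex (k j) g.
Proof.
move=> ij.
(* Padding with factors [1] turns the two entries into a product over all indices. *)
pose h l a := if l == i then f a else if l == j then g a else 1.
have hE (c : {ffun I -> A}) : f (c i) * g (c j) = \prod_l h l (c l).
  rewrite (bigD1 i) //= (bigD1 j) 1?eq_sym //= big1 => [|l /andP[li lj]].
    by rewrite /h eqxx eq_sym (negbTE ij) eqxx mulr1.
  by rewrite /h (negbTE li) (negbTE lj).
rewrite (eq_Ex _ hE) Ex_fam_prod (bigD1 i) //= (bigD1 j) 1?eq_sym //=.
rewrite big1 => [|l /andP[li lj]]; last first.
  by rewrite /h (negbTE li) (negbTE lj) Ex_cst.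
by rewrite /h eqxx eq_sym (negbTE ij) eqxx mulr1.
Qed.

Lemma Ex_fam1 i (f : A -> R) : Ex fam (fun c => f (c i)) = Ex (k i) f.
Proof.
pose h l a := if l == i then f a else 1.
have hE (c : {ffun I -> A}) : f (c i) = \prod_l h l (c l).
  rewrite (bigD1 i) //= big1 => [|l li]; first by rewrite /h eqxx mulr1.
  by rewrite /h (negbTE li).
rewrite (eq_Ex _ hE) Ex_fam_prod (bigD1 i) //= big1 => [|l li].
  by rewrite /h eqxx mulr1.
by rewrite /h (negbTE li) Ex_cst.
Qed.

Lemma Ex_fam2 i j (f : A -> A -> R) : i != j ->
  Ex fam (fun c => f (c i) (c j)) = Ex (k i) (fun a => Ex (k j) (f a)).
Proof.
move=> ij.
(* A function of two entries is a finite sum of products of functions of one entry. *)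
have fE (c : {ffun I -> A}) :
    f (c i) (c j) = \sum_b (f (c i) b) * (c j == b)%:R.
  rewrite (bigD1 (c j)) //= eqxx mulr1 big1 ?addr0 // => b bj.
  by rewrite eq_sym (negbTE bj) mulr0.
rewrite (eq_Ex _ fE) Ex_sum.
under eq_bigr do rewrite (Ex_fam2M (f^~ _) (fun a => (a == _)%:R)) //.
rewrite {3}/Ex.
transitivity (\sum_b Ex (k i) (f^~ b) * k j b).
  apply: eq_bigr => b _; congr (_ * _).
  rewrite /Ex (bigD1 b) //= eqxx mulr1 big1 ?addr0 // => a ab.
  by rewrite (negbTE ab) mulr0.
under eq_bigr do rewrite -ExZr.
rewrite -Ex_sum; apply: eq_bigr => a _; congr (_ * _).
by apply: eq_bigr => b _; rewrite mulrC.
Qed.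

End Family.

End Expectation.

(** * Random superposition codebooks *)

Section Ensemble.
Variables (R : realType) (W1 W2 U V WB UB VB : finType).
Variables (k1 : fdist R W1) (k1' : fdist R W2).
Variables (k2 : W1 -> fdist R U) (k2' : W2 -> fdist R V).
Variable k4 : W1 -> W2 -> fdist R WB.
Variables (k5 : W1 -> W2 -> WB -> U -> fdist R UB).
Variables (k6 : W1 -> W2 -> WB -> V -> fdist R VB).

(** One tuple of codewords, drawn by the codebook kernels. Any change of measure towards the target
    law is carried by [G]. *)
Definition single (G : W1 -> W2 -> U -> V -> WB -> UB -> VB -> R) : R :=
  Ex k1 (fun w1 => Ex k1' (fun w2 => Ex (k2 w1) (fun u => Ex (k2' w2) (fun v =>
  Ex (k4 w1 w2) (fun wB => Ex (k5 w1 w2 wB u) (fun ub =>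
  Ex (k6 w1 w2 wB v) (fun vb => G w1 w2 u v wB ub vb))))))).

Variables (M1 M2 M11 M22 I B1 B2 : finType) (pi1 : I -> M1) (pi2 : I -> M2).

(** [M1] and [M2] index the parts of the relay messages that both receivers decode, [M11] and [M22]
    the private parts. An index of a [WB] codeword determines its parents through [pi1] and [pi2].
    Each [fam] has a law that depends on the layers already drawn, hence the nesting. *)
Definition ensemble
   (F : {ffun M1 -> W1} -> {ffun M2 -> W2} -> {ffun M1 * M11 -> U} ->
        {ffun M2 * M22 -> V} -> {ffun I -> WB} ->
        {ffun I * M11 * B1 -> UB} -> {ffun I * M22 * B2 -> VB} -> R) : R :=
  Ex (fam (fun=> k1)) (fun c1 => Ex (fam (fun=> k1')) (fun c2 =>
  Ex (fam (fun j => k2 (c1 j.1))) (fun d1 =>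
  Ex (fam (fun j => k2' (c2 j.1))) (fun d2 =>
  Ex (fam (fun i => k4 (c1 (pi1 i)) (c2 (pi2 i)))) (fun cB =>
  Ex (fam (fun j => k5 (c1 (pi1 j.1.1)) (c2 (pi2 j.1.1)) (cB j.1.1)
                       (d1 (pi1 j.1.1, j.1.2)))) (fun uB =>
  Ex (fam (fun j => k6 (c1 (pi1 j.1.1)) (c2 (pi2 j.1.1)) (cB j.1.1)
                       (d2 (pi2 j.1.1, j.1.2)))) (fun vB =>
    F c1 c2 d1 d2 cB uB vB))))))).

Variable G : W1 -> W2 -> U -> V -> WB -> UB -> VB -> R.
Hypothesis G0 : forall w1 w2 u v wB ub vb, 0 <= G w1 w2 u v wB ub vb.

Let G5 w1 w2 u v wB :=
  Ex (k5 w1 w2 wB u) (fun ub => Ex (k6 w1 w2 wB v) (G w1 w2 u v wB ub)).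
Let G4 w1 w2 u v := Ex (k4 w1 w2) (G5 w1 w2 u v).
Let G3 w1 w2 u := Ex (k2' w2) (G4 w1 w2 u).
Let G2 w1 w2 := Ex (k2 w1) (G3 w1 w2).

Let G5_ge0 w1 w2 u v wB : 0 <= G5 w1 w2 u v wB.
Proof. by apply: Ex_ge0 => ub; apply: Ex_ge0 => vb; exact: G0. Qed.

Let G4_ge0 w1 w2 u v : 0 <= G4 w1 w2 u v.
Proof. by apply: Ex_ge0 => wB; exact: G5_ge0. Qed.

Let G3_ge0 w1 w2 u : 0 <= G3 w1 w2 u.
Proof. by apply: Ex_ge0 => v; exact: G4_ge0. Qed.

Let G2_ge0 w1 w2 : 0 <= G2 w1 w2.
Proof. by apply: Ex_ge0 => u; exact: G3_ge0. Qed.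

Variables (i : I) (m11 : M11) (m22 : M22) (b1 : B1) (b2 : B2).

(** Each layer is read at one index only, so the other entries integrate to [1], from the innermost
    layer outwards. *)
Lemma ensemble_single :
  ensemble (fun c1 c2 d1 d2 cB uB vB =>
    G (c1 (pi1 i)) (c2 (pi2 i)) (d1 (pi1 i, m11)) (d2 (pi2 i, m22)) (cB i)
      (uB (i, m11, b1)) (vB (i, m22, b2))) = single G.
Proof.
rewrite /ensemble /single.
transitivity (Ex (fam (fun=> k1)) (fun c1 => Ex (fam (fun=> k1')) (fun c2 =>
    G2 (c1 (pi1 i)) (c2 (pi2 i))))); last first.
  under eq_Ex do rewrite (Ex_fam1 _ _ (G2 _)).
  by rewrite (Ex_fam1 _ _ (fun w1 => Ex _ (G2 w1))).
apply: eq_Ex => c1; apply: eq_Ex => c2.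
transitivity (Ex (fam (fun j : M1 * M11 => k2 (c1 j.1))) (fun d1 =>
    G3 (c1 (pi1 i)) (c2 (pi2 i)) (d1 (pi1 i, m11)))); last exact: Ex_fam1.
apply: eq_Ex => d1.
transitivity (Ex (fam (fun j : M2 * M22 => k2' (c2 j.1))) (fun d2 =>
    G4 (c1 (pi1 i)) (c2 (pi2 i)) (d1 (pi1 i, m11)) (d2 (pi2 i, m22))));
  last exact: Ex_fam1.
apply: eq_Ex => d2.
rewrite -[RHS](Ex_fam1 (fun i => k4 (c1 (pi1 i)) (c2 (pi2 i))) i).
apply: eq_Ex => cB.
under eq_Ex do rewrite (Ex_fam1 _ (i, m22, b2) (G _ _ _ _ _ _)).
by rewrite (Ex_fam1 _ (i, m11, b1) (fun ub => Ex _ (G _ _ _ _ _ ub))).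
Qed.

Variable A : W1 -> W2 -> WB -> U -> UB -> R.

Let A5 w1 w2 u wB := Ex (k5 w1 w2 wB u) (A w1 w2 wB u).
Let A4 w1 w2 u := Ex (k4 w1 w2) (A5 w1 w2 u).
Let A3 w1 w2 := Ex (k2 w1) (A4 w1 w2).

Variables D1 D2 D3 D4 D5 D6 D7 : R.
Hypothesis A_D1 : forall w1 w2 wB, Ex (k2 w1) (fun u => A5 w1 w2 u wB) <= D1.
Hypothesis A_D2 : forall w1 w2 u, A4 w1 w2 u <= D2.
Hypothesis A_D3 : forall w1 u, Ex k1' (fun w2 => A4 w1 w2 u) <= D3.
Hypothesis A_D4 : forall w1 w2, A3 w1 w2 <= D4.
Hypothesis A_D5 : forall w1, Ex k1' (A3 w1) <= D5.
Hypothesis A_D6 : forall w2, Ex k1 (fun w1 => A3 w1 w2) <= D6.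
Hypothesis A_D7 : Ex k1 (fun w1 => Ex k1' (A3 w1)) <= D7.

Variables (i' : I) (m11' : M11) (b1' : B1).

(** The cases record which codewords a wrong index shares with the true one. A shared codeword is
    correlated with the output and stays a parameter in [A_D1] to [A_D7]; the others are averaged
    out. Once [pi1] differs, the [U] codeword is fresh for every [m11'], whence a single case for
    each value of the last test. *)
Definition confusion_bound : R :=
  if i' == i then D1
  else if pi1 i' == pi1 i then
    if pi2 i' == pi2 i then if m11' == m11 then D2 else D4
    else if m11' == m11 then D3 else D5
  else if pi2 i' == pi2 i then D6 else D7.

Let F5 w1 w2 u v wB w1' w2' u' wB' : R := G5 w1 w2 u v wB * A5 w1' w2' u' wB'.

(** Given the shared codewords, the true and the wrong tuple are independent, so the factor of the
    wrong tuple can be bounded conditionally and taken out. The hypothesis makes the two [UB]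
    entries distinct for every [b1']. *)
Lemma ensemble_confusion : (i', m11') != (i, m11) ->
  ensemble (fun c1 c2 d1 d2 cB uB vB =>
    G (c1 (pi1 i)) (c2 (pi2 i)) (d1 (pi1 i, m11)) (d2 (pi2 i, m22)) (cB i)
      (uB (i, m11, b1)) (vB (i, m22, b2)) *
    A (c1 (pi1 i')) (c2 (pi2 i')) (cB i') (d1 (pi1 i', m11')) (uB (i', m11', b1')))
  <= single G * confusion_bound.
Proof.
move=> neq.
have -> : ensemble (fun c1 c2 d1 d2 cB uB vB =>
    G (c1 (pi1 i)) (c2 (pi2 i)) (d1 (pi1 i, m11)) (d2 (pi2 i, m22)) (cB i)
      (uB (i, m11, b1)) (vB (i, m22, b2)) *
    A (c1 (pi1 i')) (c2 (pi2 i')) (cB i') (d1 (pi1 i', m11')) (uB (i', m11', b1')))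
  = Ex (fam (fun=> k1)) (fun c1 => Ex (fam (fun=> k1')) (fun c2 =>
    Ex (fam (fun j => k2 (c1 j.1))) (fun d1 =>
    Ex (fam (fun j => k2' (c2 j.1))) (fun d2 =>
    Ex (fam (fun i => k4 (c1 (pi1 i)) (c2 (pi2 i)))) (fun cB =>
      F5 (c1 (pi1 i)) (c2 (pi2 i)) (d1 (pi1 i, m11)) (d2 (pi2 i, m22)) (cB i)
         (c1 (pi1 i')) (c2 (pi2 i')) (d1 (pi1 i', m11')) (cB i')))))).
  apply: eq_Ex => c1; apply: eq_Ex => c2; apply: eq_Ex => d1; apply: eq_Ex => d2.
  apply: eq_Ex => cB.
  (* [A] does not involve the [VB] layer, and the two [UB] entries are independent. *)
  under eq_Ex do rewrite ExZr (Ex_fam1 _ (i, m22, b2) (G _ _ _ _ _ _)).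
  rewrite (Ex_fam2M _ (i := (i, m11, b1)) (j := (i', m11', b1'))
    (fun ub => Ex _ (G _ _ _ _ _ ub)) (A _ _ _ _)) //.
  by apply: contraNneq neq => -[-> -> _].
have -> : single G = Ex k1 (fun w1 => Ex k1' (G2 w1)) by [].
rewrite /confusion_bound; case: (eqVneq i' i) neq => [->|ni] neq.
  (* Same [WB] codeword: only the [U] codeword of the wrong tuple and the [UB] codeword below it are
     fresh. *)
  have {}neq : m11 != m11' by apply: contraNneq neq => ->.
  apply: (@le_trans _ _ (Ex (fam (fun=> k1)) (fun c1 => Ex (fam (fun=> k1'))
      (fun c2 => G2 (c1 (pi1 i)) (c2 (pi2 i)) * D1)))); last first.
    under eq_Ex do rewrite ExZr (Ex_fam1 _ _ (G2 _)).
    by rewrite ExZr (Ex_fam1 _ _ (fun w1 => Ex _ (G2 w1))).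
  apply: le_Ex => c1; apply: le_Ex => c2; rewrite /F5.
  under eq_Ex => d1.
    under eq_Ex do rewrite (Ex_fam1 _ i (fun wB => G5 _ _ _ _ wB * A5 _ _ _ wB)).
    rewrite (Ex_fam1 _ (pi2 i, m22) (fun v => Ex _ (fun wB => G5 _ _ _ v wB * A5 _ _ _ wB))).
    over.
  rewrite (Ex_fam2 _ (i := (pi1 i, m11)) (j := (pi1 i, m11'))
    (fun u u' => Ex _ (fun v => Ex _ (fun wB => G5 _ _ u v wB * A5 _ _ u' wB)))) /=; last first.
    by apply: contraNneq neq => -[->].
  rewrite /G2 -ExZr; apply: le_Ex => u.
  rewrite Ex_swap -ExZr; apply: le_Ex => v.
  rewrite Ex_swap /G4 -ExZr; apply: le_Ex => wB.
  by rewrite ExZl ler_wpM2l.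
(* With distinct [WB] indices the layers of [WB] and [V] integrate out in the same way in all six
   remaining cases. *)
have {neq}Hd2 c1 c2 d1 : Ex (fam (fun j => k2' (c2 j.1))) (fun d2 =>
    Ex (fam (fun i => k4 (c1 (pi1 i)) (c2 (pi2 i)))) (fun cB =>
      F5 (c1 (pi1 i)) (c2 (pi2 i)) (d1 (pi1 i, m11)) (d2 (pi2 i, m22)) (cB i)
         (c1 (pi1 i')) (c2 (pi2 i')) (d1 (pi1 i', m11')) (cB i'))) =
    G3 (c1 (pi1 i)) (c2 (pi2 i)) (d1 (pi1 i, m11)) *
    A4 (c1 (pi1 i')) (c2 (pi2 i')) (d1 (pi1 i', m11')).
  under eq_Ex do rewrite (Ex_fam2M _ (G5 _ _ _ _) (A5 _ _ _)) 1?eq_sym //.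
  by rewrite ExZr (Ex_fam1 _ (pi2 i, m22) (fun v => Ex _ (G5 _ _ _ v))).
under eq_Ex do under eq_Ex do under eq_Ex do rewrite Hd2.
have Hd1 (c1 : {ffun M1 -> W1}) (c2 : {ffun M2 -> W2}) : (pi1 i', m11') != (pi1 i, m11) ->
    Ex (fam (fun j => k2 (c1 j.1))) (fun d1 =>
      G3 (c1 (pi1 i)) (c2 (pi2 i)) (d1 (pi1 i, m11)) *
      A4 (c1 (pi1 i')) (c2 (pi2 i')) (d1 (pi1 i', m11'))) =
    G2 (c1 (pi1 i)) (c2 (pi2 i)) * A3 (c1 (pi1 i')) (c2 (pi2 i')).
  by move=> neq; rewrite (Ex_fam2M _ (G3 _ _) (A4 _ _)) 1?eq_sym.
case: (eqVneq (pi1 i') (pi1 i)) Hd1 => [->|n1] Hd1.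
  case: (eqVneq m11' m11) Hd1 => [->|n11] Hd1.
    (* Here the two factors share the codeword [u], so they cannot be averaged separately over
       it. *)
    have {}Hd1 (c1 : {ffun M1 -> W1}) (c2 : {ffun M2 -> W2}) :
        Ex (fam (fun j => k2 (c1 j.1))) (fun d1 =>
          G3 (c1 (pi1 i)) (c2 (pi2 i)) (d1 (pi1 i, m11)) *
          A4 (c1 (pi1 i)) (c2 (pi2 i')) (d1 (pi1 i, m11))) =
        Ex (k2 (c1 (pi1 i))) (fun u => G3 (c1 (pi1 i)) (c2 (pi2 i)) u *
                                       A4 (c1 (pi1 i)) (c2 (pi2 i')) u).
      by rewrite (Ex_fam1 _ (pi1 i, m11) (fun u => G3 _ _ u * A4 _ _ u)).
    under eq_Ex do under eq_Ex do rewrite Hd1.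
    case: (eqVneq (pi2 i') (pi2 i)) => [->|n2].
      under eq_Ex do rewrite (Ex_fam1 _ _ (fun w2 => Ex _ (fun u => G3 _ w2 u * A4 _ w2 u))).
      rewrite (Ex_fam1 _ _ (fun w1 => Ex _ (fun w2 => Ex (k2 w1)
        (fun u => G3 w1 w2 u * A4 w1 w2 u)))).
      rewrite -ExZr; apply: le_Ex => w1; rewrite -ExZr; apply: le_Ex => w2.
      by rewrite -ExZr; apply: le_Ex => u; rewrite ler_wpM2l.
    under eq_Ex do rewrite (Ex_fam2 _ (fun w2 w2' => Ex _ (fun u => G3 _ w2 u * A4 _ w2' u)))
      1?eq_sym //.
    rewrite (Ex_fam1 _ _ (fun w1 => Ex _ (fun w2 => Ex _ (fun w2' => Ex (k2 w1)
      (fun u => G3 w1 w2 u * A4 w1 w2' u))))).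
    rewrite -ExZr; apply: le_Ex => w1; rewrite -ExZr; apply: le_Ex => w2.
    (* Only the second copy of [w2] is fresh, and [A_D3] averages it at fixed [u]; hence the
       exchange. *)
    rewrite Ex_swap -ExZr; apply: le_Ex => u.
    by rewrite ExZl ler_wpM2l.
  under eq_Ex do under eq_Ex do rewrite Hd1 ?xpair_eqE ?negb_and ?n11 ?orbT //.
  case: (eqVneq (pi2 i') (pi2 i)) => [->|n2].
    under eq_Ex do rewrite (Ex_fam1 _ _ (fun w2 => G2 _ w2 * A3 _ w2)).
    rewrite (Ex_fam1 _ _ (fun w1 => Ex _ (fun w2 => G2 w1 w2 * A3 w1 w2))).
    rewrite -ExZr; apply: le_Ex => w1; rewrite -ExZr; apply: le_Ex => w2.
    by rewrite ler_wpM2l.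
  under eq_Ex do rewrite (Ex_fam2M _ (G2 _) (A3 _)) 1?eq_sym //.
  rewrite (Ex_fam1 _ _ (fun w1 => Ex _ (G2 w1) * Ex _ (A3 w1))).
  by rewrite -ExZr; apply: le_Ex => w1; rewrite ler_wpM2l // Ex_ge0.
under eq_Ex do under eq_Ex do rewrite Hd1 ?xpair_eqE ?negb_and ?n1 //.
case: (eqVneq (pi2 i') (pi2 i)) => [->|n2].
  under eq_Ex do rewrite (Ex_fam1 _ _ (fun w2 => G2 _ w2 * A3 _ w2)).
  rewrite (Ex_fam2 _ (fun w1 w1' => Ex _ (fun w2 => G2 w1 w2 * A3 w1' w2))) 1?eq_sym //.
  rewrite -ExZr; apply: le_Ex => w1; rewrite Ex_swap -ExZr; apply: le_Ex => w2.
  by rewrite ExZl ler_wpM2l.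
under eq_Ex do rewrite (Ex_fam2M _ (G2 _) (A3 _)) 1?eq_sym //.
rewrite (Ex_fam2M _ (fun w1 => Ex _ (G2 w1)) (fun w1 => Ex _ (A3 w1))) 1?eq_sym //.
by rewrite ler_wpM2l // Ex_ge0 // => w1; rewrite Ex_ge0.
Qed.

End Ensemble.

(** * Concentration of the weight of a bin *)

Section SecondMoment.
Variables (R : realType) (WB UB VB B0 B1 B2 I J5 J6 : finType).
Variables (p4 : fdist R WB) (p5 : WB -> fdist R UB) (p6 : WB -> fdist R VB).
Variables (K4 : I -> fdist R WB) (K5 : {ffun I -> WB} -> J5 -> fdist R UB).
Variable K6 : {ffun I -> WB} -> J6 -> fdist R VB.
Variables (idx : B0 -> I) (idx5 : B0 -> B1 -> J5) (idx6 : B0 -> B2 -> J6).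
Hypothesis idx_inj : injective idx.
Hypothesis idx5_inj : forall b b' b1 b1', idx5 b b1 = idx5 b' b1' -> b = b' /\ b1 = b1'.
Hypothesis idx6_inj : forall b b' b2 b2', idx6 b b2 = idx6 b' b2' -> b = b' /\ b2 = b2'.
Hypothesis K4E : forall b, K4 (idx b) = p4.
Hypothesis K5E : forall c b b1, K5 c (idx5 b b1) = p5 (c (idx b)).
Hypothesis K6E : forall c b b2, K6 c (idx6 b b2) = p6 (c (idx b)).
Variable om : WB -> UB -> VB -> R.
Variables T0 T1 T2 T3 : R.
Hypothesis T0_ge0 : 0 <= T0.
Hypothesis T1_ge0 : 0 <= T1.
Hypothesis T2_ge0 : 0 <= T2.
Hypothesis T3_ge0 : 0 <= T3.
Hypothesis om_T0 :
  Ex p4 (fun wB => Ex (p5 wB) (fun ub => Ex (p6 wB) (om wB ub)) ^+ 2) <= T0.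
Hypothesis om_T1 :
  Ex p4 (fun wB => Ex (p5 wB) (fun ub => Ex (p6 wB) (om wB ub) ^+ 2)) <= T1.
Hypothesis om_T2 :
  Ex p4 (fun wB => Ex (p6 wB) (fun vb => Ex (p5 wB) (fun ub => om wB ub vb) ^+ 2)) <= T2.
Hypothesis om_T3 :
  Ex p4 (fun wB => Ex (p5 wB) (fun ub => Ex (p6 wB) (fun vb => om wB ub vb ^+ 2))) <= T3.

Definition layers (F : {ffun I -> WB} -> {ffun J5 -> UB} -> {ffun J6 -> VB} -> R) : R :=
  Ex (fam K4) (fun cB => Ex (fam (K5 cB)) (fun uB => Ex (fam (K6 cB)) (F cB uB))).

Definition cell (cB : {ffun I -> WB}) (uB : {ffun J5 -> UB}) (vB : {ffun J6 -> VB})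
    (l : B0 * B1 * B2) : R :=
  om (cB (idx l.1.1)) (uB (idx5 l.1.1 l.1.2)) (vB (idx6 l.1.1 l.2)).

Let s := Ex p4 (fun wB => Ex (p5 wB) (fun ub => Ex (p6 wB) (om wB ub))).

Lemma layers_cell l : layers (fun cB uB vB => cell cB uB vB l) = s.
Proof.
transitivity (Ex (fam K4) (fun cB => Ex (p5 (cB (idx l.1.1))) (fun ub =>
    Ex (p6 (cB (idx l.1.1))) (om (cB (idx l.1.1)) ub)))); last first.
  by rewrite (Ex_fam1 _ _ (fun wB => Ex (p5 wB) (fun ub => Ex (p6 wB) (om wB ub)))) K4E.
apply: eq_Ex => cB; rewrite -(K5E _ _ l.1.2) -Ex_fam1; apply: eq_Ex => uB.
by rewrite -(K6E _ _ l.2) -Ex_fam1.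
Qed.

(** Cells with distinct [b0] share no entry and are independent, which leaves [s ^+ 2]. Cells with
    the same [b0] share their [WB] codeword, and also that of [UB] or of [VB] when [b1] or [b2]
    agree; [T0] to [T3] are the moments for these four patterns. Where several indicators are on,
    one term suffices and the others are nonnegative. *)
Lemma layers_cell2 l l' :
  layers (fun cB uB vB => cell cB uB vB l * cell cB uB vB l') <=
  s ^+ 2 + (l.1.1 == l'.1.1)%:R *
    (T0 + (l.1.2 == l'.1.2)%:R * T1 + (l.2 == l'.2)%:R * T2 +
     (l.1.2 == l'.1.2)%:R * (l.2 == l'.2)%:R * T3).
Proof.
case: l l' => [[b b1] b2] [[b' b1'] b2']; rewrite /cell /layers /=.
have [<-|nb] := eqVneq b b'; last first.
  rewrite mul0r addr0; apply: le_of_eq.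
  transitivity (Ex (fam K4) (fun cB =>
      Ex (p5 (cB (idx b))) (fun ub => Ex (p6 (cB (idx b))) (om (cB (idx b)) ub)) *
      Ex (p5 (cB (idx b'))) (fun ub => Ex (p6 (cB (idx b'))) (om (cB (idx b')) ub)))).
    apply: eq_Ex => cB.
    have n6 : idx6 b b2 != idx6 b' b2' by apply: contraNneq nb => /idx6_inj[->].
    under eq_Ex do rewrite (Ex_fam2M _ (om _ _) (om _ _) n6) !K6E.
    rewrite (Ex_fam2M _ (i := idx5 b b1) (j := idx5 b' b1')
      (fun ub => Ex _ (om _ ub)) (fun ub => Ex _ (om _ ub))) ?K5E //.
    by apply: contraNneq nb => /idx5_inj[->].
  rewrite (Ex_fam2M _ (fun wB => Ex (p5 wB) (fun ub => Ex (p6 wB) (om wB ub)))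
    (fun wB => Ex (p5 wB) (fun ub => Ex (p6 wB) (om wB ub)))) ?K4E //.
  by apply: contraNneq nb => /idx_inj ->.
rewrite mul1r.
have s20 : 0 <= s ^+ 2 by exact: sqr_ge0.
have K4' (f : WB -> R) : Ex p4 f = Ex (fam K4) (fun cB => f (cB (idx b))).
  by rewrite Ex_fam1 K4E.
have [<-|n1] := eqVneq b1 b1'; have [<-|n2] := eqVneq b2 b2'.
- apply: (@le_trans _ _ T3); last first.
    by rewrite ?(mulr1n, mulr0n, mul1r, mul0r) ler_wpDl //;
    move: T0_ge0 T1_ge0 T2_ge0 T3_ge0; lra.
  apply: le_trans om_T3; rewrite K4'; apply: le_of_eq.
  apply: eq_Ex => cB; rewrite -(K5E _ _ b1) -Ex_fam1; apply: eq_Ex => uB.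
  by rewrite -(K6E _ _ b2) -Ex_fam1.
- apply: (@le_trans _ _ T1); last first.
    by rewrite ?(mulr1n, mulr0n, mul1r, mul0r) ler_wpDl //;
    move: T0_ge0 T1_ge0 T2_ge0 T3_ge0; lra.
  apply: le_trans om_T1; rewrite K4'; apply: le_of_eq.
  apply: eq_Ex => cB; rewrite -(K5E _ _ b1) -Ex_fam1; apply: eq_Ex => uB.
  rewrite (Ex_fam2M _ (i := idx6 b b2) (j := idx6 b b2') (om _ _) (om _ _)) ?K6E //.
  by apply: contraNneq n2 => /idx6_inj[_ ->].
- apply: (@le_trans _ _ T2); last first.
    by rewrite ?(mulr1n, mulr0n, mul1r, mul0r) ler_wpDl //;
    move: T0_ge0 T1_ge0 T2_ge0 T3_ge0; lra.
  apply: le_trans om_T2; rewrite K4'; apply: le_of_eq.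
  apply: eq_Ex => cB.
  under eq_Ex do rewrite (Ex_fam1 _ (idx6 b b2) (fun vb => om _ _ vb * om _ _ vb)) K6E.
  rewrite Ex_swap; apply: eq_Ex => vb.
  rewrite (Ex_fam2M _ (i := idx5 b b1) (j := idx5 b b1') (fun ub => om _ ub _)
    (fun ub => om _ ub _)) ?K5E //.
  by apply: contraNneq n1 => /idx5_inj[_ ->].
apply: (@le_trans _ _ T0); last first.
    by rewrite ?(mulr1n, mulr0n, mul1r, mul0r) ler_wpDl //;
    move: T0_ge0 T1_ge0 T2_ge0 T3_ge0; lra.
apply: le_trans om_T0; rewrite K4'; apply: le_of_eq.
apply: eq_Ex => cB.
have n6 : idx6 b b2 != idx6 b b2' by apply: contraNneq n2 => /idx6_inj[_ ->].
under eq_Ex do rewrite (Ex_fam2M _ (om _ _) (om _ _) n6) !K6E.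
rewrite (Ex_fam2M _ (i := idx5 b b1) (j := idx5 b b1')
  (fun ub => Ex _ (om _ ub)) (fun ub => Ex _ (om _ ub))) ?K5E //.
by apply: contraNneq n1 => /idx5_inj[_ ->].
Qed.

Lemma eq_layers F F' : (forall cB uB vB, F cB uB vB = F' cB uB vB) -> layers F = layers F'.
Proof.
by move=> E; apply: eq_Ex => cB; apply: eq_Ex => uB; apply: eq_Ex => vB.
Qed.

Lemma layersD F F' :
  layers (fun cB uB vB => F cB uB vB + F' cB uB vB) = layers F + layers F'.
Proof.
rewrite /layers -ExD; apply: eq_Ex => cB; rewrite -ExD; apply: eq_Ex => uB.
exact: ExD.
Qed.

Lemma layersZ a F : layers (fun cB uB vB => a * F cB uB vB) = a * layers F.
Proof.
rewrite /layers -ExZl; apply: eq_Ex => cB; rewrite -ExZl; apply: eq_Ex => uB.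
exact: ExZl.
Qed.

Lemma layers_sum (L : finType) (F : L -> _) :
  layers (fun cB uB vB => \sum_l F l cB uB vB) = \sum_l layers (F l).
Proof.
rewrite /layers -Ex_sum; apply: eq_Ex => cB; rewrite -Ex_sum; apply: eq_Ex => uB.
exact: Ex_sum.
Qed.

Lemma layers_cst a : layers (fun _ _ _ => a) = a.
Proof.
by rewrite /layers; under eq_Ex do under eq_Ex do rewrite Ex_cst;
  under eq_Ex do rewrite Ex_cst; rewrite Ex_cst.
Qed.

Let N0 : R := #|B0|%:R.
Let N1 : R := #|B1|%:R.
Let N2 : R := #|B2|%:R.

(** Among all pairs of cells, a fraction [1 / N0] agrees in [b0], a fraction [1 / (N0 * N1)] agrees
    also in [b1], and so on; each pattern contributes its moment in that proportion. *)
Lemma cell_variance : (0 < #|B0|)%N -> (0 < #|B1|)%N -> (0 < #|B2|)%N ->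
  layers (fun cB uB vB => ((N0 * N1 * N2)^-1 * \sum_l cell cB uB vB l - s) ^+ 2) <=
  T0 / N0 + T1 / (N0 * N1) + T2 / (N0 * N2) + T3 / (N0 * N1 * N2).
Proof.
move=> B0p B1p B2p.
have N0p : 0 < N0 by rewrite ltr0n.
have N1p : 0 < N1 by rewrite ltr0n.
have N2p : 0 < N2 by rewrite ltr0n.
set N := N0 * N1 * N2; have Np : 0 < N by rewrite !mulr_gt0.
have sumL a : \sum_(l : B0 * B1 * B2) a = N * a.
  by rewrite sumr_const -mulr_natl !card_prod !natrM.
rewrite (eq_layers (F' := fun cB uB vB => N ^- 2 *
    (\sum_l \sum_l' cell cB uB vB l * cell cB uB vB l') +
    ((- 2%:R * s * N^-1) * (\sum_l cell cB uB vB l) + s ^+ 2))); last first.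
  move=> cB uB vB; under [in RHS]eq_bigr do rewrite -mulr_sumr.
  by rewrite -mulr_suml; field; rewrite gt_eqF.
rewrite layersD layersZ layersD layersZ layers_cst !layers_sum.
under [X in _ + (_ * X + _)]eq_bigr do rewrite layers_cell.
rewrite sumL.
(* Every cell has mean [s], so the cross term and the constant of the expanded square combine to
   [- s ^+ 2], which cancels the product of means in [layers_cell2]. *)
have -> : - 2 * s / N * (N * s) + s ^+ 2 = - s ^+ 2 by field; rewrite gt_eqF.
suff H : \sum_l layers (fun cB uB vB => \sum_l' cell cB uB vB l * cell cB uB vB l') <=
    N * (N * s ^+ 2 + (N1 * N2 * T0 + N2 * T1 + N1 * T2 + T3)).
  apply: (@le_trans _ _ (N ^- 2 * (N * (N * s ^+ 2 +
     (N1 * N2 * T0 + N2 * T1 + N1 * T2 + T3))) + - s ^+ 2)).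
    by rewrite lerD2r ler_wpM2l // invr_ge0 sqr_ge0.
  apply: le_of_eq; rewrite /N; field.
  by rewrite !gt_eqF.
rewrite -[leRHS]sumL; apply: ler_sum => l _.
rewrite layers_sum.
apply: le_trans (ler_sum _ (fun l' _ => layers_cell2 l l')) _.
rewrite big_split /= sumL lerD2l.
case: l => [[b b1] b2] /=.
rewrite -(pair_bigA _ (fun x l2 => (b == x.1)%:R * (T0 + (b1 == x.2)%:R * T1 +
   (b2 == l2)%:R * T2 + (b1 == x.2)%:R * (b2 == l2)%:R * T3))) /=.
rewrite -(pair_bigA _ (fun x0 x1 => \sum_l2 (b == x0)%:R * (T0 + (b1 == x1)%:R * T1 +
   (b2 == l2)%:R * T2 + (b1 == x1)%:R * (b2 == l2)%:R * T3))) /=.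
(* For a fixed cell, exactly one value of each bin index agrees with it. *)
have one (X : finType) (x : X) : \sum_y (x == y)%:R = 1 :> R.
  rewrite (bigD1 x) //= eqxx big1 ?addr0 // => y yx.
  by rewrite eq_sym (negbTE yx).
under eq_bigr do under eq_bigr do rewrite -mulr_sumr.
under eq_bigr do rewrite -mulr_sumr.
rewrite -mulr_suml one mul1r.
under eq_bigr => x1 _.
  rewrite !big_split /= !sumr_const -mulr_suml one mul1r -mulr_suml -mulr_sumr one mulr1.
  over.
rewrite !big_split /= !sumr_const -!mulr_suml one !mul1r.
rewrite sumrMnl -mulr_suml one mul1r.
by rewrite -[T0 *+ _ *+ _]mulr_natl -[T0 *+ _]mulr_natl -[T1 *+ _]mulr_natl
  -[T2 *+ _]mulr_natl !mulrA.
Qed.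

End SecondMoment.

(** * Linearity and symmetry of the ensemble *)

Section EnsembleLinear.
Variables (R : realType) (W1 W2 U V WB UB VB : finType).
Variables (k1 : fdist R W1) (k1' : fdist R W2).
Variables (k2 : W1 -> fdist R U) (k2' : W2 -> fdist R V).
Variable k4 : W1 -> W2 -> fdist R WB.
Variables (k5 : W1 -> W2 -> WB -> U -> fdist R UB).
Variables (k6 : W1 -> W2 -> WB -> V -> fdist R VB).
Variables (M1 M2 M11 M22 I B1 B2 : finType) (pi1 : I -> M1) (pi2 : I -> M2).

Local Notation ens :=
  (@ensemble R W1 W2 U V WB UB VB k1 k1' k2 k2' k4 k5 k6 M1 M2 M11 M22 I B1 B2 pi1 pi2).

Lemma le_ensemble F F' :
  (forall c1 c2 d1 d2 cB uB vB, F c1 c2 d1 d2 cB uB vB <= F' c1 c2 d1 d2 cB uB vB) ->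
  ens F <= ens F'.
Proof. by move=> FF'; do 7 (apply: le_Ex => ?). Qed.

Lemma eq_ensemble F F' :
  (forall c1 c2 d1 d2 cB uB vB, F c1 c2 d1 d2 cB uB vB = F' c1 c2 d1 d2 cB uB vB) ->
  ens F = ens F'.
Proof. by move=> FF'; do 7 (apply: eq_Ex => ?). Qed.

Lemma ensembleD F F' :
  ens (fun c1 c2 d1 d2 cB uB vB => F c1 c2 d1 d2 cB uB vB + F' c1 c2 d1 d2 cB uB vB) =
  ens F + ens F'.
Proof. by rewrite /ensemble; do 6 (rewrite -ExD; apply: eq_Ex => ?); rewrite ExD. Qed.

Lemma ensembleZ a F :
  ens (fun c1 c2 d1 d2 cB uB vB => a * F c1 c2 d1 d2 cB uB vB) = a * ens F.
Proof. by rewrite /ensemble; do 6 (rewrite -ExZl; apply: eq_Ex => ?); rewrite ExZl. Qed.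

Lemma ensemble_sum (L : finType) (P : pred L) F :
  ens (fun c1 c2 d1 d2 cB uB vB => \sum_(l | P l) F l c1 c2 d1 d2 cB uB vB) =
  \sum_(l | P l) ens (F l).
Proof. by rewrite /ensemble; do 6 (rewrite -Ex_sum; apply: eq_Ex => ?); rewrite Ex_sum. Qed.

Lemma ensemble_exists_le F r : ens F <= r ->
  exists c1 c2 d1 d2 cB uB vB, F c1 c2 d1 d2 cB uB vB <= r.
Proof.
move=> /Ex_exists_le[c1] /Ex_exists_le[c2] /Ex_exists_le[d1] /Ex_exists_le[d2].
move=> /Ex_exists_le[cB] /Ex_exists_le[uB] /Ex_exists_le[vB] Fr.
by exists c1, c2, d1, d2, cB, uB, vB.
Qed.

(** Exchanging the two relays maps the random codebook to one of the same form, so what is proved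
    for the first receiver serves the second. *)
Lemma ensemble_swap F : ens F =
  @ensemble R W2 W1 V U WB VB UB k1' k1 k2' k2 (fun w2 w1 => k4 w1 w2)
    (fun w2 w1 => k6 w1 w2) (fun w2 w1 => k5 w1 w2) M2 M1 M22 M11 I B2 B1 pi2 pi1
    (fun c2 c1 d2 d1 cB vB uB => F c1 c2 d1 d2 cB uB vB).
Proof.
rewrite /ensemble Ex_swap; apply: eq_Ex => c2; apply: eq_Ex => c1.
rewrite Ex_swap; apply: eq_Ex => d2; apply: eq_Ex => d1; apply: eq_Ex => cB.
exact: Ex_swap.
Qed.

Lemma single_swap G : single k1 k1' k2 k2' k4 k5 k6 G =
  single k1' k1 k2' k2 (fun w2 w1 => k4 w1 w2)
    (fun w2 w1 => k6 w1 w2) (fun w2 w1 => k5 w1 w2)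
    (fun w2 w1 v u wB vb ub => G w1 w2 u v wB ub vb).
Proof.
rewrite /single Ex_swap; apply: eq_Ex => c2; apply: eq_Ex => c1.
rewrite Ex_swap; apply: eq_Ex => d2; apply: eq_Ex => d1; apply: eq_Ex => cB.
exact: Ex_swap.
Qed.

Lemma single_sum (L : finType) (P : pred L) G :
  single k1 k1' k2 k2' k4 k5 k6
    (fun w1 w2 u v wB ub vb => \sum_(l | P l) G l w1 w2 u v wB ub vb) =
  \sum_(l | P l) single k1 k1' k2 k2' k4 k5 k6 (G l).
Proof. by rewrite /single; do 6 (rewrite -Ex_sum; apply: eq_Ex => ?); rewrite Ex_sum. Qed.

End EnsembleLinear.

(** * Moments of weights *)

Section Weights.
Variable R : realType.

Lemma Ex_pair (A B : finType) (p : fdist R A) (q : A -> fdist R B) (f : A -> B -> R) :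
  Ex p (fun a => Ex (q a) (f a)) = \sum_(x : A * B) p x.1 * q x.1 x.2 * f x.1 x.2.
Proof.
rewrite -(pair_bigA _ (fun a b => p a * q a b * f a b)) /=; apply: eq_bigr => a _.
by rewrite /Ex mulr_sumr; apply: eq_bigr => b _; rewrite mulrA.
Qed.

(** Here [k] is the codebook law and [h] a truncated likelihood ratio. Where [k] is positive and [h]
    does not vanish, [k * h <= p <= c * k] gives [h <= c], so the second moment of [h] is at most
    [c] times its first moment, which is at most [1]. *)
Lemma weighted_square_le (T : finType) (k h p : T -> R) (c : R) :
  0 <= c -> (forall t, 0 <= k t) -> (forall t, 0 <= h t) -> (forall t, k t * h t <= p t) ->
  \sum_t p t <= 1 -> (forall t, h t != 0 -> p t <= c * k t) ->
  \sum_t k t * h t ^+ 2 <= c.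
Proof.
move=> c0 k0 h0 khp p1 hc.
apply: (@le_trans _ _ (\sum_t c * p t)); last by rewrite -mulr_sumr ler_piMr.
apply: ler_sum => t _.
apply: (@le_trans _ _ (c * (k t * h t))); last by rewrite ler_wpM2l.
rewrite expr2 mulrA [leRHS]mulrCA.
have [->|ht] := eqVneq (h t) 0; first by rewrite !mulr0.
have [->|kt] := eqVneq (k t) 0; first by rewrite !mul0r.
rewrite -mulrA ler_pM2l ?lt0r ?kt ?k0 // ler_wpM2r //.
by rewrite -(@ler_pM2l _ (k t)) ?lt0r ?kt ?k0 // (le_trans (khp t)) // mulrC hc.
Qed.

(* [S] estimates [s] and [E * S] is controlled by [A]. If [S] is far below [1] then
   either [S] is far from [s] or [s] is far from [1]. *)
Lemma le_weighted_error (E S s A : R) : 0 <= E -> E <= 1 -> s <= 1 -> 0 <= A ->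
  E * S <= A -> E <= 2 * A + (16 * (S - s) ^+ 2 + 4 * (1 - s)).
Proof.
move=> E0 E1 s1 A0 ESA.
have sq := sqr_ge0 (S - s).
(* The constants: if [S >= 1/2] then [E <= 2 * A]; if [s <= 3/4] then [4 * (1 - s) >= 1]; otherwise
   [s - S > 1/4], and [16 * (S - s) ^+ 2 >= 1]. *)
have [hS|hS] := lerP 2^-1 S; first by have := ler_wpM2l E0 hS; lra.
have [hs|hs] := lerP s (3 / 4); first by lra.
have : 4^-1 * 4^-1 <= (s - S) * (s - S) by apply: ler_pM; lra.
have -> : (s - S) * (s - S) = (S - s) ^+ 2 by ring.
lra.
Qed.

End Weights.

(** * Union bound over wrong codewords *)

Section Confusion.
Variables (R : realType) (W1 W2 U V WB UB VB Y : finType).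
Variables (k1 : fdist R W1) (k1' : fdist R W2).
Variables (k2 : W1 -> fdist R U) (k2' : W2 -> fdist R V).
Variable k4 : W1 -> W2 -> fdist R WB.
Variables (k5 : W1 -> W2 -> WB -> U -> fdist R UB).
Variables (k6 : W1 -> W2 -> WB -> V -> fdist R VB).
Variables (M1 M2 M11 M22 I B1 B2 : finType) (pi1 : I -> M1) (pi2 : I -> M2).
Variable G : Y -> W1 -> W2 -> U -> V -> WB -> UB -> VB -> R.
Hypothesis G_ge0 : forall y w1 w2 u v wB ub vb, 0 <= G y w1 w2 u v wB ub vb.
Hypothesis G_le1 : \sum_y single k1 k1' k2 k2' k4 k5 k6 (G y) <= 1.
Variable pass : W1 -> W2 -> WB -> U -> UB -> Y -> bool.

Let A5 y w1 w2 u wB := Ex (k5 w1 w2 wB u) (fun ub => (pass w1 w2 wB u ub y)%:R).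
Let A4 y w1 w2 u := Ex (k4 w1 w2) (A5 y w1 w2 u).
Let A3 y w1 w2 := Ex (k2 w1) (A4 y w1 w2).

Variables D1 D2 D3 D4 D5 D6 D7 : R.
Hypothesis A_D1 : forall y w1 w2 wB, Ex (k2 w1) (fun u => A5 y w1 w2 u wB) <= D1.
Hypothesis A_D2 : forall y w1 w2 u, A4 y w1 w2 u <= D2.
Hypothesis A_D3 : forall y w1 u, Ex k1' (fun w2 => A4 y w1 w2 u) <= D3.
Hypothesis A_D4 : forall y w1 w2, A3 y w1 w2 <= D4.
Hypothesis A_D5 : forall y w1, Ex k1' (A3 y w1) <= D5.
Hypothesis A_D6 : forall y w2, Ex k1 (fun w1 => A3 y w1 w2) <= D6.
Hypothesis A_D7 : forall y, Ex k1 (fun w1 => Ex k1' (A3 y w1)) <= D7.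
Hypothesis D1_ge0 : 0 <= D1.
Hypothesis D2_ge0 : 0 <= D2.
Hypothesis D3_ge0 : 0 <= D3.
Hypothesis D4_ge0 : 0 <= D4.
Hypothesis D5_ge0 : 0 <= D5.
Hypothesis D6_ge0 : 0 <= D6.
Hypothesis D7_ge0 : 0 <= D7.

Variables (i : I) (m11 : M11) (m22 : M22) (b1 : B1) (b2 : B2).
Variables n12 n1 n2 : R.
Hypothesis card12 : \sum_i' ((pi1 i' == pi1 i) && (pi2 i' == pi2 i))%:R <= n12.
Hypothesis card1 : \sum_i' (pi1 i' == pi1 i)%:R <= n1.
Hypothesis card2 : \sum_i' (pi2 i' == pi2 i)%:R <= n2.

Definition confusion_total : R :=
  #|B1|%:R * (#|M11|%:R * D1 + n12 * D2 + n1 * D3 + n12 * #|M11|%:R * D4 +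
              n1 * #|M11|%:R * D5 + n2 * #|M11|%:R * D6 + #|I|%:R * #|M11|%:R * D7).

Let cb (i' : I) (m11' : M11) : R :=
  confusion_bound pi1 pi2 i m11 D1 D2 D3 D4 D5 D6 D7 i' m11'.

Lemma confusion_bound_ge0 i' m11' : 0 <= cb i' m11'.
Proof. by rewrite /cb /confusion_bound; do ! case: ifP. Qed.

(** Each kind of confusion is counted with only its agreement conditions, the conditions of
    disagreement being dropped. This overcounts, but turns every count into a product of sizes. *)
Lemma sum_confusion_bound :
  \sum_(t : I * M11 * B1 | t.1 != (i, m11)) cb t.1.1 t.1.2 <= confusion_total.
Proof.
apply: (@le_trans _ _ (\sum_(t : I * M11 * B1) cb t.1.1 t.1.2)).
  rewrite [leRHS](bigID (fun t : I * M11 * B1 => t.1 != (i, m11))) /= lerDl.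
  by apply: sumr_ge0 => t _; exact: confusion_bound_ge0.
rewrite -(pair_bigA _ (fun (x : I * M11) (_ : B1) => cb x.1 x.2)) /=.
under eq_bigr do rewrite sumr_const -mulr_natl.
rewrite -mulr_sumr ler_wpM2l //.
rewrite -(pair_bigA _ (fun i' m' => cb i' m')) /=.
pose eqi i' : R := (i' == i)%:R.
pose eq12 i' : R := ((pi1 i' == pi1 i) && (pi2 i' == pi2 i))%:R.
pose eq1 i' : R := (pi1 i' == pi1 i)%:R.
pose eq2 i' : R := (pi2 i' == pi2 i)%:R.
pose eqm m' : R := (m' == m11)%:R.
have cbE i' m' : cb i' m' <= eqi i' * D1 + eq12 i' * eqm m' * D2 + eq1 i' * eqm m' * D3
    + eq12 i' * D4 + eq1 i' * D5 + eq2 i' * D6 + D7.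
  rewrite /cb /confusion_bound /eqi /eq12 /eq1 /eq2 /eqm.
  move: D1_ge0 D2_ge0 D3_ge0 D4_ge0 D5_ge0 D6_ge0 D7_ge0.
  case: (_ == _); case: (_ == _); case: (_ == _); case: (_ == _);
    rewrite ?(mulr1n, mulr0n, mul1r, mul0r, mulr0, mulr1) /=; lra.
have summ : \sum_m' eqm m' = 1.
  by rewrite /eqm (bigD1 m11) //= eqxx big1 ?addr0 // => m' /negbTE->.
have sumi : \sum_i' eqi i' = 1.
  by rewrite /eqi (bigD1 i) //= eqxx big1 ?addr0 // => i' /negbTE->.
have [m mE] : exists m : R, m = #|M11|%:R by eexists.
rewrite -mE; have -> : m * D1 + n12 * D2 + n1 * D3 + n12 * m * D4 + n1 * m * D5 + n2 * m * D6 +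
    #|I|%:R * m * D7 = 1 * (m * D1) + n12 * (D2 + m * D4) + n1 * (D3 + m * D5) +
    n2 * (m * D6) + #|I|%:R * (m * D7) by ring.
have m0 : 0 <= m by rewrite mE ler0n.
apply: (@le_trans _ _ (\sum_i' (eqi i' * (m * D1) + eq12 i' * (D2 + m * D4) +
    eq1 i' * (D3 + m * D5) + eq2 i' * (m * D6) + m * D7))); last first.
  rewrite !big_split /= -!mulr_suml sumi sumr_const -(mulr_natl m) -[_ * m * D7]mulrA.
  apply: lerD; last exact: lexx.
  have mD k : 0 <= k -> 0 <= m * k by move=> k0; exact: mulr_ge0.
  apply: lerD; last by apply: ler_wpM2r card2; exact: mD.
  apply: lerD; last by apply: ler_wpM2r card1; apply: addr_ge0 => //; exact: mD.
  apply: lerD; first exact: lexx.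
  by apply: ler_wpM2r card12; apply: addr_ge0 => //; exact: mD.
apply: ler_sum => i' _.
apply: le_trans (ler_sum _ (fun m' _ => cbE i' m')) _.
have sumc c : \sum_(m' : M11) c = m * c by rewrite sumr_const mE mulr_natl.
rewrite !big_split /= -!mulr_suml -!mulr_sumr summ !sumc.
by apply: le_of_eq; ring.
Qed.

(** The bounds on a wrong tuple are uniform in [y], and [G] has total mass at most [1] over tuples
    and outputs together, so the size of the output alphabet does not enter. *)
Lemma ensemble_confusion_total :
  ensemble k1 k1' k2 k2' k4 k5 k6 pi1 pi2 (fun c1 c2 d1 d2 cB uB vB => \sum_y
    G y (c1 (pi1 i)) (c2 (pi2 i)) (d1 (pi1 i, m11)) (d2 (pi2 i, m22)) (cB i)
      (uB (i, m11, b1)) (vB (i, m22, b2)) *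
    \sum_(t : I * M11 * B1 | t.1 != (i, m11))
      (pass (c1 (pi1 t.1.1)) (c2 (pi2 t.1.1)) (cB t.1.1) (d1 (pi1 t.1.1, t.1.2))
         (uB t) y)%:R) <= confusion_total.
Proof.
have C0 : 0 <= confusion_total.
  apply: le_trans sum_confusion_bound.
  by apply: sumr_ge0 => t _; exact: confusion_bound_ge0.
apply: (@le_trans _ _ (\sum_y single k1 k1' k2 k2' k4 k5 k6 (G y) * confusion_total));
  last by rewrite -mulr_suml ler_piMl.
rewrite ensemble_sum; apply: ler_sum => y _.
apply: (@le_trans _ _ (\sum_(t : I * M11 * B1 | t.1 != (i, m11))
    single k1 k1' k2 k2' k4 k5 k6 (G y) * cb t.1.1 t.1.2)); last first.
  rewrite -mulr_sumr ler_wpM2l ?sum_confusion_bound //.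
  by rewrite /single; do 7 (apply: Ex_ge0 => ?).
under eq_ensemble do rewrite mulr_sumr.
rewrite ensemble_sum; apply: ler_sum => -[[i' m11'] b1'] neq.
pose Ay w1 w2 wB u ub : R := (pass w1 w2 wB u ub y)%:R.
exact: (ensemble_confusion k2' k6 pi1 pi2 (G_ge0 y) m22 b1 b2 (A := Ay)
  (A_D1 y) (A_D2 y) (A_D3 y) (A_D4 y) (A_D5 y) (A_D6 y) (A_D7 y)).
Qed.

End Confusion.

(** If [t0] passes, some index is picked, and its value can differ from that of [t0] only when the
    picked index lies in [S]; it is then one of the passing indices counted by the sum. *)
Lemma pick_error (R : realType) (T M : finType) (P S : pred T) (g : T -> M) (d : M) (t0 : T) :
  (forall t, ~~ S t -> g t = g t0) ->
  ((if [pick t | P t] is Some t then g t else d) != g t0)%:R <=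
  (~~ P t0)%:R + \sum_(t | S t) (P t)%:R :> R.
Proof.
move=> gS; have s0 : 0 <= \sum_(t | S t) (P t)%:R :> R by apply: sumr_ge0.
case: (boolP (P t0)) => [Pt0|_]; last first.
  by rewrite ler_wpDr //; case: (_ != _); rewrite ?ler01.
rewrite add0r; case: pickP => [t Pt|/(_ t0)]; last by rewrite Pt0.
have [St|/gS ->] := boolP (S t); last by rewrite eqxx.
apply: (@le_trans _ _ 1); first by case: (_ != _); rewrite ?ler01.
by rewrite (bigD1 t) //= Pt lerDl; apply: sumr_ge0.
Qed.

(** * One-shot error bound *)

Section OneShot.
Variables (R : realType) (W1 W2 U V WB UB VB X1 X2 XB Y1 Y2 : finType).
Variable ch : X1 -> XB -> X2 -> fdist R (Y1 * Y2)%type.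
Variables (k1 : fdist R W1) (k1' : fdist R W2).
Variables (k2 : W1 -> fdist R U) (k2' : W2 -> fdist R V).
Variable k4 : W1 -> W2 -> fdist R WB.
Variables (k5 : W1 -> W2 -> WB -> U -> fdist R UB).
Variables (k6 : W1 -> W2 -> WB -> V -> fdist R VB).
Variables (x1 : U -> X1) (x2 : V -> X2).
Variable pB : W1 -> W2 -> U -> V -> WB -> UB -> VB -> R.
Hypothesis pB_ge0 : forall w1 w2 u v wB ub vb, 0 <= pB w1 w2 u v wB ub vb.
Hypothesis pB_sum1 : forall w1 w2 u v,
  \sum_wB \sum_ub \sum_vb pB w1 w2 u v wB ub vb = 1.
Variable kX : W1 -> W2 -> U -> V -> WB -> UB -> VB -> fdist R XB.

(** The target law. It departs from the codebook law only in drawing [(WB, UB, VB)] from the joint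
    kernel [pB]. The relay inputs are functions of the codewords because a random input can be made
    part of the letter of [U] or [V]. *)
Definition truth (f : W1 -> W2 -> U -> V -> WB -> UB -> VB -> XB -> Y1 * Y2 -> R) : R :=
  Ex k1 (fun w1 => Ex k1' (fun w2 => Ex (k2 w1) (fun u => Ex (k2' w2) (fun v =>
  \sum_wB \sum_ub \sum_vb pB w1 w2 u v wB ub vb *
    Ex (kX w1 w2 u v wB ub vb) (fun xB => Ex (ch (x1 u) xB (x2 v)) (fun y =>
      f w1 w2 u v wB ub vb xB y)))))).

Variable A : W1 -> W2 -> U -> V -> WB -> UB -> VB -> bool.
Variables T0 T1 T2 T3 : R.
Hypothesis T0_ge0 : 0 <= T0.
Hypothesis T1_ge0 : 0 <= T1.
Hypothesis T2_ge0 : 0 <= T2.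
Hypothesis T3_ge0 : 0 <= T3.
Hypothesis A_T0 : forall w1 w2 u v wB ub vb, A w1 w2 u v wB ub vb ->
  \sum_ub' \sum_vb' pB w1 w2 u v wB ub' vb' <= T0 * k4 w1 w2 wB.
Hypothesis A_T1 : forall w1 w2 u v wB ub vb, A w1 w2 u v wB ub vb ->
  \sum_vb' pB w1 w2 u v wB ub vb' <= T1 * (k4 w1 w2 wB * k5 w1 w2 wB u ub).
Hypothesis A_T2 : forall w1 w2 u v wB ub vb, A w1 w2 u v wB ub vb ->
  \sum_ub' pB w1 w2 u v wB ub' vb <= T2 * (k4 w1 w2 wB * k6 w1 w2 wB v vb).
Hypothesis A_T3 : forall w1 w2 u v wB ub vb, A w1 w2 u v wB ub vb ->
  pB w1 w2 u v wB ub vb <=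
    T3 * (k4 w1 w2 wB * k5 w1 w2 wB u ub * k6 w1 w2 wB v vb).

(* Truncating to [A] bounds the moments of the likelihood ratio. *)
Definition om w1 w2 u v wB ub vb : R :=
  if A w1 w2 u v wB ub vb then
    pB w1 w2 u v wB ub vb / (k4 w1 w2 wB * k5 w1 w2 wB u ub * k6 w1 w2 wB v vb)
  else 0.

Lemma om_ge0 w1 w2 u v wB ub vb : 0 <= om w1 w2 u v wB ub vb.
Proof.
rewrite /om; case: ifP => // _.
by rewrite divr_ge0 // !mulr_ge0 ?pmf_ge0.
Qed.

(** The quotient in [om] is [0] where the codebook law vanishes; the identity survives because
    [A_T3] forces [pB] to vanish there as well. *)
Lemma omE w1 w2 u v wB ub vb :
  k4 w1 w2 wB * k5 w1 w2 wB u ub * k6 w1 w2 wB v vb * om w1 w2 u v wB ub vb =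
  pB w1 w2 u v wB ub vb * (A w1 w2 u v wB ub vb)%:R.
Proof.
rewrite /om; case: ifPn => [hA|_]; last by rewrite !mulr0.
have := A_T3 hA; set k := k4 _ _ _ * _ * _ => pBk.
have [k0|k0] := eqVneq k 0; last by rewrite mulr1 mulrC divfK.
rewrite k0 mul0r; move: pBk; rewrite k0 mulr0 => pBk.
by rewrite (@le_anti _ _ (pB w1 w2 u v wB ub vb) 0) ?mul0r // pBk pB_ge0.
Qed.

Lemma sum_omE w1 w2 u v f :
  Ex (k4 w1 w2) (fun wB => Ex (k5 w1 w2 wB u) (fun ub => Ex (k6 w1 w2 wB v)
    (fun vb => om w1 w2 u v wB ub vb * f wB ub vb))) =
  \sum_wB \sum_ub \sum_vb pB w1 w2 u v wB ub vb * (A w1 w2 u v wB ub vb)%:R * f wB ub vb.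
Proof.
rewrite {1}/Ex; apply: eq_bigr => wB _; rewrite mulr_sumr; apply: eq_bigr => ub _.
by rewrite mulrA mulr_sumr; apply: eq_bigr => vb _; rewrite -omE !mulrA.
Qed.

Lemma sum_omE1 w1 w2 u v :
  Ex (k4 w1 w2) (fun wB => Ex (k5 w1 w2 wB u) (fun ub => Ex (k6 w1 w2 wB v)
    (om w1 w2 u v wB ub))) =
  \sum_wB \sum_ub \sum_vb pB w1 w2 u v wB ub vb * (A w1 w2 u v wB ub vb)%:R.
Proof.
have := sum_omE w1 w2 u v (fun _ _ _ => 1).
under eq_Ex do under eq_Ex do under eq_Ex do rewrite mulr1.
move=> ->; apply: eq_bigr => wB _; apply: eq_bigr => ub _; apply: eq_bigr => vb _.
by rewrite mulr1.
Qed.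

(** Change of measure from the codebook to the target law. It is an inequality because the
    truncation to [A] discards mass. *)
Lemma single_om_le f : (forall w1 w2 u v wB ub vb xB y, 0 <= f w1 w2 u v wB ub vb xB y) ->
  single k1 k1' k2 k2' k4 k5 k6 (fun w1 w2 u v wB ub vb => om w1 w2 u v wB ub vb *
    Ex (kX w1 w2 u v wB ub vb) (fun xB => Ex (ch (x1 u) xB (x2 v)) (fun y =>
      f w1 w2 u v wB ub vb xB y))) <= truth f.
Proof.
move=> f0; apply: le_Ex => w1; apply: le_Ex => w2; apply: le_Ex => u; apply: le_Ex => v.
rewrite sum_omE; apply: ler_sum => wB _; apply: ler_sum => ub _; apply: ler_sum => vb _.
have e0 : 0 <= Ex (kX w1 w2 u v wB ub vb) (fun xB => Ex (ch (x1 u) xB (x2 v)) (fun y =>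
      f w1 w2 u v wB ub vb xB y)) by do 2 (apply: Ex_ge0 => ?).
rewrite ler_wpM2r //.
by case: (A _ _ _ _ _ _ _); rewrite ?mulr1 ?mulr0 ?pB_ge0.
Qed.

Lemma truth_cst a : truth (fun _ _ _ _ _ _ _ _ _ => a) = a.
Proof.
rewrite /truth -[RHS](Ex_cst k1); apply: eq_Ex => w1.
rewrite -[RHS](Ex_cst k1'); apply: eq_Ex => w2.
rewrite -[RHS](Ex_cst (k2 w1)); apply: eq_Ex => u.
rewrite -[RHS](Ex_cst (k2' w2)); apply: eq_Ex => v.
rewrite -[RHS]mul1r -(pB_sum1 w1 w2 u v) mulr_suml; apply: eq_bigr => wB _.
rewrite mulr_suml; apply: eq_bigr => ub _; rewrite mulr_suml; apply: eq_bigr => vb _.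
by under eq_Ex do rewrite Ex_cst; rewrite Ex_cst.
Qed.

Section Moments.
Variables (w1 : W1) (w2 : W2) (u : U) (v : V).
Let p4 := k4 w1 w2.
Let p5 wB := k5 w1 w2 wB u.
Let p6 wB := k6 w1 w2 wB v.
Let o := om w1 w2 u v.
Let pb := pB w1 w2 u v.

Let kom_le wB ub vb : p4 wB * p5 wB ub * p6 wB vb * o wB ub vb <= pb wB ub vb.
Proof.
rewrite /p4 /p5 /p6 /o omE; case: (A _ _ _ _ _ _ _); first by rewrite mulr1.
by rewrite mulr0 pB_ge0.
Qed.

(** Averaging [om] over the lower layers gives a truncated ratio of marginals. If it is nonzero at
    [wB], some [(ub, vb)] lies in [A], and [A_T0], whose conclusion does not mention that pair,
    bounds the ratio. The other moments follow the same pattern. *)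
Lemma om_moment0 :
  Ex p4 (fun wB => Ex (p5 wB) (fun ub => Ex (p6 wB) (o wB ub)) ^+ 2) <= T0.
Proof.
apply: (weighted_square_le (p := fun wB => \sum_ub \sum_vb pb wB ub vb)) => //.
- by move=> wB; exact: pmf_ge0.
- by move=> wB; do 2 (apply: Ex_ge0 => ?); exact: om_ge0.
- move=> wB; rewrite mulr_sumr; apply: ler_sum => ub _.
  by rewrite mulrA mulr_sumr; apply: ler_sum => vb _; rewrite mulrA.
- by rewrite pB_sum1.
- move=> wB; apply: contraNle => h; apply/eqP; rewrite /Ex big1 // => ub _.
  rewrite big1 ?mulr0 // => vb _; rewrite /o /om; case: ifP => [hA|]; last by rewrite mulr0.
  by have := lt_le_trans h (A_T0 hA); rewrite ltxx.
Qed.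

Lemma om_moment1 :
  Ex p4 (fun wB => Ex (p5 wB) (fun ub => Ex (p6 wB) (o wB ub) ^+ 2)) <= T1.
Proof.
rewrite Ex_pair.
apply: (weighted_square_le (k := fun x : WB * UB => p4 x.1 * p5 x.1 x.2)
  (h := fun x : WB * UB => Ex (p6 x.1) (o x.1 x.2))
  (p := fun x : WB * UB => \sum_vb pb x.1 x.2 vb)) => //.
- by move=> [wB ub]; rewrite mulr_ge0 ?pmf_ge0.
- by move=> [wB ub]; apply: Ex_ge0 => vb; exact: om_ge0.
- move=> [wB ub] /=; rewrite mulr_sumr; apply: ler_sum => vb _.
  by rewrite mulrA.
- by rewrite -(pair_bigA _ (fun wB ub => \sum_vb pb wB ub vb)) /= pB_sum1.
- move=> [wB ub] /=; apply: contraNle => h; apply/eqP; rewrite /Ex big1 // => vb _.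
  rewrite /o /om; case: ifP => [hA|]; last by rewrite mulr0.
  by have := lt_le_trans h (A_T1 hA); rewrite ltxx.
Qed.

Lemma om_moment2 :
  Ex p4 (fun wB => Ex (p6 wB) (fun vb => Ex (p5 wB) (fun ub => o wB ub vb) ^+ 2)) <= T2.
Proof.
rewrite Ex_pair.
apply: (weighted_square_le (k := fun x : WB * VB => p4 x.1 * p6 x.1 x.2)
  (h := fun x : WB * VB => Ex (p5 x.1) (fun ub => o x.1 ub x.2))
  (p := fun x : WB * VB => \sum_ub pb x.1 ub x.2)) => //.
- by move=> [wB vb]; rewrite mulr_ge0 ?pmf_ge0.
- by move=> [wB vb]; apply: Ex_ge0 => ub; exact: om_ge0.
- move=> [wB vb] /=; rewrite mulr_sumr; apply: ler_sum => ub _.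
  by rewrite mulrA [p4 wB * _ * _]mulrAC.
- rewrite -(pair_bigA _ (fun wB vb => \sum_ub pb wB ub vb)) /=.
  by under eq_bigr do rewrite exchange_big; rewrite pB_sum1.
- move=> [wB vb] /=; apply: contraNle => h; apply/eqP; rewrite /Ex big1 // => ub _.
  rewrite /o /om; case: ifP => [hA|]; last by rewrite mulr0.
  by have := lt_le_trans h (A_T2 hA); rewrite ltxx.
Qed.

Lemma om_moment3 :
  Ex p4 (fun wB => Ex (p5 wB) (fun ub => Ex (p6 wB) (fun vb => o wB ub vb ^+ 2))) <= T3.
Proof.
under eq_Ex do rewrite Ex_pair.
have -> : Ex p4 (fun wB => \sum_(x : UB * VB) p5 wB x.1 * p6 wB x.2 * o wB x.1 x.2 ^+ 2) =
    \sum_(x : WB * (UB * VB)) p4 x.1 * p5 x.1 x.2.1 * p6 x.1 x.2.2 *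
       o x.1 x.2.1 x.2.2 ^+ 2.
  rewrite -(pair_bigA _ (fun a b => p4 a * p5 a b.1 * p6 a b.2 * o a b.1 b.2 ^+ 2)) /=.
  by apply: eq_bigr => wB _; rewrite mulr_sumr; apply: eq_bigr => x _; rewrite !mulrA.
apply: (weighted_square_le
  (k := fun x : WB * (UB * VB) => p4 x.1 * p5 x.1 x.2.1 * p6 x.1 x.2.2)
  (h := fun x : WB * (UB * VB) => o x.1 x.2.1 x.2.2)
  (p := fun x : WB * (UB * VB) => pb x.1 x.2.1 x.2.2)) => //.
- by move=> [wB [ub vb]]; rewrite !mulr_ge0 ?pmf_ge0.
- by move=> [wB [ub vb]]; exact: om_ge0.
- rewrite -(pair_bigA _ (fun wB x => pb wB x.1 x.2)) /=.
  by under eq_bigr do rewrite -(pair_bigA _ (fun ub vb => pb _ ub vb)) /=; rewrite pB_sum1.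
- move=> [wB [ub vb]] /=; rewrite /o /om; case: ifP => [hA _|]; last by rewrite eqxx.
  exact: A_T3 hA.
Qed.

End Moments.

Variables (N0 N1 N2 M10 M11 M20 M22 B0 B1 B2 : finType).
Variables (iota1 : N1 -> M10 * M11) (iota2 : N2 -> M20 * M22).
Hypothesis iota1_inj : injective iota1.
Hypothesis iota2_inj : injective iota2.
Variables (n0 : N0) (n1 : N1) (n2 : N2).
Hypothesis B0_gt0 : (0 < #|B0|)%N.
Hypothesis B1_gt0 : (0 < #|B1|)%N.
Hypothesis B2_gt0 : (0 < #|B2|)%N.

(** A [WB] codeword carries the parts of the relay messages decoded by both receivers, the common
    message and a bin index. The factor [N0 * B0] ranges over the indices with the same two
    parents. *)
Let I : finType := (M10 * M20 * (N0 * B0))%type.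
Let pi1 (i : I) : M10 := i.1.1.
Let pi2 (i : I) : M20 := i.1.2.

Variable pass1 : W1 -> W2 -> WB -> U -> UB -> Y1 -> bool.
Variable pass2 : W2 -> W1 -> WB -> V -> VB -> Y2 -> bool.

Let P5 y w1 w2 u wB := Ex (k5 w1 w2 wB u) (fun ub => (pass1 w1 w2 wB u ub y)%:R).
Let P4 y w1 w2 u := Ex (k4 w1 w2) (P5 y w1 w2 u).
Let P3 y w1 w2 := Ex (k2 w1) (P4 y w1 w2).

Variables D1 D2 D3 D4 D5 D6 D7 : R.
Hypothesis P_D1 : forall y w1 w2 wB, Ex (k2 w1) (fun u => P5 y w1 w2 u wB) <= D1.
Hypothesis P_D2 : forall y w1 w2 u, P4 y w1 w2 u <= D2.
Hypothesis P_D3 : forall y w1 u, Ex k1' (fun w2 => P4 y w1 w2 u) <= D3.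
Hypothesis P_D4 : forall y w1 w2, P3 y w1 w2 <= D4.
Hypothesis P_D5 : forall y w1, Ex k1' (P3 y w1) <= D5.
Hypothesis P_D6 : forall y w2, Ex k1 (fun w1 => P3 y w1 w2) <= D6.
Hypothesis P_D7 : forall y, Ex k1 (fun w1 => Ex k1' (P3 y w1)) <= D7.
Hypothesis D1_ge0 : 0 <= D1.
Hypothesis D2_ge0 : 0 <= D2.
Hypothesis D3_ge0 : 0 <= D3.
Hypothesis D4_ge0 : 0 <= D4.
Hypothesis D5_ge0 : 0 <= D5.
Hypothesis D6_ge0 : 0 <= D6.
Hypothesis D7_ge0 : 0 <= D7.

Let Q5 y w2 w1 v wB := Ex (k6 w1 w2 wB v) (fun vb => (pass2 w2 w1 wB v vb y)%:R).
Let Q4 y w2 w1 v := Ex (k4 w1 w2) (Q5 y w2 w1 v).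
Let Q3 y w2 w1 := Ex (k2' w2) (Q4 y w2 w1).

Variables D1' D2' D3' D4' D5' D6' D7' : R.
Hypothesis Q_D1 : forall y w2 w1 wB, Ex (k2' w2) (fun v => Q5 y w2 w1 v wB) <= D1'.
Hypothesis Q_D2 : forall y w2 w1 v, Q4 y w2 w1 v <= D2'.
Hypothesis Q_D3 : forall y w2 v, Ex k1 (fun w1 => Q4 y w2 w1 v) <= D3'.
Hypothesis Q_D4 : forall y w2 w1, Q3 y w2 w1 <= D4'.
Hypothesis Q_D5 : forall y w2, Ex k1 (Q3 y w2) <= D5'.
Hypothesis Q_D6 : forall y w1, Ex k1' (fun w2 => Q3 y w2 w1) <= D6'.
Hypothesis Q_D7 : forall y, Ex k1' (fun w2 => Ex k1 (Q3 y w2)) <= D7'.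
Hypothesis D1'_ge0 : 0 <= D1'.
Hypothesis D2'_ge0 : 0 <= D2'.
Hypothesis D3'_ge0 : 0 <= D3'.
Hypothesis D4'_ge0 : 0 <= D4'.
Hypothesis D5'_ge0 : 0 <= D5'.
Hypothesis D6'_ge0 : 0 <= D6'.
Hypothesis D7'_ge0 : 0 <= D7'.

Let nK : R := #|N0|%:R * #|B0|%:R.
Let nM10 : R := #|M10|%:R.
Let nM11 : R := #|M11|%:R.
Let nM20 : R := #|M20|%:R.
Let nM22 : R := #|M22|%:R.
Let nB0 : R := #|B0|%:R.
Let nB1 : R := #|B1|%:R.
Let nB2 : R := #|B2|%:R.

Definition confusion1 : R :=
  nB1 * (nM11 * D1 + nK * D2 + (nM20 * nK) * D3 + nK * nM11 * D4 +
         (nM20 * nK) * nM11 * D5 + (nM10 * nK) * nM11 * D6 +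
         (nM10 * nM20 * nK) * nM11 * D7).

Definition confusion2 : R :=
  nB2 * (nM22 * D1' + nK * D2' + (nM10 * nK) * D3' + nK * nM22 * D4' +
         (nM10 * nK) * nM22 * D5' + (nM20 * nK) * nM22 * D6' +
         (nM10 * nM20 * nK) * nM22 * D7').

Local Notation ens := (@ensemble R W1 W2 U V WB UB VB k1 k1' k2 k2' k4 k5 k6
  M10 M20 M11 M22 I B1 B2 pi1 pi2).

(** A left inverse of the message split. Rounding of the sizes may leave pairs outside the image,
    which are sent to the default message. *)
Definition inv_iota1 (x : M10 * M11) : N1 := odflt n1 [pick m | iota1 m == x].
Definition inv_iota2 (x : M20 * M22) : N2 := odflt n2 [pick m | iota2 m == x].

Lemma iota1K : cancel iota1 inv_iota1.
Proof.
by move=> m; rewrite /inv_iota1; case: pickP => [m' /eqP/iota1_inj //|/(_ m)]; rewrite eqxx.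
Qed.

Lemma iota2K : cancel iota2 inv_iota2.
Proof.
by move=> m; rewrite /inv_iota2; case: pickP => [m' /eqP/iota2_inj //|/(_ m)]; rewrite eqxx.
Qed.

Section Codebook.
Variables (c1 : {ffun M10 -> W1}) (c2 : {ffun M20 -> W2}).
Variables (d1 : {ffun M10 * M11 -> U}) (d2 : {ffun M20 * M22 -> V}).
Variables (cB : {ffun I -> WB}).
Variables (uB : {ffun I * M11 * B1 -> UB}) (vB : {ffun I * M22 * B2 -> VB}).

Definition passing1 (y : Y1) (t : I * M11 * B1) : bool :=
  pass1 (c1 (pi1 t.1.1)) (c2 (pi2 t.1.1)) (cB t.1.1) (d1 (pi1 t.1.1, t.1.2)) (uB t) y.

Definition passing2 (y : Y2) (t : I * M22 * B2) : bool :=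
  pass2 (c2 (pi2 t.1.1)) (c1 (pi1 t.1.1)) (cB t.1.1) (d2 (pi2 t.1.1, t.1.2)) (vB t) y.

Definition decode1 (y : Y1) : N0 * N1 :=
  if [pick t | passing1 y t] is Some t then
    (t.1.1.2.1, inv_iota1 (pi1 t.1.1, t.1.2)) else (n0, n1).

Definition decode2 (y : Y2) : N0 * N2 :=
  if [pick t | passing2 y t] is Some t then
    (t.1.1.2.1, inv_iota2 (pi2 t.1.1, t.1.2)) else (n0, n2).

Variables (m0 : N0) (m1 : N1) (m2 : N2).

Definition cloud (b0 : B0) : I := ((iota1 m1).1, (iota2 m2).1, (m0, b0)).

Definition message_error (xB : XB) : R :=
  Ex (ch (x1 (d1 ((iota1 m1).1, (iota1 m1).2))) xB (x2 (d2 ((iota2 m2).1, (iota2 m2).2))))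
    (fun y => ((decode1 y.1 != (m0, m1)) || (decode2 y.2 != (m0, m2)))%:R).

Lemma message_error_ge0 xB : 0 <= message_error xB.
Proof. by apply: Ex_ge0 => y. Qed.

Lemma message_error_le1 xB : message_error xB <= 1.
Proof. by apply: Ex_le_cst => y; case: (_ || _). Qed.

Definition at_cloud (l : B0 * B1 * B2) (T : Type)
    (f : W1 -> W2 -> U -> V -> WB -> UB -> VB -> T) : T :=
  f (c1 (iota1 m1).1) (c2 (iota2 m2).1) (d1 ((iota1 m1).1, (iota1 m1).2))
    (d2 ((iota2 m2).1, (iota2 m2).2)) (cB (cloud l.1.1)) (uB (cloud l.1.1, (iota1 m1).2, l.1.2))
    (vB (cloud l.1.1, (iota2 m2).2, l.2)).

Definition cell_error (l : B0 * B1 * B2) : R := Ex (at_cloud l kX) message_error.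

(** A wrong [b0] or a wrong part of the other relay's message counts as an error although the
    estimate may still be right; this is why these rates occur in the decoding constraints. A wrong
    [b1] alone does not change the estimate and is not counted. *)
Lemma decode1_error (l : B0 * B1 * B2) y :
  (decode1 y != (m0, m1))%:R <=
  (~~ passing1 y (cloud l.1.1, (iota1 m1).2, l.1.2))%:R +
  \sum_(t | t.1 != (cloud l.1.1, (iota1 m1).2)) (passing1 y t)%:R :> R.
Proof.
pose g (t : I * M11 * B1) := (t.1.1.2.1, inv_iota1 (pi1 t.1.1, t.1.2)).
have <- : g (cloud l.1.1, (iota1 m1).2, l.1.2) = (m0, m1).
  by rewrite /g /pi1 /= -surjective_pairing iota1K.
apply: (@pick_error _ _ _ _ (fun t => t.1 != _) g) => -[[i m] b] /negPn/eqP[-> ->].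
by [].
Qed.

Lemma decode2_error (l : B0 * B1 * B2) y :
  (decode2 y != (m0, m2))%:R <=
  (~~ passing2 y (cloud l.1.1, (iota2 m2).2, l.2))%:R +
  \sum_(t | t.1 != (cloud l.1.1, (iota2 m2).2)) (passing2 y t)%:R :> R.
Proof.
pose g (t : I * M22 * B2) := (t.1.1.2.1, inv_iota2 (pi2 t.1.1, t.1.2)).
have <- : g (cloud l.1.1, (iota2 m2).2, l.2) = (m0, m2).
  by rewrite /g /pi2 /= -surjective_pairing iota2K.
apply: (@pick_error _ _ _ _ (fun t => t.1 != _) g) => -[[i m] b] /negPn/eqP[-> ->].
by [].
Qed.

Variable xB0 : XB.

Definition best_input : XB := [arg min_(xB < xB0) message_error xB]%O.

Lemma best_input_le l : message_error best_input <= cell_error l.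
Proof.
rewrite -[leLHS](Ex_cst (at_cloud l kX)); apply: le_Ex => xB.
by rewrite /best_input; case: arg_minP => // xB' _; exact.
Qed.

End Codebook.

Let out1 w1 w2 u v wB ub vb (f : Y1 -> R) : R :=
  Ex (kX w1 w2 u v wB ub vb) (fun xB => Ex (ch (x1 u) xB (x2 v)) (fun y => f y.1)).

Let out2 w1 w2 u v wB ub vb (f : Y2 -> R) : R :=
  Ex (kX w1 w2 u v wB ub vb) (fun xB => Ex (ch (x1 u) xB (x2 v)) (fun y => f y.2)).

Let sum_eq (Y : finType) (f : Y -> R) y : \sum_y' f y' * (y == y')%:R = f y.
Proof.
rewrite (bigD1 y) //= eqxx mulr1 big1 ?addr0 // => y' yy'.
by rewrite eq_sym (negbTE yy') mulr0.
Qed.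

(** Disintegration over the output value, since the confusion bounds hold for one fixed [y] at a
    time. *)
Let out1E w1 w2 u v wB ub vb f : out1 w1 w2 u v wB ub vb f =
  \sum_y1 out1 w1 w2 u v wB ub vb (fun y => (y == y1)%:R) * f y1.
Proof.
rewrite /out1; under [RHS]eq_bigr do rewrite -ExZr.
rewrite -Ex_sum; apply: eq_Ex => xB.
under [RHS]eq_bigr do rewrite -ExZr.
rewrite -Ex_sum; apply: eq_Ex => y.
by under eq_bigr do rewrite mulrC; rewrite sum_eq.
Qed.

Let out2E w1 w2 u v wB ub vb f : out2 w1 w2 u v wB ub vb f =
  \sum_y2 out2 w1 w2 u v wB ub vb (fun y => (y == y2)%:R) * f y2.
Proof.
rewrite /out2; under [RHS]eq_bigr do rewrite -ExZr.
rewrite -Ex_sum; apply: eq_Ex => xB.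
under [RHS]eq_bigr do rewrite -ExZr.
rewrite -Ex_sum; apply: eq_Ex => y.
by under eq_bigr do rewrite mulrC; rewrite sum_eq.
Qed.

Let out1_ge0 w1 w2 u v wB ub vb f : (forall y, 0 <= f y) -> 0 <= out1 w1 w2 u v wB ub vb f.
Proof. by move=> f0; do 2 (apply: Ex_ge0 => ?). Qed.

Let out2_ge0 w1 w2 u v wB ub vb f : (forall y, 0 <= f y) -> 0 <= out2 w1 w2 u v wB ub vb f.
Proof. by move=> f0; do 2 (apply: Ex_ge0 => ?). Qed.

Let G1 y w1 w2 u v wB ub vb : R :=
  om w1 w2 u v wB ub vb * out1 w1 w2 u v wB ub vb (fun y' => (y' == y)%:R).

Let G2 y w1 w2 u v wB ub vb : R :=
  om w1 w2 u v wB ub vb * out2 w1 w2 u v wB ub vb (fun y' => (y' == y)%:R).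

Let G1_ge0 y w1 w2 u v wB ub vb : 0 <= G1 y w1 w2 u v wB ub vb.
Proof. by rewrite mulr_ge0 ?om_ge0 // out1_ge0. Qed.

Let G2_ge0 y w1 w2 u v wB ub vb : 0 <= G2 y w1 w2 u v wB ub vb.
Proof. by rewrite mulr_ge0 ?om_ge0 // out2_ge0. Qed.

Let G1_le1 : \sum_y single k1 k1' k2 k2' k4 k5 k6 (G1 y) <= 1.
Proof.
rewrite -single_sum -(truth_cst 1); apply: le_trans (single_om_le _) => //.
apply: le_of_eq; rewrite /single.
do 7 (apply: eq_Ex => ?); rewrite /G1 -mulr_sumr; congr (_ * _).
rewrite [RHS](out1E _ _ _ _ _ _ _ (fun=> 1)).
by under [RHS]eq_bigr do rewrite mulr1.
Qed.

Let G2_le1 : \sum_y single k1' k1 k2' k2 (fun w2 w1 => k4 w1 w2) (fun w2 w1 => k6 w1 w2)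
    (fun w2 w1 => k5 w1 w2) (fun w2 w1 v u wB vb ub => G2 y w1 w2 u v wB ub vb) <= 1.
Proof.
under eq_bigr do rewrite -(single_swap k1 k1' k2 k2' k4 k5 k6).
rewrite -single_sum -(truth_cst 1); apply: le_trans (single_om_le _) => //.
apply: le_of_eq; rewrite /single.
do 7 (apply: eq_Ex => ?); rewrite /G2 -mulr_sumr; congr (_ * _).
rewrite [RHS](out2E _ _ _ _ _ _ _ (fun=> 1)).
by under [RHS]eq_bigr do rewrite mulr1.
Qed.

Let sum1 (T : finType) (a : T) : \sum_t (t == a)%:R = 1 :> R.
Proof. by rewrite (bigD1 a) //= eqxx big1 ?addr0 // => t /negbTE->. Qed.

Let card_I : #|I|%:R = nM10 * nM20 * nK.
Proof. by rewrite !card_prod !natrM. Qed.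

Let card12 a b : \sum_(i : I) ((pi1 i == a) && (pi2 i == b))%:R = nK :> R.
Proof.
rewrite -(pair_bigA _ (fun (x : M10 * M20) (_ : N0 * B0) => ((x.1 == a) && (x.2 == b))%:R)) /=.
under eq_bigr do rewrite sumr_const -(mulr_natr _ #|_|) card_prod natrM.
rewrite -mulr_suml -(pair_bigA _ (fun x y => ((x == a) && (y == b))%:R)) /=.
under eq_bigr do under eq_bigr do rewrite -mulnb natrM.
under eq_bigr do rewrite -mulr_sumr sum1 mulr1.
by rewrite sum1 mul1r.
Qed.

Let card1 a : \sum_(i : I) (pi1 i == a)%:R = nM20 * nK :> R.
Proof.
rewrite -(pair_bigA _ (fun (x : M10 * M20) (_ : N0 * B0) => (x.1 == a)%:R)) /=.
under eq_bigr do rewrite sumr_const -(mulr_natr _ #|_|) card_prod natrM.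
rewrite -mulr_suml -(pair_bigA _ (fun x _ => (x == a)%:R)) /=.
under eq_bigr do rewrite sumr_const -(mulr_natr _ #|_|).
by rewrite -mulr_suml sum1 mul1r.
Qed.

Let card2 b : \sum_(i : I) (pi2 i == b)%:R = nM10 * nK :> R.
Proof.
rewrite -(pair_bigA _ (fun (x : M10 * M20) (_ : N0 * B0) => (x.2 == b)%:R)) /=.
under eq_bigr do rewrite sumr_const -(mulr_natr _ #|_|) card_prod natrM.
rewrite -mulr_suml -(pair_bigA _ (fun _ y => (y == b)%:R)) /=.
under eq_bigr do rewrite sum1.
by rewrite sumr_const.
Qed.

(** Each receiver fails only if the sent tuple does not pass its test or a wrong tuple does. With
    the weight [om] the sent tuple follows the target law up to truncation, which gives the two
    [truth] terms; the wrong tuples keep the codebook law outside what they share with it. *)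
Lemma ensemble_cell_error m0 m1 m2 l :
  ens (fun c1 c2 d1 d2 cB uB vB => at_cloud c1 c2 d1 d2 cB uB vB m0 m1 m2 l om *
    cell_error c1 c2 d1 d2 cB uB vB m0 m1 m2 l) <=
  truth (fun w1 w2 u v wB ub vb xB y => (~~ pass1 w1 w2 wB u ub y.1)%:R) +
  truth (fun w1 w2 u v wB ub vb xB y => (~~ pass2 w2 w1 wB v vb y.2)%:R) +
  (confusion1 + confusion2).
Proof.
set i := cloud m0 m1 m2 l.1.1.
pose E1 w1 w2 u v wB ub vb := om w1 w2 u v wB ub vb * out1 w1 w2 u v wB ub vb
  (fun y => (~~ pass1 w1 w2 wB u ub y)%:R).
pose E2 w1 w2 u v wB ub vb := om w1 w2 u v wB ub vb * out2 w1 w2 u v wB ub vb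
  (fun y => (~~ pass2 w2 w1 wB v vb y)%:R).
apply: (@le_trans _ _ (ens (fun c1 c2 d1 d2 cB uB vB =>
  at_cloud c1 c2 d1 d2 cB uB vB m0 m1 m2 l E1 +
  (at_cloud c1 c2 d1 d2 cB uB vB m0 m1 m2 l E2 +
  (\sum_y at_cloud c1 c2 d1 d2 cB uB vB m0 m1 m2 l (G1 y) *
     (\sum_(t | t.1 != (i, (iota1 m1).2)) (passing1 c1 c2 d1 cB uB y t)%:R) +
  \sum_y at_cloud c1 c2 d1 d2 cB uB vB m0 m1 m2 l (G2 y) *
     (\sum_(t | t.1 != (i, (iota2 m2).2)) (passing2 c1 c2 d2 cB vB y t)%:R)))))).
  apply: le_ensemble => c1 c2 d1 d2 cB uB vB.
  rewrite /at_cloud /E1 /E2 /G1 /G2.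
  set o := om _ _ _ _ _ _ _.
  under [X in _ <= _ + (_ + (X + _))]eq_bigr do rewrite -mulrA.
  under [X in _ <= _ + (_ + (_ + X))]eq_bigr do rewrite -mulrA.
  rewrite -!mulr_sumr -out1E -out2E -!mulrDr ler_wpM2l ?om_ge0 //.
  rewrite /cell_error /at_cloud /message_error /out1 /out2 -!ExD.
  apply: le_Ex => xB; rewrite -!ExD; apply: le_Ex => y.
  apply: (@le_trans _ _ ((decode1 c1 c2 d1 cB uB y.1 != (m0, m1))%:R +
                         (decode2 c1 c2 d2 cB vB y.2 != (m0, m2))%:R)).
    by case: (_ != _); case: (_ != _); rewrite /= ?addr0 ?add0r ?lerDl.
  apply: le_trans (lerD (decode1_error c1 c2 d1 cB uB m0 m1 m2 l y.1)
                        (decode2_error c1 c2 d2 cB vB m0 m1 m2 l y.2)) _.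
  by rewrite addrACA -!addrA lexx.
rewrite !ensembleD addrA; apply: lerD; apply: lerD.
- rewrite (ensemble_single k1 k1' k2 k2' k4 k5 k6 pi1 pi2 E1 i (iota1 m1).2 (iota2 m2).2 l.1.2 l.2).
  by apply: single_om_le => *; rewrite ler0n.
- rewrite (ensemble_single k1 k1' k2 k2' k4 k5 k6 pi1 pi2 E2 i (iota1 m1).2 (iota2 m2).2 l.1.2 l.2).
  by apply: single_om_le => *; rewrite ler0n.
- rewrite /confusion1 -card_I.
  have h12 : \sum_i' ((pi1 i' == pi1 i) && (pi2 i' == pi2 i))%:R <= nK by rewrite card12.
  have h1 : \sum_i' (pi1 i' == pi1 i)%:R <= nM20 * nK by rewrite card1.
  have h2 : \sum_i' (pi2 i' == pi2 i)%:R <= nM10 * nK by rewrite card2.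
  exact: (@ensemble_confusion_total R W1 W2 U V WB UB VB Y1 k1 k1' k2 k2' k4 k5 k6
    M10 M20 M11 M22 I B1 B2 pi1 pi2 G1 G1_ge0 G1_le1 pass1 D1 D2 D3 D4 D5 D6 D7
    P_D1 P_D2 P_D3 P_D4 P_D5 P_D6 P_D7
    D1_ge0 D2_ge0 D3_ge0 D4_ge0 D5_ge0 D6_ge0 D7_ge0
    i (iota1 m1).2 (iota2 m2).2 l.1.2 l.2 _ _ _ h12 h1 h2).
(* The second receiver is the first one after exchanging the relays. *)
rewrite ensemble_swap /confusion2 -card_I.
have h12 : \sum_i' ((pi2 i' == pi2 i) && (pi1 i' == pi1 i))%:R <= nK.
  by under eq_bigr do rewrite andbC; rewrite card12.
have h1 : \sum_i' (pi1 i' == pi1 i)%:R <= nM20 * nK by rewrite card1.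
have h2 : \sum_i' (pi2 i' == pi2 i)%:R <= nM10 * nK by rewrite card2.
exact: (@ensemble_confusion_total R W2 W1 V U WB VB UB Y2 k1' k1 k2' k2
    (fun w2 w1 => k4 w1 w2) (fun w2 w1 => k6 w1 w2) (fun w2 w1 => k5 w1 w2)
    M20 M10 M22 M11 I B2 B1 pi2 pi1 (fun y w2 w1 v u wB vb ub => G2 y w1 w2 u v wB ub vb)
    (fun y w2 w1 v u wB vb ub => G2_ge0 y w1 w2 u v wB ub vb) G2_le1
    pass2 D1' D2' D3' D4' D5' D6' D7'
    Q_D1 Q_D2 Q_D3 Q_D4 Q_D5 Q_D6 Q_D7
    D1'_ge0 D2'_ge0 D3'_ge0 D4'_ge0 D5'_ge0 D6'_ge0 D7'_ge0
    i (iota2 m2).2 (iota1 m1).2 l.2 l.1.2 _ _ _ h12 h2 h1).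
Qed.

(** By [sum_omE1], the target probability of [A] given the four relay codewords. *)
Let mass w1 w2 u v : R := Ex (k4 w1 w2) (fun wB => Ex (k5 w1 w2 wB u) (fun ub =>
  Ex (k6 w1 w2 wB v) (om w1 w2 u v wB ub))).

Let N := nB0 * nB1 * nB2.

Definition variance_bound : R :=
  T0 / nB0 + T1 / (nB0 * nB1) + T2 / (nB0 * nB2) + T3 / (nB0 * nB1 * nB2).

(** The bound holds for each choice of the four relay codebooks: once they are fixed, all cells of a
    message triple refer to the same [(w1, w2, u, v)], as [cell_variance] requires. *)
Lemma ensemble_variance (m0 : N0) m1 m2 :
  ens (fun c1 c2 d1 d2 cB uB vB =>
    (N^-1 * \sum_l at_cloud c1 c2 d1 d2 cB uB vB m0 m1 m2 l om -
     mass (c1 (iota1 m1).1) (c2 (iota2 m2).1) (d1 ((iota1 m1).1, (iota1 m1).2))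
       (d2 ((iota2 m2).1, (iota2 m2).2))) ^+ 2) <= variance_bound.
Proof.
rewrite /ensemble; apply: Ex_le_cst => c1; apply: Ex_le_cst => c2.
apply: Ex_le_cst => d1; apply: Ex_le_cst => d2.
set w1 := c1 _; set w2 := c2 _; set u := d1 _; set v := d2 _.
apply: (@cell_variance R WB UB VB B0 B1 B2 I (I * M11 * B1)%type (I * M22 * B2)%type
  (k4 w1 w2) (fun wB => k5 w1 w2 wB u) (fun wB => k6 w1 w2 wB v)
  (fun i => k4 (c1 (pi1 i)) (c2 (pi2 i)))
  (fun cB j => k5 (c1 (pi1 j.1.1)) (c2 (pi2 j.1.1)) (cB j.1.1) (d1 (pi1 j.1.1, j.1.2)))
  (fun cB j => k6 (c1 (pi1 j.1.1)) (c2 (pi2 j.1.1)) (cB j.1.1) (d2 (pi2 j.1.1, j.1.2)))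
  (cloud m0 m1 m2) (fun b b1 => (cloud m0 m1 m2 b, (iota1 m1).2, b1))
  (fun b b2 => (cloud m0 m1 m2 b, (iota2 m2).2, b2))) => //.
- by move=> b b' [].
- by move=> b b' b1 b1' [-> ->].
- by move=> b b' b2 b2' [-> ->].
- exact: om_moment0.
- exact: om_moment1.
- exact: om_moment2.
- exact: om_moment3.
Qed.

Let mass_le1 w1 w2 u v : mass w1 w2 u v <= 1.
Proof.
rewrite /mass sum_omE1 -[leRHS](pB_sum1 w1 w2 u v).
apply: ler_sum => wB _; apply: ler_sum => ub _; apply: ler_sum => vb _.
by case: (A _ _ _ _ _ _ _); rewrite ?mulr1 ?mulr0 ?lexx ?pB_ge0.
Qed.

Lemma ensemble_mass (m0 : N0) m1 m2 :
  ens (fun c1 c2 d1 d2 cB uB vB =>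
    1 - mass (c1 (iota1 m1).1) (c2 (iota2 m2).1) (d1 ((iota1 m1).1, (iota1 m1).2))
       (d2 ((iota2 m2).1, (iota2 m2).2))) =
  truth (fun w1 w2 u v wB ub vb xB y => (~~ A w1 w2 u v wB ub vb)%:R).
Proof.
(* Any cell will do, as the integrand depends on the relay codewords only. *)
have /card_gt0P[b0 _] := B0_gt0.
have /card_gt0P[b1 _] := B1_gt0.
have /card_gt0P[b2 _] := B2_gt0.
rewrite (ensemble_single k1 k1' k2 k2' k4 k5 k6 pi1 pi2
  (fun w1 w2 u v _ _ _ => 1 - mass w1 w2 u v) (cloud m0 m1 m2 b0)
  (iota1 m1).2 (iota2 m2).2 b1 b2).
apply: eq_Ex => w1; apply: eq_Ex => w2; apply: eq_Ex => u; apply: eq_Ex => v.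
under eq_Ex do under eq_Ex do rewrite Ex_cst.
under eq_Ex do rewrite Ex_cst.
rewrite Ex_cst /mass sum_omE1 -[X in X - _](pB_sum1 w1 w2 u v) -sumrB.
apply: eq_bigr => wB _; rewrite -sumrB; apply: eq_bigr => ub _; rewrite -sumrB.
apply: eq_bigr => vb _.
under eq_Ex do rewrite Ex_cst.
rewrite Ex_cst; case: (A _ _ _ _ _ _ _); first by rewrite mulr1 subrr mulr0.
by rewrite mulr0 subr0 mulr1.
Qed.

Variable xB0 : XB.

Definition error_bound : R :=
  2 * (truth (fun w1 w2 u v wB ub vb xB y => (~~ pass1 w1 w2 wB u ub y.1)%:R) +
       truth (fun w1 w2 u v wB ub vb xB y => (~~ pass2 w2 w1 wB v vb y.2)%:R) +
       (confusion1 + confusion2)) +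
  (16 * variance_bound +
   4 * truth (fun w1 w2 u v wB ub vb xB y => (~~ A w1 w2 u v wB ub vb)%:R)).

(** [le_weighted_error] is applied codebook by codebook: [E] is the error of the best input, [S] the
    average weight of the cells and [s] the mass. The best input is at least as good as every cell,
    which bounds [E * S] by the weighted average of cell errors. *)
Lemma ensemble_message_error m0 m1 m2 :
  ens (fun c1 c2 d1 d2 cB uB vB => message_error c1 c2 d1 d2 cB uB vB m0 m1 m2
    (best_input c1 c2 d1 d2 cB uB vB m0 m1 m2 xB0)) <= error_bound.
Proof.
have Np : 0 < N by rewrite !mulr_gt0 // ltr0n.
apply: (@le_trans _ _ (ens (fun c1 c2 d1 d2 cB uB vB =>
  2 * (N^-1 * \sum_l at_cloud c1 c2 d1 d2 cB uB vB m0 m1 m2 l om *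
        cell_error c1 c2 d1 d2 cB uB vB m0 m1 m2 l) +
  (16 * (N^-1 * \sum_l at_cloud c1 c2 d1 d2 cB uB vB m0 m1 m2 l om -
     mass (c1 (iota1 m1).1) (c2 (iota2 m2).1) (d1 ((iota1 m1).1, (iota1 m1).2))
       (d2 ((iota2 m2).1, (iota2 m2).2))) ^+ 2 +
   4 * (1 - mass (c1 (iota1 m1).1) (c2 (iota2 m2).1) (d1 ((iota1 m1).1, (iota1 m1).2))
       (d2 ((iota2 m2).1, (iota2 m2).2))))))).
  apply: le_ensemble => c1 c2 d1 d2 cB uB vB.
  apply: le_weighted_error.
  - exact: message_error_ge0.
  - exact: message_error_le1.
  - exact: mass_le1.
  - rewrite mulr_ge0 ?invr_ge0 ?(ltW Np) //; apply: sumr_ge0 => l _.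
    by rewrite mulr_ge0 ?om_ge0 //; apply: Ex_ge0 => xB; exact: message_error_ge0.
  - rewrite mulrCA ler_wpM2l ?invr_ge0 ?(ltW Np) // mulr_sumr; apply: ler_sum => l _.
    by rewrite mulrC ler_wpM2l ?om_ge0 // best_input_le.
rewrite ensembleD ensembleD !ensembleZ ensemble_sum; apply: lerD.
  rewrite ler_wpM2l // mulrC ler_pdivrMr //.
  apply: (le_trans (ler_sum _ (fun l _ => ensemble_cell_error m0 m1 m2 l))).
  by rewrite sumr_const !card_prod -mulr_natr !natrM.
rewrite (ensemble_mass m0); apply: lerD; last exact: lexx.
by rewrite ler_wpM2l //; exact: ensemble_variance.
Qed.

(** The sum over message triples is taken inside the ensemble average, so that one codebook is good
    for all of them on average. *)
Theorem one_shot : exists (enc1 : N1 -> X1) (enc2 : N2 -> X2) (encB : N0 -> N1 -> N2 -> XB)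
    (dec1 : Y1 -> N0 * N1) (dec2 : Y2 -> N0 * N2),
  \sum_m0 \sum_m1 \sum_m2 Ex (ch (enc1 m1) (encB m0 m1 m2) (enc2 m2))
    (fun y => ((dec1 y.1 != (m0, m1)) || (dec2 y.2 != (m0, m2)))%:R) <=
  (#|N0| * #|N1| * #|N2|)%:R * error_bound.
Proof.
have : ens (fun c1 c2 d1 d2 cB uB vB => \sum_m0 \sum_m1 \sum_m2
    message_error c1 c2 d1 d2 cB uB vB m0 m1 m2
    (best_input c1 c2 d1 d2 cB uB vB m0 m1 m2 xB0)) <=
    (#|N0| * #|N1| * #|N2|)%:R * error_bound.
  have -> : (#|N0| * #|N1| * #|N2|)%:R * error_bound =
      \sum_(m0 : N0) \sum_(m1 : N1) \sum_(m2 : N2) error_bound.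
    have sumc (T : finType) (c : R) : \sum_(t : T) c = #|T|%:R * c.
      by rewrite sumr_const mulr_natl.
    by rewrite !sumc !natrM !mulrA.
  rewrite ensemble_sum; apply: ler_sum => m0 _.
  rewrite ensemble_sum; apply: ler_sum => m1 _.
  by rewrite ensemble_sum; apply: ler_sum => m2 _; exact: ensemble_message_error.
move=> /ensemble_exists_le[c1 [c2 [d1 [d2 [cB [uB [vB h]]]]]]].
exists (fun m1 => x1 (d1 ((iota1 m1).1, (iota1 m1).2))).
exists (fun m2 => x2 (d2 ((iota2 m2).1, (iota2 m2).2))).
exists (fun m0 m1 m2 => best_input c1 c2 d1 d2 cB uB vB m0 m1 m2 xB0).
by exists (decode1 c1 c2 d1 cB uB), (decode2 c1 c2 d2 cB vB).
Qed.

End OneShot.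

Section TruthLemmas.
Variables (R : realType) (W1 W2 U V WB UB VB X1 X2 XB Y1 Y2 : finType).
Variable ch : X1 -> XB -> X2 -> fdist R (Y1 * Y2)%type.
Variables (k1 : fdist R W1) (k1' : fdist R W2).
Variables (k2 : W1 -> fdist R U) (k2' : W2 -> fdist R V).
Variables (x1 : U -> X1) (x2 : V -> X2).
Variable pB : W1 -> W2 -> U -> V -> WB -> UB -> VB -> R.
Hypothesis pB_ge0 : forall w1 w2 u v wB ub vb, 0 <= pB w1 w2 u v wB ub vb.
Variable kX : W1 -> W2 -> U -> V -> WB -> UB -> VB -> fdist R XB.

Local Notation tr := (truth ch k1 k1' k2 k2' x1 x2 pB kX).

Lemma le_truth f g :
  (forall w1 w2 u v wB ub vb xB y, 0 < k1 w1 -> 0 < k1' w2 -> 0 < k2 w1 u ->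
     0 < k2' w2 v -> 0 < pB w1 w2 u v wB ub vb -> 0 < kX w1 w2 u v wB ub vb xB ->
     0 < ch (x1 u) xB (x2 v) y ->
     f w1 w2 u v wB ub vb xB y <= g w1 w2 u v wB ub vb xB y) ->
  tr f <= tr g.
Proof.
move=> fg; apply: le_Ex_supp => w1 h1; apply: le_Ex_supp => w2 h2.
apply: le_Ex_supp => u h3; apply: le_Ex_supp => v h4.
apply: ler_sum => wB _; apply: ler_sum => ub _; apply: ler_sum => vb _.
have := pB_ge0 w1 w2 u v wB ub vb; rewrite le_eqVlt => /predU1P[<-|h5].
  by rewrite !mul0r.
rewrite ler_pM2l //; apply: le_Ex_supp => xB h6; apply: le_Ex_supp => y h7.
exact: fg.
Qed.

Lemma truthD f g : tr (fun w1 w2 u v wB ub vb xB y =>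
    f w1 w2 u v wB ub vb xB y + g w1 w2 u v wB ub vb xB y) = tr f + tr g.
Proof.
rewrite /truth; do 4 (rewrite -ExD; apply: eq_Ex => ?).
do 3 (rewrite -big_split; apply: eq_bigr => ? _ /=).
rewrite -mulrDr; congr (_ * _).
by rewrite -ExD; apply: eq_Ex => ?; rewrite -ExD.
Qed.

End TruthLemmas.

(** * Memoryless extension to words *)

Section NLetter.
Variables (R : realType) (W1 W2 U V WB UB VB X1 X2 XB Y1 Y2 : finType).
Variable ch : X1 -> XB -> X2 -> fdist R (Y1 * Y2)%type.
Variable J : finType.
Variables (k1 : J -> fdist R W1) (k1' : J -> fdist R W2).
Variables (k2 : J -> W1 -> fdist R U) (k2' : J -> W2 -> fdist R V).
Variables (x1 : U -> X1) (x2 : V -> X2).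
Variable pB : J -> W1 -> W2 -> U -> V -> WB -> UB -> VB -> R.
Hypothesis pB_ge0 : forall j w1 w2 u v wB ub vb, 0 <= pB j w1 w2 u v wB ub vb.
Variable kX : J -> W1 -> W2 -> U -> V -> WB -> UB -> VB -> fdist R XB.

Lemma sum_ffun_prod (A : finType) (f : J -> A -> R) :
  \sum_(c : {ffun J -> A}) \prod_j f j (c j) = \prod_j \sum_a f j a.
Proof. by rewrite bigA_distr_bigA. Qed.

Section MemorylessChannel.
Variables (a1 : {ffun J -> X1}) (aB : {ffun J -> XB}) (a2 : {ffun J -> X2}).

(** A law on pairs of words rather than on words of pairs, so that each receiver has its own output
    alphabet in the one-shot bound. *)
Definition memoryless_pmf (y : {ffun J -> Y1} * {ffun J -> Y2}) : R :=
  \prod_j ch (a1 j) (aB j) (a2 j) (y.1 j, y.2 j).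

Lemma memoryless_ge0 y : 0 <= memoryless_pmf y.
Proof. by apply: prodr_ge0 => j _; exact: pmf_ge0. Qed.

Lemma memoryless_prod (f : J -> Y1 * Y2 -> R) :
  \sum_y memoryless_pmf y * \prod_j f j (y.1 j, y.2 j) =
  \prod_j Ex (ch (a1 j) (aB j) (a2 j)) (f j).
Proof.
rewrite -(pair_bigA _ (fun y1 y2 => memoryless_pmf (y1, y2) *
  \prod_j f j (y1 j, y2 j))) /=.
under eq_bigr do under eq_bigr do rewrite /memoryless_pmf /= -big_split /=.
under eq_bigr => y1 _ do rewrite (sum_ffun_prod
  (fun j b => ch (a1 j) (aB j) (a2 j) (y1 j, b) * f j (y1 j, b))).
rewrite (sum_ffun_prod (fun j a =>
  \sum_b ch (a1 j) (aB j) (a2 j) (a, b) * f j (a, b))).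
apply: eq_bigr => j _.
rewrite (pair_bigA _ (fun a b => ch (a1 j) (aB j) (a2 j) (a, b) * f j (a, b))) /=.
by apply: eq_bigr => -[a b].
Qed.

Lemma memoryless_sum1 : \sum_y memoryless_pmf y = 1.
Proof.
pose one (_ : J) (_ : Y1 * Y2) : R := 1.
transitivity (\sum_y memoryless_pmf y * \prod_j one j (y.1 j, y.2 j)).
  by apply: eq_bigr => y _; rewrite [X in _ * X]big1 ?mulr1.
by rewrite (memoryless_prod one) big1 // => j _; rewrite Ex_cst.
Qed.

Definition memoryless : fdist R ({ffun J -> Y1} * {ffun J -> Y2})%type :=
  FDist memoryless_ge0 memoryless_sum1.

Lemma memoryless_gt0 y j : 0 < memoryless y -> 0 < ch (a1 j) (aB j) (a2 j) (y.1 j, y.2 j).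
Proof.
rewrite lt0r => /andP[/prodf_neq0/(_ j isT) h _].
by rewrite lt0r h pmf_ge0.
Qed.

End MemorylessChannel.

Definition pBn (w1 : {ffun J -> W1}) (w2 : {ffun J -> W2}) (u : {ffun J -> U})
    (v : {ffun J -> V}) (wB : {ffun J -> WB}) (ub : {ffun J -> UB}) (vb : {ffun J -> VB}) : R :=
  \prod_j pB j (w1 j) (w2 j) (u j) (v j) (wB j) (ub j) (vb j).

Lemma pBn_ge0 w1 w2 u v wB ub vb : 0 <= pBn w1 w2 u v wB ub vb.
Proof. by apply: prodr_ge0. Qed.

Lemma pBn_gt0 w1 w2 u v wB ub vb j : 0 < pBn w1 w2 u v wB ub vb ->
  0 < pB j (w1 j) (w2 j) (u j) (v j) (wB j) (ub j) (vb j).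
Proof.
rewrite lt0r => /andP[/prodf_neq0/(_ j isT) h _].
by rewrite lt0r h pB_ge0.
Qed.

Definition truthn : _ -> R := truth memoryless (fam k1) (fam k1')
  (fun w1 : {ffun J -> W1} => fam (fun j => k2 j (w1 j)))
  (fun w2 : {ffun J -> W2} => fam (fun j => k2' j (w2 j)))
  (fun u : {ffun J -> U} => [ffun j => x1 (u j)])
  (fun v : {ffun J -> V} => [ffun j => x2 (v j)]) pBn
  (fun (w1 : {ffun J -> W1}) (w2 : {ffun J -> W2}) (u : {ffun J -> U})
    (v : {ffun J -> V}) (wB : {ffun J -> WB}) (ub : {ffun J -> UB}) (vb : {ffun J -> VB}) =>
    fam (fun j => kX j (w1 j) (w2 j) (u j) (v j) (wB j) (ub j) (vb j))).

(** Given the layers above it, each layer has independent coordinates, so the product over [j]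
    passes through one average at a time. *)
Lemma truthn_prod (f : J -> W1 -> W2 -> U -> V -> WB -> UB -> VB -> XB -> Y1 * Y2 -> R) :
  truthn (fun w1 w2 u v wB ub vb xB y => \prod_j
    f j (w1 j) (w2 j) (u j) (v j) (wB j) (ub j) (vb j) (xB j) (y.1 j, y.2 j)) =
  \prod_j truth ch (k1 j) (k1' j) (k2 j) (k2' j) x1 x2 (pB j) (kX j) (f j).
Proof.
pose g8 j w1 w2 u v wB ub vb xB := Ex (ch (x1 u) xB (x2 v)) (f j w1 w2 u v wB ub vb xB).
pose g7 j w1 w2 u v wB ub vb := pB j w1 w2 u v wB ub vb *
  Ex (kX j w1 w2 u v wB ub vb) (g8 j w1 w2 u v wB ub vb).
pose g4 j w1 w2 u v := \sum_wB \sum_ub \sum_vb g7 j w1 w2 u v wB ub vb.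
rewrite /truthn /truth.
rewrite -(Ex_fam_prod k1 (fun j w1 => Ex (k1' j) (fun w2 => Ex (k2 j w1) (fun u =>
   Ex (k2' j w2) (g4 j w1 w2 u))))).
apply: eq_Ex => w1.
rewrite -(Ex_fam_prod k1' (fun j w2 => Ex (k2 j (w1 j)) (fun u =>
   Ex (k2' j w2) (g4 j (w1 j) w2 u)))).
apply: eq_Ex => w2.
rewrite -(Ex_fam_prod (fun j => k2 j (w1 j)) (fun j u =>
   Ex (k2' j (w2 j)) (g4 j (w1 j) (w2 j) u))).
apply: eq_Ex => u.
rewrite -(Ex_fam_prod (fun j => k2' j (w2 j)) (fun j v => g4 j (w1 j) (w2 j) (u j) v)).
apply: eq_Ex => v.
rewrite /g4.
rewrite -(sum_ffun_prod (fun j wB => \sum_ub \sum_vb g7 j (w1 j) (w2 j) (u j) (v j) wB ub vb)).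
apply: eq_bigr => wB _.
rewrite -(sum_ffun_prod (fun j ub => \sum_vb g7 j (w1 j) (w2 j) (u j) (v j) (wB j) ub vb)).
apply: eq_bigr => ub _.
rewrite -(sum_ffun_prod (fun j vb => g7 j (w1 j) (w2 j) (u j) (v j) (wB j) (ub j) vb)).
apply: eq_bigr => vb _.
rewrite /g7 big_split /=; congr (_ * _).
rewrite -(Ex_fam_prod (fun j => kX j (w1 j) (w2 j) (u j) (v j) (wB j) (ub j) (vb j))
  (fun j xB => g8 j (w1 j) (w2 j) (u j) (v j) (wB j) (ub j) (vb j) xB)).
apply: eq_Ex => xB.
rewrite {1}/Ex (memoryless_prod _ _ _ (fun j => f j (w1 j) (w2 j) (u j) (v j) (wB j)
  (ub j) (vb j) (xB j))).
by apply: eq_bigr => j _; rewrite /g8 !ffunE.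
Qed.

End NLetter.

(** * Exponential bounds *)

Section Chernoff.
Variable R : realType.

(** From [expR (- x) >= 1 - x] one gets [expR x <= (1 - x)^-1], and [(1 + x + 2 * x ^+ 2) * (1 - x)
    = 1 + x ^+ 2 * (1 - 2 * x)]. *)
Lemma expR_le_quadratic (x : R) : x <= 2^-1 -> expR x <= 1 + x + 2 * x ^+ 2.
Proof.
move=> hx; have h1 : 0 < 1 - x by lra.
have := expR_ge1Dx (- x); rewrite expRN => h2.
rewrite -[expR x]invrK; apply: (@le_trans _ _ (1 - x)^-1).
  by rewrite lef_pV2 ?posrE ?invr_gt0 ?expR_gt0.
rewrite -[leLHS]mul1r ler_pdivrMr //.
have : 0 <= x ^+ 2 * (1 - 2 * x) by rewrite mulr_ge0 ?sqr_ge0 //; lra.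
by move=> h3; rewrite -subr_ge0; apply: le_trans h3 _; apply: le_of_eq; ring.
Qed.

(** To first order in [l] the expectation is [1 - l * Ex mu z], and for small [l] the quadratic
    remainder does not compensate the decrease. *)
Lemma chernoff_base (T : finType) (mu : fdist R T) (z : T -> R) : 0 < Ex mu z ->
  exists2 l, 0 < l & Ex mu (fun t => expR (- (l * z t))) < 1.
Proof.
move=> D0; set D := Ex mu z in D0.
have [M M1 zM] : exists2 M, 1 <= M & forall t, `|z t| <= M.
  exists (1 + \sum_t `|z t|); first by rewrite lerDl sumr_ge0.
  by move=> t; rewrite (bigD1 t) //= addrCA lerDl addr_ge0 // sumr_ge0.
have DM : D <= M.
  by apply: Ex_le_cst => t; rewrite (le_trans (ler_norm _)).
have M0 : 0 < M by lra.
(* The minimizer of [1 - l * D + 2 * (l * M) ^+ 2], where the value is [1 - l * (D / 2)]. Since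
   [D <= M], it keeps [l * M] below [1/4], within the range of the quadratic bound. *)
pose l := D / (4 * M ^+ 2).
have l0 : 0 < l by rewrite divr_gt0 // mulr_gt0 // exprn_gt0.
exists l => //.
apply: (@le_lt_trans _ _ (Ex mu (fun t => (1 + 2 * (l * M) ^+ 2) + - l * z t))).
  apply: le_Ex => t.
  have ht : `|l * z t| <= l * M by rewrite normrM (gtr0_norm l0) ler_pM2l.
  have lM : l * M = D / M / 4 by rewrite /l; field; rewrite gt_eqF.
  have lM4 : l * M <= 4^-1 by rewrite lM ler_piMl // ler_pdivrMr // mul1r.
  apply: le_trans (expR_le_quadratic _) _.
    by rewrite (le_trans (ler_norm _)) // normrN (le_trans ht) //; lra.
  have : (l * z t) ^+ 2 <= (l * M) ^+ 2.
    by rewrite -[leLHS]real_normK ?num_real // ler_pXn2r ?nnegrE // ltW // mulr_gt0.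
  by rewrite sqrrN mulNr; lra.
rewrite ExD Ex_cst ExZl -/D.
have -> : 1 + 2 * (l * M) ^+ 2 + - l * D = 1 - l * (D / 2).
  by rewrite /l; field; rewrite gt_eqF.
by rewrite gtrBl mulr_gt0 // divr_gt0.
Qed.

(** On the event the sum of the [ln (r j) - ln c] is nonpositive, so the exponential is at least
    [1]; the constant [c] is a threshold per coordinate. *)
Lemma indicator_chernoff (J : finType) (r : J -> R) (l c : R) :
  (forall j, 0 < r j) -> 0 < l -> 0 < c ->
  (\prod_j r j <= c ^+ #|J|)%R%:R <= \prod_j expR (- (l * (ln (r j) - ln c))).
Proof.
move=> r0 l0 c0; case: (boolP (\prod_j r j <= c ^+ #|J|)) => [h|_]; last first.
  by apply: prodr_ge0 => j _; rewrite expR_ge0.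
rewrite -expR_sum -[X in X <= _]expR0 ler_expR sumrN oppr_ge0 -mulr_sumr pmulr_rle0 //.
rewrite sumrB subr_le0 sumr_const.
rewrite -ler_expR expR_sum.
rewrite (eq_bigr r) => [|j _]; last by rewrite lnK ?posrE.
by rewrite -mulr_natr expRM_natr lnK ?posrE.
Qed.

Lemma indicator_markov (c x : R) : 0 < c -> 0 <= x -> (c < x)%R%:R <= c^-1 * x.
Proof.
move=> c0 x0; case: ltP => [cx|_]; last by rewrite mulr0n mulr_ge0 // invr_ge0 ltW.
by rewrite mulrC ler_pdivlMr // mul1r ltW.
Qed.

Lemma Ex_ind (A : finType) (p : fdist R A) (a0 : A) (f : A -> R) :
  Ex p (fun a => (a == a0)%:R * f a) = p a0 * f a0.
Proof.
rewrite /Ex (bigD1 a0) //= eqxx mul1r big1 ?addr0 // => a /negbTE->.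
by rewrite mul0r mulr0.
Qed.

End Chernoff.

Section TruthChernoff.
Variables (R : realType) (W1 W2 U V WB UB VB X1 X2 XB Y1 Y2 : finType).
Variable ch : X1 -> XB -> X2 -> fdist R (Y1 * Y2)%type.
Variable J : finType.
Variables (k1 : J -> fdist R W1) (k1' : J -> fdist R W2).
Variables (k2 : J -> W1 -> fdist R U) (k2' : J -> W2 -> fdist R V).
Variables (x1 : U -> X1) (x2 : V -> X2).
Variable pB : J -> W1 -> W2 -> U -> V -> WB -> UB -> VB -> R.
Hypothesis pB_ge0 : forall j w1 w2 u v wB ub vb, 0 <= pB j w1 w2 u v wB ub vb.
Variable kX : J -> W1 -> W2 -> U -> V -> WB -> UB -> VB -> fdist R XB.
Variable r : J -> W1 -> W2 -> U -> V -> WB -> UB -> VB -> XB -> Y1 * Y2 -> R.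
Variables l c : R.
Hypothesis l_gt0 : 0 < l.
Variable supp : J -> W1 -> W2 -> U -> V -> WB -> UB -> VB -> XB -> Y1 * Y2 -> Prop.
Hypothesis c_gt0 : 0 < c.
Hypothesis suppP : forall j w1 w2 u v wB ub vb xB y, 0 < k1 j w1 -> 0 < k1' j w2 ->
  0 < k2 j w1 u -> 0 < k2' j w2 v -> 0 < pB j w1 w2 u v wB ub vb ->
  0 < kX j w1 w2 u v wB ub vb xB -> 0 < ch (x1 u) xB (x2 v) y ->
  supp j w1 w2 u v wB ub vb xB y.
Hypothesis r_gt0 : forall j w1 w2 u v wB ub vb xB y,
  supp j w1 w2 u v wB ub vb xB y -> 0 < r j w1 w2 u v wB ub vb xB y.

(** The predicate [supp] stands for the support of the target law: logarithms of the densities are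
    meaningful only there, and it holds at every coordinate of a word of positive probability. *)
Lemma truthn_chernoff
    (F : {ffun J -> W1} -> {ffun J -> W2} -> {ffun J -> U} -> {ffun J -> V} ->
         {ffun J -> WB} -> {ffun J -> UB} -> {ffun J -> VB} -> {ffun J -> XB} ->
         {ffun J -> Y1} * {ffun J -> Y2} -> R) :
  (forall (w1 : {ffun J -> W1}) (w2 : {ffun J -> W2}) (u : {ffun J -> U}) (v : {ffun J -> V})
      (wB : {ffun J -> WB}) (ub : {ffun J -> UB}) (vb : {ffun J -> VB}) (xB : {ffun J -> XB})
      (y : {ffun J -> Y1} * {ffun J -> Y2}),
    (forall j, supp j (w1 j) (w2 j) (u j) (v j) (wB j) (ub j) (vb j) (xB j) (y.1 j, y.2 j)) ->
    F w1 w2 u v wB ub vb xB y <= (\prod_j r j (w1 j) (w2 j) (u j) (v j) (wB j) (ub j)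
        (vb j) (xB j) (y.1 j, y.2 j) <= c ^+ #|J|)%R%:R) ->
  truthn ch k1 k1' k2 k2' x1 x2 pB kX F <=
  \prod_j truth ch (k1 j) (k1' j) (k2 j) (k2' j) x1 x2 (pB j) (kX j)
    (fun w1 w2 u v wB ub vb xB y =>
       expR (- (l * (ln (r j w1 w2 u v wB ub vb xB y) - ln c)))).
Proof.
move=> FE; rewrite -(truthn_prod ch k1 k1' k2 k2' x1 x2 pB kX (fun j w1 w2 u v wB ub vb xB y =>
       expR (- (l * (ln (r j w1 w2 u v wB ub vb xB y) - ln c))))).
apply: le_truth => [*|w1 w2 u v wB ub vb xB y h1 h2 h3 h4 h5 h6 h7].
  exact: pBn_ge0.
have S j : supp j (w1 j) (w2 j) (u j) (v j) (wB j) (ub j) (vb j) (xB j) (y.1 j, y.2 j).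
  apply: suppP; [exact: fam_gt0 h1|exact: fam_gt0 h2|exact: fam_gt0 j h3|
    exact: fam_gt0 j h4|exact: (pBn_gt0 pB_ge0 j h5)|exact: fam_gt0 j h6|].
  by have := memoryless_gt0 j h7; rewrite !ffunE.
apply: le_trans (FE _ _ _ _ _ _ _ _ _ S) _.
by apply: indicator_chernoff => // j; exact: r_gt0.
Qed.

End TruthChernoff.

(** * Confusion probabilities for words *)

Section ConfusionN.
Variables (R : realType) (W1 W2 U WB UB : finType) (J : finType).
Variables (k1 : J -> fdist R W1) (k1' : J -> fdist R W2).
Variable (k2 : J -> W1 -> fdist R U).
Variable k4 : J -> W1 -> W2 -> fdist R WB.
Variable k5 : J -> W1 -> W2 -> WB -> U -> fdist R UB.
Variable r : J -> W1 -> W2 -> WB -> U -> UB -> R.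
Hypothesis r_ge0 : forall j w1 w2 wB u ub, 0 <= r j w1 w2 wB u ub.
Variable c : R.
Hypothesis c_gt0 : 0 < c.

Let r5 j w1 w2 u wB := Ex (k5 j w1 w2 wB u) (r j w1 w2 wB u).
Let r4 j w1 w2 u := Ex (k4 j w1 w2) (r5 j w1 w2 u).
Let r3 j w1 w2 := Ex (k2 j w1) (r4 j w1 w2).

Variable pass : {ffun J -> W1} -> {ffun J -> W2} -> {ffun J -> WB} -> {ffun J -> U} ->
  {ffun J -> UB} -> bool.
Hypothesis pass_r : forall w1 w2 wB u ub, pass w1 w2 wB u ub ->
  c ^+ #|J| < \prod_j r j (w1 j) (w2 j) (wB j) (u j) (ub j).

Let p5 (w1 : {ffun J -> W1}) (w2 : {ffun J -> W2}) (u : {ffun J -> U}) (wB : {ffun J -> WB}) : R :=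
  Ex (fam (fun j => k5 j (w1 j) (w2 j) (wB j) (u j))) (fun ub => (pass w1 w2 wB u ub)%:R).
Let p4 (w1 : {ffun J -> W1}) (w2 : {ffun J -> W2}) (u : {ffun J -> U}) :=
  Ex (fam (fun j => k4 j (w1 j) (w2 j))) (p5 w1 w2 u).
Let p3 (w1 : {ffun J -> W1}) (w2 : {ffun J -> W2}) := Ex (fam (fun j => k2 j (w1 j))) (p4 w1 w2).

Let C := (c ^+ #|J|)^-1.

Let C_ge0 : 0 <= C.
Proof. by rewrite invr_ge0 exprn_ge0 // ltW. Qed.

Let r5_ge0 j w1 w2 u wB : 0 <= r5 j w1 w2 u wB.
Proof. exact: Ex_ge0. Qed.

Let r4_ge0 j w1 w2 u : 0 <= r4 j w1 w2 u.
Proof. exact: Ex_ge0. Qed.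

Let r3_ge0 j w1 w2 : 0 <= r3 j w1 w2.
Proof. exact: Ex_ge0. Qed.

Let p5_le (w1 : {ffun J -> W1}) (w2 : {ffun J -> W2}) (u : {ffun J -> U})
    (wB : {ffun J -> WB}) : p5 w1 w2 u wB <= C * \prod_j r5 j (w1 j) (w2 j) (u j) (wB j).
Proof.
rewrite /p5 /r5 -Ex_fam_prod -ExZl; apply: le_Ex => ub.
apply: le_trans (indicator_markov _ _); last 2 first.
- exact: exprn_gt0.
- by apply: prodr_ge0 => j _; exact: r_ge0.
by case: (boolP (pass _ _ _ _ _)) => [/pass_r ->|].
Qed.

Let p4_le (w1 : {ffun J -> W1}) (w2 : {ffun J -> W2}) (u : {ffun J -> U}) :
  p4 w1 w2 u <= C * \prod_j r4 j (w1 j) (w2 j) (u j).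
Proof. by rewrite /p4 /r4 -Ex_fam_prod -ExZl; apply: le_Ex => wB; exact: p5_le. Qed.

Let p3_le (w1 : {ffun J -> W1}) (w2 : {ffun J -> W2}) : p3 w1 w2 <= C * \prod_j r3 j (w1 j) (w2 j).
Proof. by rewrite /p3 /r3 -Ex_fam_prod -ExZl; apply: le_Ex => u; exact: p4_le. Qed.

Let C_le (x : J -> R) : (forall j, 0 <= x j) -> (forall j, x j <= 1) -> C * \prod_j x j <= C.
Proof.
by move=> x0 x1; rewrite ler_piMr // prodr_ile1 // => j _; rewrite x0 x1.
Qed.

(** Markov's inequality: a passing tuple has a density product above [c ^+ #|J|], while the mean of
    that product over the fresh codewords factorizes into single-letter means that are at most [1].
    The seven versions differ only in which codewords are fresh. *)
Lemma confusionn1 : (forall j w1 w2 wB, Ex (k2 j w1) (fun u => r5 j w1 w2 u wB) <= 1) ->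
  forall (w1 : {ffun J -> W1}) (w2 : {ffun J -> W2}) (wB : {ffun J -> WB}),
  Ex (fam (fun j => k2 j (w1 j))) (fun u => p5 w1 w2 u wB) <= C.
Proof.
move=> h w1 w2 wB.
apply: le_trans (C_le (x := fun j => Ex (k2 j (w1 j))
  (fun u => r5 j (w1 j) (w2 j) u (wB j))) _ _) => [|j|j] //; last exact: Ex_ge0.
by rewrite -Ex_fam_prod -ExZl; apply: le_Ex => u; exact: p5_le.
Qed.

Lemma confusionn2 : (forall j w1 w2 u, r4 j w1 w2 u <= 1) ->
  forall w1 w2 u, p4 w1 w2 u <= C.
Proof. by move=> h w1 w2 u; apply: le_trans (p4_le _ _ _) (C_le _ _). Qed.

Lemma confusionn3 : (forall j w1 u, Ex (k1' j) (fun w2 => r4 j w1 w2 u) <= 1) ->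
  forall (w1 : {ffun J -> W1}) (u : {ffun J -> U}), Ex (fam k1') (fun w2 => p4 w1 w2 u) <= C.
Proof.
move=> h w1 u.
apply: le_trans (C_le (x := fun j => Ex (k1' j)
  (fun w2 => r4 j (w1 j) w2 (u j))) _ _) => [|j|j] //; last exact: Ex_ge0.
by rewrite -Ex_fam_prod -ExZl; apply: le_Ex => w2; exact: p4_le.
Qed.

Lemma confusionn4 : (forall j w1 w2, r3 j w1 w2 <= 1) -> forall w1 w2, p3 w1 w2 <= C.
Proof. by move=> h w1 w2; apply: le_trans (p3_le _ _) (C_le _ _). Qed.

Lemma confusionn5 : (forall j w1, Ex (k1' j) (r3 j w1) <= 1) ->
  forall w1, Ex (fam k1') (p3 w1) <= C.
Proof.
move=> h w1.
apply: le_trans (C_le (x := fun j => Ex (k1' j) (r3 j (w1 j))) _ _) => [|j|j] //;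
  last exact: Ex_ge0.
by rewrite -Ex_fam_prod -ExZl; apply: le_Ex => w2; exact: p3_le.
Qed.

Lemma confusionn6 : (forall j w2, Ex (k1 j) (fun w1 => r3 j w1 w2) <= 1) ->
  forall w2, Ex (fam k1) (fun w1 => p3 w1 w2) <= C.
Proof.
move=> h w2.
apply: le_trans (C_le (x := fun j => Ex (k1 j) (fun w1 => r3 j w1 (w2 j))) _ _) => [|j|j] //;
  last exact: Ex_ge0.
by rewrite -Ex_fam_prod -ExZl; apply: le_Ex => w1; exact: p3_le.
Qed.

Lemma confusionn7 : (forall j, Ex (k1 j) (fun w1 => Ex (k1' j) (r3 j w1)) <= 1) ->
  Ex (fam k1) (fun w1 => Ex (fam k1') (p3 w1)) <= C.
Proof.
move=> h.
apply: le_trans (C_le (x := fun j => Ex (k1 j) (fun w1 => Ex (k1' j) (r3 j w1))) _ _)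
  => [|j|j] //; last by apply: Ex_ge0 => w1; exact: Ex_ge0.
rewrite -Ex_fam_prod -ExZl; apply: le_Ex => w1.
by rewrite -Ex_fam_prod -ExZl; apply: le_Ex => w2; exact: p3_le.
Qed.

End ConfusionN.

(** * Densities and mutual information *)

Section Marginals.
Variables (R : realType) (T : finType) (mu : fdist R T).
Local Notation prv := (prv mu).

Lemma prv_Ex (A : finType) (X : T -> A) a : prv X a = Ex mu (fun t => (X t == a)%:R).
Proof.
rewrite /prv /Ex big_mkcond; apply: eq_bigr => t _.
by case: ifP; rewrite ?mulr1 ?mulr0.
Qed.

Lemma prv_ge0 (A : finType) (X : T -> A) a : 0 <= prv X a.
Proof. by apply: sumr_ge0 => t _; exact: pmf_ge0. Qed.

Lemma eq_prv (A B : finType) (X : T -> A) (Y : T -> B) a b :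
  (forall t, (X t == a) = (Y t == b)) -> prv X a = prv Y b.
Proof. by move=> XY; apply: eq_bigl => t; rewrite XY. Qed.

Lemma prv_gt0 (A : finType) (X : T -> A) t : 0 < mu t -> 0 < prv X (X t).
Proof.
move=> mut; rewrite /prv (bigD1 t) //= ltr_pwDl //.
by apply: sumr_ge0 => t' _; exact: pmf_ge0.
Qed.

Lemma Ex_prv (A : finType) (X : T -> A) (f : A -> R) :
  Ex mu (fun t => f (X t)) = \sum_a prv X a * f a.
Proof.
rewrite /Ex (partition_big X xpredT) //=; apply: eq_bigr => a _.
by rewrite mulr_suml; apply: eq_bigr => t /eqP->.
Qed.

Lemma prv_sum1 (A : finType) (X : T -> A) : \sum_a prv X a = 1.
Proof.
by rewrite -(Ex_cst mu 1) (Ex_prv X (fun=> 1)); apply: eq_bigr => a _; rewrite mulr1.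
Qed.

Definition law (A : finType) (X : T -> A) : fdist R A :=
  FDist (prv_ge0 X) (prv_sum1 X).

Lemma sum_prv_pair (A B : finType) (X : T -> A) (Y : T -> B) a :
  \sum_b prv [% X, Y] (a, b) = prv X a.
Proof.
by rewrite [RHS](partition_big Y xpredT).
Qed.

Lemma prv_pair0 (A B : finType) (X : T -> A) (Y : T -> B) a b :
  prv X a = 0 -> prv [% X, Y] (a, b) = 0.
Proof.
rewrite -(sum_prv_pair X Y) => /psumr_eq0P; apply=> // b' _.
exact: prv_ge0.
Qed.

Section Conditional.
Variables (A B : finType) (X : T -> A) (Y : T -> B) (a : A).

(* Conditionally on an event of probability [0], the unconditional law is used. *)
Definition cond_pmf (b : B) : R :=
  if prv X a == 0 then prv Y b else prv [% X, Y] (a, b) / prv X a.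

Lemma cond_pmf_ge0 b : 0 <= cond_pmf b.
Proof. by rewrite /cond_pmf; case: ifP => _; rewrite ?divr_ge0 ?prv_ge0. Qed.

Lemma cond_pmf_sum1 : \sum_b cond_pmf b = 1.
Proof.
rewrite /cond_pmf; case: eqVneq => [_|h]; first exact: prv_sum1.
by rewrite -mulr_suml sum_prv_pair divff.
Qed.

Definition cond : fdist R B := FDist cond_pmf_ge0 cond_pmf_sum1.

Lemma condE b : prv [% X, Y] (a, b) = prv X a * cond b.
Proof.
rewrite /= /cond_pmf; case: eqVneq => [h|h]; last by rewrite mulrC divfK.
by rewrite h mul0r prv_pair0.
Qed.

End Conditional.

Lemma cond_mutual_infoE (A B C : finType) (X : T -> A) (Y : T -> B) (Z : T -> C) :
  cond_mutual_info mu X Y Z = Ex mu (fun t => log2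
    (prv [% X, Y, Z] (X t, Y t, Z t) * prv Z (Z t) /
     (prv [% X, Z] (X t, Z t) * prv [% Y, Z] (Y t, Z t)))).
Proof.
rewrite /cond_mutual_info pair_bigA pair_bigA /=.
rewrite -(Ex_prv [% X, Y, Z] (fun x : A * B * C => log2
    (prv [% X, Y, Z] x * prv Z x.2 /
     (prv [% X, Z] (x.1.1, x.2) * prv [% Y, Z] (x.1.2, x.2))))) /=.
by [].
Qed.

End Marginals.

Lemma log2M (R : realType) (x y : R) : 0 < x -> 0 < y -> log2 (x * y) = log2 x + log2 y.
Proof. by move=> x0 y0; rewrite /log2 lnM ?posrE // mulrDl. Qed.

Lemma log2V (R : realType) (x : R) : 0 < x -> log2 x^-1 = - log2 x.
Proof. by move=> x0; rewrite /log2 lnV ?posrE // mulNr. Qed.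

Lemma eq_Ex_supp (R : realType) (T : finType) (p : fdist R T) (f g : T -> R) :
  (forall t, 0 < p t -> f t = g t) -> Ex p f = Ex p g.
Proof.
by move=> fg; apply: le_anti; apply/andP; split; apply: le_Ex_supp => t /fg->.
Qed.

Lemma Ex_fst (R : realType) (A B : finType) (p : fdist R (A * B)%type) (f : A -> R) :
  Ex p (fun x => f x.1) = \sum_a (\sum_b p (a, b)) * f a.
Proof.
rewrite /Ex (eq_bigr (fun x : A * B => p (x.1, x.2) * f x.1)) => [|[a b] //].
rewrite -(pair_bigA _ (fun a b => p (a, b) * f a)) /=.
by apply: eq_bigr => a _; rewrite mulr_suml.
Qed.

(** For two events that fix the same variables in different orders or groupings: a truth table over
    the equalities of coordinates. *)
Ltac eq_events := move=> *; rewrite /pairrv !xpair_eqE; do ! case: (_ == _) => //=.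

(** * Decoding densities *)

Section ReceiverInfo.
Variables (R : realType) (T : finType) (mu : fdist R T).
Variables (Q W1 W2 U X WB UB Y : finType).
Variables (vQ : T -> Q) (vW1 : T -> W1) (vW2 : T -> W2) (vU : T -> U).
Variables (vWB : T -> WB) (vUB : T -> UB) (vY : T -> Y).
Variables (k1 : Q -> fdist R W1) (k1' : Q -> fdist R W2).
Variables (k2 : Q -> W1 -> fdist R (U * X)%type).
Variables (k4 : Q -> W1 -> W2 -> fdist R WB).
Variables (k5 : Q -> W1 -> W2 -> WB -> U -> fdist R UB).
Local Notation prv := (prv mu).

(** The relay input is drawn together with [U], but the densities tested by the receiver involve [U]
    alone. *)
Let ku q w1 u := \sum_x k2 q w1 (u, x).

Hypothesis prv_W1W2 : forall q w1 w2,
  prv [% vQ, vW1, vW2] (q, w1, w2) = prv vQ q * k1 q w1 * k1' q w2.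
Hypothesis prv_U : forall q w1 w2 u,
  prv [% vQ, vW1, vW2, vU] (q, w1, w2, u) = prv [% vQ, vW1, vW2] (q, w1, w2) * ku q w1 u.
Hypothesis prv_WB : forall q w1 w2 wB,
  prv [% vQ, vW1, vW2, vWB] (q, w1, w2, wB) =
  prv [% vQ, vW1, vW2] (q, w1, w2) * k4 q w1 w2 wB.
Hypothesis prv_UB : forall q w1 w2 u wB ub,
  prv [% vQ, vW1, vW2, vU, vWB, vUB] (q, w1, w2, u, wB, ub) =
  prv [% vQ, vW1, vW2, vU, vWB] (q, w1, w2, u, wB) * k5 q w1 w2 wB u ub.

Let full := [% vQ, vW1, vW2, vU, vWB, vUB].

(** The law of a tuple in the codebook before weighting: given [(W1, W2)], [WB] is independent of
    [U], unlike under [mu]. *)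
Definition codeword_law q w1 w2 wB u ub : R :=
  prv vQ q * k1 q w1 * k1' q w2 * ku q w1 u * k4 q w1 w2 wB * k5 q w1 w2 wB u ub.

(* The density tested by the decoder for the confusion event in which the
   codewords outside [SH] are wrong. *)
Definition rho (S : finType) (SH : T -> S) (s : S) q w1 w2 wB u ub y : R :=
  prv [% full, vY] (q, w1, w2, u, wB, ub, y) * prv SH s /
  (codeword_law q w1 w2 wB u ub * prv [% SH, vY] (s, y)).

Let ku_ge0 q w1 u : 0 <= ku q w1 u.
Proof. by apply: sumr_ge0 => x _; exact: pmf_ge0. Qed.

Lemma codeword_law_ge0 q w1 w2 wB u ub : 0 <= codeword_law q w1 w2 wB u ub.
Proof. by rewrite !mulr_ge0 ?pmf_ge0 ?prv_ge0. Qed.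

Lemma rho_ge0 (S : finType) (SH : T -> S) s q w1 w2 wB u ub y :
  0 <= rho SH s q w1 w2 wB u ub y.
Proof. by apply: divr_ge0; apply: mulr_ge0; rewrite ?prv_ge0 ?codeword_law_ge0. Qed.

(** The source of [theta1]: the ratio of the true law of the tuple to [codeword_law] is the
    information density of [U] and [WB] given [(Q, W1, W2)]. Without denominators the identity also
    covers points of probability zero. *)
Lemma codeword_lawE q w1 w2 wB u ub :
  codeword_law q w1 w2 wB u ub * prv [% vQ, vW1, vW2, vU, vWB] (q, w1, w2, u, wB) *
    prv [% vQ, vW1, vW2] (q, w1, w2) =
  prv full (q, w1, w2, u, wB, ub) * prv [% vQ, vW1, vW2, vU] (q, w1, w2, u) *
    prv [% vQ, vW1, vW2, vWB] (q, w1, w2, wB).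
Proof. by rewrite prv_UB prv_U prv_WB prv_W1W2 /codeword_law; ring. Qed.

Lemma codeword_law_gt0 t : 0 < mu t ->
  0 < codeword_law (vQ t) (vW1 t) (vW2 t) (vWB t) (vU t) (vUB t).
Proof.
move=> mut; have := codeword_lawE (vQ t) (vW1 t) (vW2 t) (vWB t) (vU t) (vUB t).
set c := codeword_law _ _ _ _ _ _ => cE; rewrite lt0r codeword_law_ge0 andbT.
apply/eqP => c0; move: cE; rewrite -/c c0 !mul0r => /esym/eqP.
have p1 : 0 < prv full (vQ t, vW1 t, vW2 t, vU t, vWB t, vUB t) := prv_gt0 full mut.
have p2 : 0 < prv [% vQ, vW1, vW2, vU] (vQ t, vW1 t, vW2 t, vU t) := prv_gt0 _ mut.
have p3 : 0 < prv [% vQ, vW1, vW2, vWB] (vQ t, vW1 t, vW2 t, vWB t) := prv_gt0 _ mut.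
by rewrite !mulf_eq0 (gt_eqF p1) (gt_eqF p2) (gt_eqF p3).
Qed.

Lemma rho_gt0 (S : finType) (SH : T -> S) t : 0 < mu t ->
  0 < rho SH (SH t) (vQ t) (vW1 t) (vW2 t) (vWB t) (vU t) (vUB t) (vY t).
Proof.
move=> mut; apply: divr_gt0; apply: mulr_gt0.
- exact: (prv_gt0 [% full, vY] mut).
- exact: prv_gt0.
- exact: codeword_law_gt0.
- exact: (prv_gt0 [% SH, vY] mut).
Qed.

(** On the support [rho] is the product of two information densities, that of [V] and [vY] given [Z]
    and that of [vU] and [vWB] given [ZZ]. The hypotheses compare only the information carried by
    the variables, so that any ordering of tuples is accepted. *)
Lemma Ex_log_rho (S A C C' : finType) (SH : T -> S) (V : T -> A) (Z : T -> C) (ZZ : T -> C') :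
  (forall t t', (Z t' == Z t) = (SH t' == SH t)) ->
  (forall t t', (V t' == V t) && (Z t' == Z t) = (full t' == full t)) ->
  (forall t t', (ZZ t' == ZZ t) = ([% vQ, vW1, vW2] t' == [% vQ, vW1, vW2] t)) ->
  Ex mu (fun t => log2 (rho SH (SH t) (vQ t) (vW1 t) (vW2 t) (vWB t) (vU t) (vUB t) (vY t))) =
  cond_mutual_info mu V vY Z + cond_mutual_info mu vU vWB ZZ.
Proof.
move=> hZ hV hZZ; rewrite !cond_mutual_infoE -ExD; apply: eq_Ex_supp => t mut.
have pos (B : finType) (F : T -> B) := prv_gt0 F mut.
rewrite -log2M ?divr_gt0 ?mulr_gt0 ?(pos _ [% V, vY, Z]) ?(pos _ Z) ?(pos _ [% V, Z])
  ?(pos _ [% vY, Z]) ?(pos _ [% vU, vWB, ZZ]) ?(pos _ ZZ) ?(pos _ [% vU, ZZ])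
  ?(pos _ [% vWB, ZZ]) //.
congr log2.
have -> : prv [% V, vY, Z] (V t, vY t, Z t) = prv [% full, vY] (full t, vY t).
  apply: eq_prv => t'.
  rewrite -[LHS]/((V t' == V t) && (vY t' == vY t) && (Z t' == Z t)).
  by rewrite -[RHS]/((full t' == full t) && (vY t' == vY t)) -hV andbAC.
have -> : prv Z (Z t) = prv SH (SH t) by apply: eq_prv => t'.
have -> : prv [% V, Z] (V t, Z t) = prv full (full t).
  by apply: eq_prv => t'; rewrite -hV.
have -> : prv [% vY, Z] (vY t, Z t) = prv [% SH, vY] (SH t, vY t).
  apply: eq_prv => t'; rewrite -[LHS]/((vY t' == vY t) && (Z t' == Z t)).
  by rewrite hZ andbC.
have -> : prv [% vU, vWB, ZZ] (vU t, vWB t, ZZ t) =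
    prv [% vQ, vW1, vW2, vU, vWB] (vQ t, vW1 t, vW2 t, vU t, vWB t).
  apply: eq_prv => t'.
  rewrite -[LHS]/((vU t' == vU t) && (vWB t' == vWB t) && (ZZ t' == ZZ t)) hZZ.
  by eq_events.
have -> : prv ZZ (ZZ t) = prv [% vQ, vW1, vW2] (vQ t, vW1 t, vW2 t).
  by apply: eq_prv => t'; rewrite hZZ.
have -> : prv [% vU, ZZ] (vU t, ZZ t) = prv [% vQ, vW1, vW2, vU] (vQ t, vW1 t, vW2 t, vU t).
  by apply: eq_prv => t'; rewrite -[LHS]/((vU t' == vU t) && (ZZ t' == ZZ t)) hZZ; eq_events.
have -> : prv [% vWB, ZZ] (vWB t, ZZ t) =
    prv [% vQ, vW1, vW2, vWB] (vQ t, vW1 t, vW2 t, vWB t).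
  by apply: eq_prv => t'; rewrite -[LHS]/((vWB t' == vWB t) && (ZZ t' == ZZ t)) hZZ; eq_events.
have := codeword_lawE (vQ t) (vW1 t) (vW2 t) (vWB t) (vU t) (vUB t).
rewrite /rho -/(full t).
move: (codeword_law_gt0 mut) (pos _ full) (pos _ [% SH, vY]) (pos _ [% vQ, vW1, vW2])
  (pos _ [% vQ, vW1, vW2, vU]) (pos _ [% vQ, vW1, vW2, vWB])
  (pos _ [% vQ, vW1, vW2, vU, vWB]).
rewrite -[([% SH, vY]) t]/(SH t, vY t).
rewrite -[([% vQ, vW1, vW2]) t]/(vQ t, vW1 t, vW2 t).
rewrite -[([% vQ, vW1, vW2, vU]) t]/(vQ t, vW1 t, vW2 t, vU t).
rewrite -[([% vQ, vW1, vW2, vWB]) t]/(vQ t, vW1 t, vW2 t, vWB t).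
rewrite -[([% vQ, vW1, vW2, vU, vWB]) t]/(vQ t, vW1 t, vW2 t, vU t, vWB t).
rewrite -[(vQ t, vW1 t, vW2 t, vU t, vWB t, vUB t)]/(full t).
move: (codeword_law _ _ _ _ _ _) (prv full _) (prv [% SH, vY] _) (prv [% vQ, vW1, vW2] _)
  (prv [% vQ, vW1, vW2, vU] _) (prv [% vQ, vW1, vW2, vWB] _)
  (prv [% vQ, vW1, vW2, vU, vWB] _) (prv [% full, vY] _) (prv SH _).
move=> c f sy z zu zwb zuwb a s c0 f0 sy0 z0 zu0 zwb0 zuwb0 E.
have -> : c = f * zu * zwb / (zuwb * z).
  by rewrite -E; field; rewrite !gt_eqF.
by field; rewrite !gt_eqF.
Qed.

Section Confusion.
Variables (q : Q) (y : Y).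

Let sum_UB w1 w2 u wB :
  \sum_ub prv [% full, vY] (q, w1, w2, u, wB, ub, y) =
  prv [% vQ, vW1, vW2, vU, vWB, vY] (q, w1, w2, u, wB, y).
Proof.
by rewrite -(sum_prv_pair _ _ vUB); apply: eq_bigr => ub _; apply: eq_prv; eq_events.
Qed.

Let sum_WB w1 w2 u :
  \sum_wB \sum_ub prv [% full, vY] (q, w1, w2, u, wB, ub, y) =
  prv [% vQ, vW1, vW2, vU, vY] (q, w1, w2, u, y).
Proof.
under eq_bigr do rewrite sum_UB.
by rewrite -(sum_prv_pair _ _ vWB); apply: eq_bigr => wB _; apply: eq_prv; eq_events.
Qed.

Let sum_U w1 w2 :
  \sum_u \sum_wB \sum_ub prv [% full, vY] (q, w1, w2, u, wB, ub, y) =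
  prv [% vQ, vW1, vW2, vY] (q, w1, w2, y).
Proof.
under eq_bigr do rewrite sum_WB.
by rewrite -(sum_prv_pair _ _ vU); apply: eq_bigr => u _; apply: eq_prv; eq_events.
Qed.

Lemma prv_W1 w1 : prv [% vQ, vW1] (q, w1) = prv vQ q * k1 q w1.
Proof.
rewrite -(sum_prv_pair _ _ vW2); under eq_bigr do rewrite prv_W1W2.
by rewrite -mulr_sumr pmf_sum1 mulr1.
Qed.

Lemma prv_W2 w2 : prv [% vQ, vW2] (q, w2) = prv vQ q * k1' q w2.
Proof.
rewrite -(sum_prv_pair _ _ vW1).
transitivity (\sum_w1 prv [% vQ, vW1, vW2] (q, w1, w2)).
  by apply: eq_bigr => w1 _; apply: eq_prv; eq_events.
under eq_bigr do rewrite prv_W1W2 mulrAC.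
by rewrite -mulr_sumr pmf_sum1 mulr1.
Qed.

(** Here [k] is the codebook law of the fresh codewords given the shared ones. It cancels against
    [rho], leaving the conditional probability of the tuple given [(SH, Y)]; strict inequality can
    occur only where a denominator vanishes. *)
Lemma rho_le (S : finType) (SH : T -> S) s w1 w2 wB u ub k :
  0 <= k -> codeword_law q w1 w2 wB u ub = prv SH s * k ->
  k * rho SH s q w1 w2 wB u ub y <=
  prv [% full, vY] (q, w1, w2, u, wB, ub, y) / prv [% SH, vY] (s, y).
Proof.
rewrite /rho => k0 ->.
have [->|kn0] := eqVneq k 0; first by rewrite mul0r divr_ge0 ?prv_ge0.
have [->|sn0] := eqVneq (prv SH s) 0.
  by rewrite mulr0 mul0r mulr0 divr_ge0 ?prv_ge0.
have [->|sy0] := eqVneq (prv [% SH, vY] (s, y)) 0.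
  by rewrite !(mulr0, invr0).
by apply: le_of_eq; field; rewrite kn0 sn0 sy0.
Qed.

Let div_le1 (x z : R) : x = z -> 0 <= z -> x / z <= 1.
Proof.
move=> -> z0; have [->|zn0] := eqVneq z 0; first by rewrite mul0r.
by rewrite divff.
Qed.

(** By [rho_le] the average over fresh codewords is at most a sum of conditional probabilities given
    the shared codewords and [y]. The seven bounds differ in the shared codewords. *)
Lemma rho_sum1 w1 w2 wB : Ex (k2 q w1) (fun ux => Ex (k5 q w1 w2 wB ux.1) (fun ub =>
  rho [% vQ, vW1, vW2, vWB] (q, w1, w2, wB) q w1 w2 wB ux.1 ub y)) <= 1.
Proof.
rewrite (Ex_fst _ (fun u => Ex (k5 q w1 w2 wB u) (fun ub =>
  rho [% vQ, vW1, vW2, vWB] (q, w1, w2, wB) q w1 w2 wB u ub y))).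
apply: (@le_trans _ _ (\sum_u \sum_ub prv [% full, vY] (q, w1, w2, u, wB, ub, y) /
    prv [% vQ, vW1, vW2, vWB, vY] (q, w1, w2, wB, y))); last first.
  under eq_bigr do rewrite -mulr_suml sum_UB.
  rewrite -mulr_suml; apply: div_le1; last exact: prv_ge0.
  by rewrite -(sum_prv_pair _ _ vU); apply: eq_bigr => u _; apply: eq_prv; eq_events.
apply: ler_sum => u _; rewrite /Ex mulr_sumr; apply: ler_sum => ub _; rewrite mulrA.
apply: rho_le; first by rewrite mulr_ge0 ?ku_ge0 ?pmf_ge0.
by rewrite prv_WB prv_W1W2 /codeword_law /ku; ring.
Qed.

Lemma rho_sum2 w1 w2 u : Ex (k4 q w1 w2) (fun wB => Ex (k5 q w1 w2 wB u) (fun ub =>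
  rho [% vQ, vW1, vW2, vU] (q, w1, w2, u) q w1 w2 wB u ub y)) <= 1.
Proof.
apply: (@le_trans _ _ (\sum_wB \sum_ub prv [% full, vY] (q, w1, w2, u, wB, ub, y) /
    prv [% vQ, vW1, vW2, vU, vY] (q, w1, w2, u, y))); last first.
  under eq_bigr do rewrite -mulr_suml.
  by rewrite -mulr_suml sum_WB; apply: div_le1; last exact: prv_ge0.
apply: ler_sum => wB _; rewrite mulr_sumr; apply: ler_sum => ub _; rewrite mulrA.
apply: rho_le; first by rewrite mulr_ge0 ?pmf_ge0.
by rewrite prv_U prv_W1W2 /codeword_law /ku; ring.
Qed.

Lemma rho_sum3 w1 u : Ex (k1' q) (fun w2 => Ex (k4 q w1 w2) (fun wB =>
  Ex (k5 q w1 w2 wB u) (fun ub =>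
  rho [% vQ, vW1, vU] (q, w1, u) q w1 w2 wB u ub y))) <= 1.
Proof.
apply: (@le_trans _ _ (\sum_w2 \sum_wB \sum_ub prv [% full, vY] (q, w1, w2, u, wB, ub, y) /
    prv [% vQ, vW1, vU, vY] (q, w1, u, y))); last first.
  under eq_bigr do under eq_bigr do rewrite -mulr_suml.
  under eq_bigr do rewrite -mulr_suml sum_WB.
  rewrite -mulr_suml; apply: div_le1; last exact: prv_ge0.
  by rewrite -(sum_prv_pair _ _ vW2); apply: eq_bigr => w2 _; apply: eq_prv; eq_events.
apply: ler_sum => w2 _; rewrite mulr_sumr; apply: ler_sum => wB _; rewrite mulrA.
rewrite mulr_sumr; apply: ler_sum => ub _; rewrite mulrA.
apply: rho_le; first by rewrite !mulr_ge0 ?pmf_ge0.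
(* [U] is independent of [W2] given [(Q, W1)], so summing out [W2] leaves the kernel of [U]. *)
have -> : prv [% vQ, vW1, vU] (q, w1, u) = prv vQ q * k1 q w1 * ku q w1 u.
  rewrite -(sum_prv_pair _ _ vW2).
  transitivity (\sum_w2 prv vQ q * k1 q w1 * ku q w1 u * k1' q w2).
    apply: eq_bigr => w2' _; transitivity (prv [% vQ, vW1, vW2, vU] (q, w1, w2', u)).
      by apply: eq_prv; eq_events.
    by rewrite prv_U prv_W1W2 mulrAC.
  by rewrite -mulr_sumr pmf_sum1 mulr1.
by rewrite /codeword_law /ku; ring.
Qed.

Lemma rho_sum4 w1 w2 : Ex (k2 q w1) (fun ux => Ex (k4 q w1 w2) (fun wB =>
  Ex (k5 q w1 w2 wB ux.1) (fun ub =>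
  rho [% vQ, vW1, vW2] (q, w1, w2) q w1 w2 wB ux.1 ub y))) <= 1.
Proof.
rewrite (Ex_fst _ (fun u => Ex (k4 q w1 w2) (fun wB => Ex (k5 q w1 w2 wB u) (fun ub =>
  rho [% vQ, vW1, vW2] (q, w1, w2) q w1 w2 wB u ub y)))).
apply: (@le_trans _ _ (\sum_u \sum_wB \sum_ub prv [% full, vY] (q, w1, w2, u, wB, ub, y) /
    prv [% vQ, vW1, vW2, vY] (q, w1, w2, y))); last first.
  under eq_bigr do under eq_bigr do rewrite -mulr_suml.
  under eq_bigr do rewrite -mulr_suml.
  by rewrite -mulr_suml sum_U; apply: div_le1; last exact: prv_ge0.
apply: ler_sum => u _; rewrite mulr_sumr; apply: ler_sum => wB _; rewrite mulrA.
rewrite mulr_sumr; apply: ler_sum => ub _; rewrite mulrA.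
apply: rho_le; first by rewrite !mulr_ge0 ?ku_ge0 ?pmf_ge0.
by rewrite prv_W1W2 /codeword_law /ku; ring.
Qed.

Lemma rho_sum5 w1 : Ex (k1' q) (fun w2 => Ex (k2 q w1) (fun ux => Ex (k4 q w1 w2) (fun wB =>
  Ex (k5 q w1 w2 wB ux.1) (fun ub =>
  rho [% vQ, vW1] (q, w1) q w1 w2 wB ux.1 ub y)))) <= 1.
Proof.
apply: (@le_trans _ _ (\sum_w2 \sum_u \sum_wB \sum_ub
    prv [% full, vY] (q, w1, w2, u, wB, ub, y) / prv [% vQ, vW1, vY] (q, w1, y)));
    last first.
  under eq_bigr do under eq_bigr do under eq_bigr do rewrite -mulr_suml.
  under eq_bigr do under eq_bigr do rewrite -mulr_suml.
  under eq_bigr do rewrite -mulr_suml sum_U.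
  rewrite -mulr_suml; apply: div_le1; last exact: prv_ge0.
  by rewrite -(sum_prv_pair _ _ vW2); apply: eq_bigr => w2 _; apply: eq_prv; eq_events.
apply: ler_sum => w2 _.
rewrite (Ex_fst _ (fun u => Ex (k4 q w1 w2) (fun wB => Ex (k5 q w1 w2 wB u) (fun ub =>
  rho [% vQ, vW1] (q, w1) q w1 w2 wB u ub y)))).
rewrite mulr_sumr; apply: ler_sum => u _; rewrite mulrA.
rewrite mulr_sumr; apply: ler_sum => wB _; rewrite mulrA.
rewrite mulr_sumr; apply: ler_sum => ub _; rewrite mulrA.
apply: rho_le; first by rewrite !mulr_ge0 ?ku_ge0 ?pmf_ge0.
by rewrite prv_W1 /codeword_law /ku; ring.
Qed.

Lemma rho_sum6 w2 : Ex (k1 q) (fun w1 => Ex (k2 q w1) (fun ux => Ex (k4 q w1 w2) (fun wB =>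
  Ex (k5 q w1 w2 wB ux.1) (fun ub =>
  rho [% vQ, vW2] (q, w2) q w1 w2 wB ux.1 ub y)))) <= 1.
Proof.
apply: (@le_trans _ _ (\sum_w1 \sum_u \sum_wB \sum_ub
    prv [% full, vY] (q, w1, w2, u, wB, ub, y) / prv [% vQ, vW2, vY] (q, w2, y)));
    last first.
  under eq_bigr do under eq_bigr do under eq_bigr do rewrite -mulr_suml.
  under eq_bigr do under eq_bigr do rewrite -mulr_suml.
  under eq_bigr do rewrite -mulr_suml sum_U.
  rewrite -mulr_suml; apply: div_le1; last exact: prv_ge0.
  by rewrite -(sum_prv_pair _ _ vW1); apply: eq_bigr => w1 _; apply: eq_prv; eq_events.
apply: ler_sum => w1 _.
rewrite (Ex_fst _ (fun u => Ex (k4 q w1 w2) (fun wB => Ex (k5 q w1 w2 wB u) (fun ub =>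
  rho [% vQ, vW2] (q, w2) q w1 w2 wB u ub y)))).
rewrite mulr_sumr; apply: ler_sum => u _; rewrite mulrA.
rewrite mulr_sumr; apply: ler_sum => wB _; rewrite mulrA.
rewrite mulr_sumr; apply: ler_sum => ub _; rewrite mulrA.
apply: rho_le; first by rewrite !mulr_ge0 ?ku_ge0 ?pmf_ge0.
by rewrite prv_W2 /codeword_law /ku; ring.
Qed.

Lemma rho_sum7 : Ex (k1 q) (fun w1 => Ex (k1' q) (fun w2 => Ex (k2 q w1) (fun ux =>
  Ex (k4 q w1 w2) (fun wB => Ex (k5 q w1 w2 wB ux.1) (fun ub =>
  rho vQ q q w1 w2 wB ux.1 ub y))))) <= 1.
Proof.
apply: (@le_trans _ _ (\sum_w1 \sum_w2 \sum_u \sum_wB \sum_ub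
    prv [% full, vY] (q, w1, w2, u, wB, ub, y) / prv [% vQ, vY] (q, y)));
    last first.
  under eq_bigr do under eq_bigr do under eq_bigr do under eq_bigr do rewrite -mulr_suml.
  under eq_bigr do under eq_bigr do under eq_bigr do rewrite -mulr_suml.
  under eq_bigr do under eq_bigr do rewrite -mulr_suml sum_U.
  under eq_bigr do rewrite -mulr_suml.
  rewrite -mulr_suml; apply: div_le1; last exact: prv_ge0.
  rewrite -(sum_prv_pair _ _ vW1); apply: eq_bigr => w1 _.
  by rewrite -(sum_prv_pair _ _ vW2); apply: eq_bigr => w2 _; apply: eq_prv; eq_events.
apply: ler_sum => w1 _; rewrite mulr_sumr; apply: ler_sum => w2 _; rewrite mulrA.
rewrite (Ex_fst _ (fun u => Ex (k4 q w1 w2) (fun wB => Ex (k5 q w1 w2 wB u) (fun ub =>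
  rho vQ q q w1 w2 wB u ub y)))).
rewrite mulr_sumr; apply: ler_sum => u _; rewrite mulrA.
rewrite mulr_sumr; apply: ler_sum => wB _; rewrite mulrA.
rewrite mulr_sumr; apply: ler_sum => ub _; rewrite mulrA.
apply: rho_le; first by rewrite !mulr_ge0 ?ku_ge0 ?pmf_ge0.
by rewrite /codeword_law /ku; ring.
Qed.

End Confusion.

(* The [k]-th confusion event is the one bounded by [rho_sum(k+1)]. *)
Definition rhos (k : nat) q w1 w2 wB u ub y : R :=
  match k with
  | 0 => rho [% vQ, vW1, vW2, vWB] (q, w1, w2, wB) q w1 w2 wB u ub y
  | 1 => rho [% vQ, vW1, vW2, vU] (q, w1, w2, u) q w1 w2 wB u ub y
  | 2 => rho [% vQ, vW1, vU] (q, w1, u) q w1 w2 wB u ub y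
  | 3 => rho [% vQ, vW1, vW2] (q, w1, w2) q w1 w2 wB u ub y
  | 4 => rho [% vQ, vW1] (q, w1) q w1 w2 wB u ub y
  | 5 => rho [% vQ, vW2] (q, w2) q w1 w2 wB u ub y
  | _ => rho vQ q q w1 w2 wB u ub y
  end.

Lemma rhos_ge0 k q w1 w2 wB u ub y : 0 <= rhos k q w1 w2 wB u ub y.
Proof. by do 6 (case: k => [|k] /=; first exact: rho_ge0); exact: rho_ge0. Qed.

Lemma rhos_gt0 k t : 0 < mu t ->
  0 < rhos k (vQ t) (vW1 t) (vW2 t) (vWB t) (vU t) (vUB t) (vY t).
Proof.
move=> mut; do 6 (case: k => [|k] /=; [exact: (rho_gt0 _ mut)|]).
exact: (rho_gt0 _ mut).
Qed.

End ReceiverInfo.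

(** * Binning densities *)

Section BinningInfo.
Variables (R : realType) (T : finType) (mu : fdist R T).
Variables (Q W1 W2 U V WB UB VB : finType).
Variables (vQ : T -> Q) (vW1 : T -> W1) (vW2 : T -> W2) (vU : T -> U) (vV : T -> V).
Variables (vWB : T -> WB) (vUB : T -> UB) (vVB : T -> VB).
Variables (k4 : Q -> W1 -> W2 -> fdist R WB).
Variables (k5 : Q -> W1 -> W2 -> WB -> U -> fdist R UB).
Variables (k6 : Q -> W1 -> W2 -> WB -> V -> fdist R VB).
Variable pB : Q -> W1 -> W2 -> U -> V -> WB -> UB -> VB -> R.
Local Notation prv := (prv mu).

Hypothesis pB_ge0 : forall q w1 w2 u v wB ub vb, 0 <= pB q w1 w2 u v wB ub vb.
Hypothesis prv_WB : forall q w1 w2 wB,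
  prv [% vQ, vW1, vW2, vWB] (q, w1, w2, wB) =
  prv [% vQ, vW1, vW2] (q, w1, w2) * k4 q w1 w2 wB.
Hypothesis prv_UB : forall q w1 w2 u wB ub,
  prv [% vQ, vW1, vW2, vU, vWB, vUB] (q, w1, w2, u, wB, ub) =
  prv [% vQ, vW1, vW2, vU, vWB] (q, w1, w2, u, wB) * k5 q w1 w2 wB u ub.
Hypothesis prv_VB : forall q w1 w2 v wB vb,
  prv [% vQ, vW1, vW2, vV, vWB, vVB] (q, w1, w2, v, wB, vb) =
  prv [% vQ, vW1, vW2, vV, vWB] (q, w1, w2, v, wB) * k6 q w1 w2 wB v vb.
Hypothesis prv_B : forall q w1 w2 u v wB ub vb,
  prv [% vQ, vW1, vW2, vU, vV, vWB, vUB, vVB] (q, w1, w2, u, v, wB, ub, vb) =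
  prv [% vQ, vW1, vW2, vU, vV] (q, w1, w2, u, v) * pB q w1 w2 u v wB ub vb.

Definition marg0 q w1 w2 u v wB := \sum_ub \sum_vb pB q w1 w2 u v wB ub vb.
Definition marg1 q w1 w2 u v wB ub := \sum_vb pB q w1 w2 u v wB ub vb.
Definition marg2 q w1 w2 u v wB vb := \sum_ub pB q w1 w2 u v wB ub vb.

Lemma prv_marg1 q w1 w2 u v wB ub :
  prv [% vQ, vW1, vW2, vU, vV, vWB, vUB] (q, w1, w2, u, v, wB, ub) =
  prv [% vQ, vW1, vW2, vU, vV] (q, w1, w2, u, v) * marg1 q w1 w2 u v wB ub.
Proof.
by rewrite -(sum_prv_pair _ _ vVB) mulr_sumr; apply: eq_bigr => vb _; exact: prv_B.
Qed.

Lemma prv_marg2 q w1 w2 u v wB vb :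
  prv [% vQ, vW1, vW2, vU, vV, vWB, vVB] (q, w1, w2, u, v, wB, vb) =
  prv [% vQ, vW1, vW2, vU, vV] (q, w1, w2, u, v) * marg2 q w1 w2 u v wB vb.
Proof.
rewrite -(sum_prv_pair _ _ vUB) mulr_sumr; apply: eq_bigr => ub _.
by rewrite -prv_B; apply: eq_prv; eq_events.
Qed.

Lemma prv_marg0 q w1 w2 u v wB :
  prv [% vQ, vW1, vW2, vU, vV, vWB] (q, w1, w2, u, v, wB) =
  prv [% vQ, vW1, vW2, vU, vV] (q, w1, w2, u, v) * marg0 q w1 w2 u v wB.
Proof.
by rewrite -(sum_prv_pair _ _ vUB) mulr_sumr; apply: eq_bigr => ub _; exact: prv_marg1.
Qed.

(** Reciprocals of the likelihood ratios, because the exponential bound controls products that are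
    too small, while covering asks that likelihood ratios are not too large. *)
Definition beta0 q w1 w2 u v wB : R := k4 q w1 w2 wB / marg0 q w1 w2 u v wB.
Definition beta1 q w1 w2 u v wB ub : R :=
  k4 q w1 w2 wB * k5 q w1 w2 wB u ub / marg1 q w1 w2 u v wB ub.
Definition beta2 q w1 w2 u v wB vb : R :=
  k4 q w1 w2 wB * k6 q w1 w2 wB v vb / marg2 q w1 w2 u v wB vb.
Definition beta3 q w1 w2 u v wB ub vb : R :=
  k4 q w1 w2 wB * k5 q w1 w2 wB u ub * k6 q w1 w2 wB v vb / pB q w1 w2 u v wB ub vb.

Section Support.
Variable t : T.
Hypothesis mut : 0 < mu t.

Let pos_factor (x y z : R) : z = x * y -> 0 < z -> 0 <= y -> 0 < x /\ 0 < y.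
Proof.
move=> -> xy y0; have yn : 0 < y.
  by rewrite lt0r y0 andbT; apply: contraTneq xy => ->; rewrite mulr0 ltxx.
by rewrite -(pmulr_lgt0 _ yn).
Qed.

Let pG : 0 < prv [% vQ, vW1, vW2, vU, vV] (vQ t, vW1 t, vW2 t, vU t, vV t).
Proof. exact: prv_gt0 _ mut. Qed.

Lemma k4_gt0 : 0 < k4 (vQ t) (vW1 t) (vW2 t) (vWB t).
Proof. by apply: (pos_factor (prv_WB _ _ _ _) (prv_gt0 _ mut) _).2; exact: pmf_ge0. Qed.

Lemma k5_gt0 : 0 < k5 (vQ t) (vW1 t) (vW2 t) (vWB t) (vU t) (vUB t).
Proof. by apply: (pos_factor (prv_UB _ _ _ _ _ _) (prv_gt0 _ mut) _).2; exact: pmf_ge0. Qed.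

Lemma k6_gt0 : 0 < k6 (vQ t) (vW1 t) (vW2 t) (vWB t) (vV t) (vVB t).
Proof. by apply: (pos_factor (prv_VB _ _ _ _ _ _) (prv_gt0 _ mut) _).2; exact: pmf_ge0. Qed.

Lemma marg0_gt0 : 0 < marg0 (vQ t) (vW1 t) (vW2 t) (vU t) (vV t) (vWB t).
Proof.
apply: (pos_factor (prv_marg0 _ _ _ _ _ _) (prv_gt0 _ mut) _).2.
by do 2 (apply: sumr_ge0 => ? _).
Qed.

Lemma marg1_gt0 : 0 < marg1 (vQ t) (vW1 t) (vW2 t) (vU t) (vV t) (vWB t) (vUB t).
Proof.
apply: (pos_factor (prv_marg1 _ _ _ _ _ _ _) (prv_gt0 _ mut) _).2.
by apply: sumr_ge0 => ? _.
Qed.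

Lemma marg2_gt0 : 0 < marg2 (vQ t) (vW1 t) (vW2 t) (vU t) (vV t) (vWB t) (vVB t).
Proof.
apply: (pos_factor (prv_marg2 _ _ _ _ _ _ _) (prv_gt0 _ mut) _).2.
by apply: sumr_ge0 => ? _.
Qed.

Lemma pB_gt0 : 0 < pB (vQ t) (vW1 t) (vW2 t) (vU t) (vV t) (vWB t) (vUB t) (vVB t).
Proof. by apply: (pos_factor (prv_B _ _ _ _ _ _ _ _) (prv_gt0 _ mut) _).2. Qed.

End Support.

Let m0 t := marg0 (vQ t) (vW1 t) (vW2 t) (vU t) (vV t) (vWB t).
Let m1 t := marg1 (vQ t) (vW1 t) (vW2 t) (vU t) (vV t) (vWB t) (vUB t).
Let m2 t := marg2 (vQ t) (vW1 t) (vW2 t) (vU t) (vV t) (vWB t) (vVB t).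
Let b t := pB (vQ t) (vW1 t) (vW2 t) (vU t) (vV t) (vWB t) (vUB t) (vVB t).
Let c4 t := k4 (vQ t) (vW1 t) (vW2 t) (vWB t).
Let c5 t := k5 (vQ t) (vW1 t) (vW2 t) (vWB t) (vU t) (vUB t).
Let c6 t := k6 (vQ t) (vW1 t) (vW2 t) (vWB t) (vV t) (vVB t).

(** The four informations become expected logarithms of [m0 / c4], [m1 / (m0 * c5)],
    [m2 / (m0 * c6)] and [b * m0 / (m1 * m2)], whose products telescope to the reciprocals of
    [beta0] to [beta3]. *)
Lemma cmi_UV_WB : cond_mutual_info mu [% vU, vV] vWB [% vW1, vW2, vQ] =
  Ex mu (fun t => log2 (m0 t / c4 t)).
Proof.
rewrite cond_mutual_infoE; apply: eq_Ex_supp => t mut; congr log2.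
have -> : prv [% [% vU, vV], vWB, [% vW1, vW2, vQ]]
    ((([% vU, vV]) t), vWB t, (([% vW1, vW2, vQ]) t)) =
    prv [% vQ, vW1, vW2, vU, vV, vWB] (vQ t, vW1 t, vW2 t, vU t, vV t, vWB t).
  by apply: eq_prv; eq_events.
have -> : prv [% [% vU, vV], [% vW1, vW2, vQ]]
    ((([% vU, vV]) t), (([% vW1, vW2, vQ]) t)) =
    prv [% vQ, vW1, vW2, vU, vV] (vQ t, vW1 t, vW2 t, vU t, vV t).
  by apply: eq_prv; eq_events.
have -> : prv [% vWB, [% vW1, vW2, vQ]] (vWB t, (([% vW1, vW2, vQ]) t)) =
    prv [% vQ, vW1, vW2, vWB] (vQ t, vW1 t, vW2 t, vWB t).
  by apply: eq_prv; eq_events.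
have -> : prv [% vW1, vW2, vQ] (([% vW1, vW2, vQ]) t) =
    prv [% vQ, vW1, vW2] (vQ t, vW1 t, vW2 t).
  by apply: eq_prv; eq_events.
have pG : 0 < prv [% vQ, vW1, vW2, vU, vV] (vQ t, vW1 t, vW2 t, vU t, vV t) := prv_gt0 _ mut.
have pZ : 0 < prv [% vQ, vW1, vW2] (vQ t, vW1 t, vW2 t) := prv_gt0 _ mut.
have := k4_gt0 mut.
rewrite prv_marg0 prv_WB -/(m0 t) -/(c4 t) => p4; field.
by rewrite !gt_eqF.
Qed.

Lemma cmi_V_UB : cond_mutual_info mu vV vUB [% vU, vW1, vW2, vWB, vQ] =
  Ex mu (fun t => log2 (m1 t / (m0 t * c5 t))).
Proof.
rewrite cond_mutual_infoE; apply: eq_Ex_supp => t mut; congr log2.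
set z := [% vU, vW1, vW2, vWB, vQ].
have -> : prv [% vV, vUB, z] (vV t, vUB t, z t) =
    prv [% vQ, vW1, vW2, vU, vV, vWB, vUB] (vQ t, vW1 t, vW2 t, vU t, vV t, vWB t, vUB t).
  by rewrite /z; apply: eq_prv; eq_events.
have -> : prv [% vV, z] (vV t, z t) =
    prv [% vQ, vW1, vW2, vU, vV, vWB] (vQ t, vW1 t, vW2 t, vU t, vV t, vWB t).
  by rewrite /z; apply: eq_prv; eq_events.
have -> : prv [% vUB, z] (vUB t, z t) =
    prv [% vQ, vW1, vW2, vU, vWB, vUB] (vQ t, vW1 t, vW2 t, vU t, vWB t, vUB t).
  by rewrite /z; apply: eq_prv; eq_events.
have -> : prv z (z t) = prv [% vQ, vW1, vW2, vU, vWB] (vQ t, vW1 t, vW2 t, vU t, vWB t).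
  by rewrite /z; apply: eq_prv; eq_events.
have pG : 0 < prv [% vQ, vW1, vW2, vU, vV] (vQ t, vW1 t, vW2 t, vU t, vV t) := prv_gt0 _ mut.
have pZ : 0 < prv [% vQ, vW1, vW2, vU, vWB] (vQ t, vW1 t, vW2 t, vU t, vWB t) := prv_gt0 _ mut.
have := k5_gt0 mut; have := marg0_gt0 mut.
rewrite prv_marg0 prv_marg1 prv_UB -/(m0 t) -/(m1 t) -/(c5 t) => p0 p5; field.
by rewrite !gt_eqF.
Qed.

Lemma cmi_U_VB : cond_mutual_info mu vU vVB [% vV, vW1, vW2, vWB, vQ] =
  Ex mu (fun t => log2 (m2 t / (m0 t * c6 t))).
Proof.
rewrite cond_mutual_infoE; apply: eq_Ex_supp => t mut; congr log2.
set z := [% vV, vW1, vW2, vWB, vQ].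
have -> : prv [% vU, vVB, z] (vU t, vVB t, z t) =
    prv [% vQ, vW1, vW2, vU, vV, vWB, vVB] (vQ t, vW1 t, vW2 t, vU t, vV t, vWB t, vVB t).
  by rewrite /z; apply: eq_prv; eq_events.
have -> : prv [% vU, z] (vU t, z t) =
    prv [% vQ, vW1, vW2, vU, vV, vWB] (vQ t, vW1 t, vW2 t, vU t, vV t, vWB t).
  by rewrite /z; apply: eq_prv; eq_events.
have -> : prv [% vVB, z] (vVB t, z t) =
    prv [% vQ, vW1, vW2, vV, vWB, vVB] (vQ t, vW1 t, vW2 t, vV t, vWB t, vVB t).
  by rewrite /z; apply: eq_prv; eq_events.
have -> : prv z (z t) = prv [% vQ, vW1, vW2, vV, vWB] (vQ t, vW1 t, vW2 t, vV t, vWB t).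
  by rewrite /z; apply: eq_prv; eq_events.
have pG : 0 < prv [% vQ, vW1, vW2, vU, vV] (vQ t, vW1 t, vW2 t, vU t, vV t) := prv_gt0 _ mut.
have pZ : 0 < prv [% vQ, vW1, vW2, vV, vWB] (vQ t, vW1 t, vW2 t, vV t, vWB t) := prv_gt0 _ mut.
have := k6_gt0 mut; have := marg0_gt0 mut.
rewrite prv_marg0 prv_marg2 prv_VB -/(m0 t) -/(m2 t) -/(c6 t) => p0 p5; field.
by rewrite !gt_eqF.
Qed.

Lemma cmi_UB_VB : cond_mutual_info mu vUB vVB [% vU, vV, vW1, vW2, vWB, vQ] =
  Ex mu (fun t => log2 (b t * m0 t / (m1 t * m2 t))).
Proof.
rewrite cond_mutual_infoE; apply: eq_Ex_supp => t mut; congr log2.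
set z := [% vU, vV, vW1, vW2, vWB, vQ].
have -> : prv [% vUB, vVB, z] (vUB t, vVB t, z t) =
    prv [% vQ, vW1, vW2, vU, vV, vWB, vUB, vVB]
      (vQ t, vW1 t, vW2 t, vU t, vV t, vWB t, vUB t, vVB t).
  by rewrite /z; apply: eq_prv; eq_events.
have -> : prv [% vUB, z] (vUB t, z t) =
    prv [% vQ, vW1, vW2, vU, vV, vWB, vUB] (vQ t, vW1 t, vW2 t, vU t, vV t, vWB t, vUB t).
  by rewrite /z; apply: eq_prv; eq_events.
have -> : prv [% vVB, z] (vVB t, z t) =
    prv [% vQ, vW1, vW2, vU, vV, vWB, vVB] (vQ t, vW1 t, vW2 t, vU t, vV t, vWB t, vVB t).
  by rewrite /z; apply: eq_prv; eq_events.
have -> : prv z (z t) =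
    prv [% vQ, vW1, vW2, vU, vV, vWB] (vQ t, vW1 t, vW2 t, vU t, vV t, vWB t).
  by rewrite /z; apply: eq_prv; eq_events.
have pG : 0 < prv [% vQ, vW1, vW2, vU, vV] (vQ t, vW1 t, vW2 t, vU t, vV t) := prv_gt0 _ mut.
have := marg0_gt0 mut; have := marg1_gt0 mut; have := marg2_gt0 mut.
rewrite prv_B prv_marg0 prv_marg1 prv_marg2 -/(m0 t) -/(m1 t) -/(m2 t) -/(b t) => p2 p1 p0.
by field; rewrite !gt_eqF.
Qed.

Let eta0 := cond_mutual_info mu [% vU, vV] vWB [% vW1, vW2, vQ].
Let eta1 := cond_mutual_info mu vV vUB [% vU, vW1, vW2, vWB, vQ].
Let eta2 := cond_mutual_info mu vU vVB [% vV, vW1, vW2, vWB, vQ].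
Let eta3 := cond_mutual_info mu vUB vVB [% vU, vV, vW1, vW2, vWB, vQ].

Let log2_inj (x y : R) : 0 < x -> x * y = 1 -> log2 y = - log2 x.
Proof.
move=> x0 xy; rewrite -log2V //; congr log2.
by rewrite -[LHS](mulKf (lt0r_neq0 x0)) xy mulr1.
Qed.

Lemma Ex_log_beta0 : Ex mu (fun t => log2 (beta0 (vQ t) (vW1 t) (vW2 t) (vU t) (vV t) (vWB t)))
  = - eta0.
Proof.
rewrite /eta0 cmi_UV_WB -mulN1r -ExZl; apply: eq_Ex_supp => t mut; rewrite mulN1r.
have [p0 p4] := (marg0_gt0 mut, k4_gt0 mut).
apply: log2_inj; first by rewrite divr_gt0.
by rewrite /beta0 -/(m0 t) -/(c4 t); field; rewrite !gt_eqF.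
Qed.

Lemma Ex_log_beta1 :
  Ex mu (fun t => log2 (beta1 (vQ t) (vW1 t) (vW2 t) (vU t) (vV t) (vWB t) (vUB t)))
  = - (eta0 + eta1).
Proof.
rewrite /eta0 /eta1 cmi_UV_WB cmi_V_UB -ExD -mulN1r -ExZl.
apply: eq_Ex_supp => t mut; rewrite mulN1r.
have [p0 p4] := (marg0_gt0 mut, k4_gt0 mut).
have [p1 p5] := (marg1_gt0 mut, k5_gt0 mut).
rewrite -log2M ?divr_gt0 ?mulr_gt0 //.
apply: log2_inj; first by rewrite !(divr_gt0, mulr_gt0).
rewrite /beta1 -/(m1 t) -/(c4 t) -/(c5 t); field.
by rewrite /m0 /m1 /c4 /c5 !gt_eqF.
Qed.

Lemma Ex_log_beta2 :
  Ex mu (fun t => log2 (beta2 (vQ t) (vW1 t) (vW2 t) (vU t) (vV t) (vWB t) (vVB t)))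
  = - (eta0 + eta2).
Proof.
rewrite /eta0 /eta2 cmi_UV_WB cmi_U_VB -ExD -mulN1r -ExZl.
apply: eq_Ex_supp => t mut; rewrite mulN1r.
have [p0 p4] := (marg0_gt0 mut, k4_gt0 mut).
have [p1 p5] := (marg2_gt0 mut, k6_gt0 mut).
rewrite -log2M ?divr_gt0 ?mulr_gt0 //.
apply: log2_inj; first by rewrite !(divr_gt0, mulr_gt0).
rewrite /beta2 -/(m2 t) -/(c4 t) -/(c6 t); field.
by rewrite /m0 /m2 /c4 /c6 !gt_eqF.
Qed.

Lemma Ex_log_beta3 :
  Ex mu (fun t => log2 (beta3 (vQ t) (vW1 t) (vW2 t) (vU t) (vV t) (vWB t) (vUB t) (vVB t)))
  = - (eta0 + eta1 + eta2 + eta3).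
Proof.
rewrite /eta0 /eta1 /eta2 /eta3 cmi_UV_WB cmi_V_UB cmi_U_VB cmi_UB_VB.
rewrite -!ExD -mulN1r -ExZl; apply: eq_Ex_supp => t mut; rewrite mulN1r.
have [p0 p4] := (marg0_gt0 mut, k4_gt0 mut).
have [p1 p5] := (marg1_gt0 mut, k5_gt0 mut).
have [p2 p6] := (marg2_gt0 mut, k6_gt0 mut).
have p7 := pB_gt0 mut.
have logM4 (a c d e : R) : 0 < a -> 0 < c -> 0 < d -> 0 < e ->
    log2 a + log2 c + log2 d + log2 e = log2 (a * c * d * e).
  by move=> *; rewrite !log2M ?mulr_gt0.
rewrite logM4 ?(divr_gt0, mulr_gt0) //.
apply: log2_inj; first by rewrite !(divr_gt0, mulr_gt0).
rewrite /beta3 -/(b t) -/(c4 t) -/(c5 t) -/(c6 t); field.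
by rewrite /b /m0 /m1 /m2 /c4 /c5 /c6 !gt_eqF.
Qed.

End BinningInfo.

Lemma Ex_const (R : realType) (T : finType) (p : fdist R T) (f : T -> R) a :
  (forall t, f t = a) -> Ex p f = a.
Proof. by move=> fa; rewrite -[RHS](Ex_cst p); exact: eq_Ex. Qed.

(** * Joint laws of the BCCR *)

Section JointLaw.
Variable R : realType.

Section PairLaw.
Variables (A B : finType) (p : fdist R A) (k : A -> fdist R B).

Definition fdpair_pmf (x : A * B) : R := p x.1 * k x.1 x.2.

Lemma fdpair_ge0 x : 0 <= fdpair_pmf x.
Proof. by rewrite mulr_ge0 ?pmf_ge0. Qed.

Lemma Ex_fdpair_pmf (f : A * B -> R) :
  \sum_x fdpair_pmf x * f x = Ex p (fun a => Ex (k a) (fun b => f (a, b))).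
Proof. by rewrite Ex_pair; apply: eq_bigr => -[a b]. Qed.

Lemma fdpair_sum1 : \sum_x fdpair_pmf x = 1.
Proof.
have := Ex_fdpair_pmf (fun=> 1); under eq_bigr do rewrite mulr1.
by move=> ->; under eq_Ex do rewrite Ex_cst; rewrite Ex_cst.
Qed.

Definition fdpair : fdist R (A * B)%type := FDist fdpair_ge0 fdpair_sum1.

Lemma Ex_fdpair (f : A * B -> R) :
  Ex fdpair f = Ex p (fun a => Ex (k a) (fun b => f (a, b))).
Proof. exact: Ex_fdpair_pmf. Qed.

End PairLaw.

Variables (X1 XB X2 Y1 Y2 : finType) (W : channel R X1 XB X2 Y1 Y2).
Variables (Q W1 U1 W2 V2 WB UB VB : finType).
Variable P : fdist R (joint_space X1 XB X2 Q W1 U1 W2 V2 WB UB VB).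
Variable pQ : fdist R Q.
Variable p1 : Q -> fdist R (W1 * U1 * X1)%type.
Variable p2 : Q -> fdist R (W2 * V2 * X2)%type.
Variable pB : W1 -> U1 -> W2 -> V2 -> Q -> fdist R (WB * UB * VB)%type.
Variable pXB : X1 -> X2 -> VB -> UB -> WB -> U1 -> W1 -> V2 -> W2 -> Q -> fdist R XB.
Hypothesis PE : forall q w1 u1 w2 v2 wB uB vB x1 x2 xB,
  P (q, w1, u1, w2, v2, wB, uB, vB, x1, x2, xB) =
  pQ q * p1 q (w1, u1, x1) * p2 q (w2, v2, x2) *
  pB w1 u1 w2 v2 q (wB, uB, vB) * pXB x1 x2 vB uB wB u1 w1 v2 w2 q xB.

Local Notation T := (sample_space X1 XB X2 Y1 Y2 Q W1 U1 W2 V2 WB UB VB).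

Let mu : fdist R T := with_outputs W P.
Local Notation prv := (prv mu).

Definition rvX1 (t : T) : X1 := let: (_, _, _, _, _, _, _, _, x1, _, _, _) := t in x1.
Definition rvX2 (t : T) : X2 := let: (_, _, _, _, _, _, _, _, _, x2, _, _) := t in x2.
Definition rvXB (t : T) : XB := let: (_, _, _, _, _, _, _, _, _, _, xB, _) := t in xB.

Let vQ : T -> Q := @rvQ X1 XB X2 Y1 Y2 Q W1 U1 W2 V2 WB UB VB.
Let vW1 : T -> W1 := @rvW1 X1 XB X2 Y1 Y2 Q W1 U1 W2 V2 WB UB VB.
Let vW2 : T -> W2 := @rvW2 X1 XB X2 Y1 Y2 Q W1 U1 W2 V2 WB UB VB.
Let vU : T -> U1 := @rvU1 X1 XB X2 Y1 Y2 Q W1 U1 W2 V2 WB UB VB.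
Let vV : T -> V2 := @rvV2 X1 XB X2 Y1 Y2 Q W1 U1 W2 V2 WB UB VB.
Let vWB : T -> WB := @rvWB X1 XB X2 Y1 Y2 Q W1 U1 W2 V2 WB UB VB.
Let vUB : T -> UB := @rvUB X1 XB X2 Y1 Y2 Q W1 U1 W2 V2 WB UB VB.
Let vVB : T -> VB := @rvVB X1 XB X2 Y1 Y2 Q W1 U1 W2 V2 WB UB VB.
Let vY : T -> Y1 * Y2 := snd.
Let vX1 : T -> X1 := rvX1.
Let vX2 : T -> X2 := rvX2.
Let vXB : T -> XB := rvXB.

Lemma Ex_with_outputs (f : T -> R) :
  Ex mu f = Ex pQ (fun q => Ex (p1 q) (fun a => Ex (p2 q) (fun b =>
    Ex (pB a.1.1 a.1.2 b.1.1 b.1.2 q) (fun c =>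
    Ex (pXB a.2 b.2 c.2 c.1.2 c.1.1 a.1.2 a.1.1 b.1.2 b.1.1 q) (fun xB =>
    Ex (W a.2 xB b.2) (fun y =>
      f (q, a.1.1, a.1.2, b.1.1, b.1.2, c.1.1, c.1.2, c.2, a.2, b.2, xB, y))))))).
Proof.
(* The coordinates are regrouped by stage of the factorization, so that each use of [Ex_fdpair]
   splits off one kernel. *)
pose S := (Q * (W1 * U1 * X1) * (W2 * V2 * X2) * (WB * UB * VB) * XB * (Y1 * Y2))%type.
pose h (s : S) : T := let: (q, (w1, u1, x1), (w2, v2, x2), (wB, uB, vB), xB, y) := s in
  (q, w1, u1, w2, v2, wB, uB, vB, x1, x2, xB, y).
pose h' (t : T) : S := let: (q, w1, u1, w2, v2, wB, uB, vB, x1, x2, xB, y) := t in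
  (q, (w1, u1, x1), (w2, v2, x2), (wB, uB, vB), xB, y).
have hK : cancel h h'.
  by move=> [[[[[q [[w1 u1] x1]] [[w2 v2] x2]] [[wB uB] vB]] xB] y].
have h'K : cancel h' h.
  by move=> [[[[[[[[[[[q w1] u1] w2] v2] wB] uB] vB] x1] x2] xB] y].
pose nu := fdpair (fdpair (fdpair (fdpair (fdpair pQ p1) (fun s => p2 s.1))
  (fun s => pB s.1.2.1.1 s.1.2.1.2 s.2.1.1 s.2.1.2 s.1.1))
  (fun s => pXB s.1.1.2.2 s.1.2.2 s.2.2 s.2.1.2 s.2.1.1 s.1.1.2.1.2 s.1.1.2.1.1
              s.1.2.1.2 s.1.2.1.1 s.1.1.1))
  (fun s => W s.1.1.1.2.2 s.2 s.1.1.2.2).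
transitivity (Ex nu (f \o h)).
  rewrite /Ex (reindex h) /=; last by exists h' => s _; [exact: hK | exact: h'K].
  apply: eq_bigr => -[[[[[q [[w1 u1] x1]] [[w2 v2] x2]] [[wB uB] vB]] xB] y] _.
  congr (_ * _).
  by rewrite /h /with_outputs_pmf /= PE /fdpair_pmf /= /fdpair_pmf /= /fdpair_pmf /=.
rewrite /nu Ex_fdpair Ex_fdpair Ex_fdpair Ex_fdpair Ex_fdpair.
apply: eq_Ex => q; apply: eq_Ex => -[[w1 u1] x1]; apply: eq_Ex => -[[w2 v2] x2].
by apply: eq_Ex => -[[wB uB] vB]; apply: eq_Ex => xB; apply: eq_Ex => y.
Qed.

(** The factorization draws [(W1, U1, X1)] at once, but superposition needs [W1] first; the kernels
    are therefore conditional laws of [mu]. *)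
Let k1 q := cond mu vQ vW1 q.
Let k1' q := cond mu vQ vW2 q.
Let k2 q w1 := cond mu [% vQ, vW1] [% vU, vX1] (q, w1).
Let k2' q w2 := cond mu [% vQ, vW2] [% vV, vX2] (q, w2).

Let W1U := (W1 * U1 * X1)%type.
Let W2V := (W2 * V2 * X2)%type.
Let vA : T -> W1U := [% vW1, vU, vX1].
Let vD : T -> W2V := [% vW2, vV, vX2].

Lemma Ex_transmitters (F : Q -> W1U -> W2V -> R) :
  Ex mu (fun t => F (vQ t) (vA t) (vD t)) =
  Ex pQ (fun q => Ex (p1 q) (fun a => Ex (p2 q) (F q a))).
Proof.
rewrite Ex_with_outputs; apply: eq_Ex => q; apply: eq_Ex => -[[w1 u1] x1].
apply: eq_Ex => -[[w2 v2] x2] /=.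
by apply: Ex_const => c; apply: Ex_const => xB; exact: Ex_const.
Qed.

Let Ex_eq (A : finType) (p : fdist R A) (a : A) : Ex p (fun x => (x == a)%:R) = p a.
Proof.
by rewrite -[RHS]mulr1 -(Ex_ind p a (fun=> 1)); apply: eq_Ex => x; rewrite mulr1.
Qed.

Let prv_QAB q a b : prv [% vQ, vA, vD] (q, a, b) = pQ q * (p1 q a * p2 q b).
Proof.
rewrite prv_Ex (eq_Ex _ (g := fun t => (vQ t == q)%:R *
    ((vA t == a)%:R * (vD t == b)%:R))); last first.
  by move=> t; rewrite -!natrM !mulnb andbA.
rewrite (Ex_transmitters (fun q' a' b' => (q' == q)%:R * ((a' == a)%:R * (b' == b)%:R))).
under eq_Ex do under eq_Ex do rewrite ExZl ExZl Ex_eq.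
under eq_Ex do rewrite ExZl (Ex_ind _ a (fun=> p2 _ b)).
by rewrite (Ex_ind pQ q (fun q' => p1 q' a * p2 q' b)).
Qed.

Let prv_QA q a : prv [% vQ, vA] (q, a) = pQ q * p1 q a.
Proof.
rewrite -(sum_prv_pair _ _ vD); under eq_bigr do rewrite prv_QAB.
by rewrite -mulr_sumr -mulr_sumr pmf_sum1 mulr1.
Qed.

Let prv_QB q b : prv [% vQ, vD] (q, b) = pQ q * p2 q b.
Proof.
rewrite -(sum_prv_pair _ _ vA).
transitivity (\sum_a pQ q * p2 q b * p1 q a).
  apply: eq_bigr => a _; transitivity (prv [% vQ, vA, vD] (q, a, b)).
    apply: eq_prv => t; rewrite -[LHS]/((vQ t == q) && (vD t == b) && (vA t == a)).
    by rewrite andbAC.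
  by rewrite prv_QAB mulrCA mulrC.
by rewrite -mulr_sumr pmf_sum1 mulr1.
Qed.

Let prv_Q q : prv vQ q = pQ q.
Proof.
rewrite -(sum_prv_pair _ _ vA); under eq_bigr do rewrite prv_QA.
by rewrite -mulr_sumr pmf_sum1 mulr1.
Qed.

(** At a null [q] the kernel [cond] is a default law unrelated to [p1], which expectations over [q]
    do not see. *)
Let p1E q w1 u1 x1 : 0 < pQ q -> p1 q (w1, u1, x1) = k1 q w1 * k2 q w1 (u1, x1).
Proof.
move=> q0; apply: (mulfI (lt0r_neq0 q0)).
rewrite -prv_QA mulrA -prv_Q -condE -condE; apply: eq_prv => t.
rewrite -[LHS]/((vQ t == q) && ((vW1 t == w1) && (vU t == u1) && (vX1 t == x1))).
by rewrite -andbA andbA.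
Qed.

Let p2E q w2 v2 x2 : 0 < pQ q -> p2 q (w2, v2, x2) = k1' q w2 * k2' q w2 (v2, x2).
Proof.
move=> q0; apply: (mulfI (lt0r_neq0 q0)).
rewrite -prv_QB mulrA -prv_Q -condE -condE; apply: eq_prv => t.
rewrite -[LHS]/((vQ t == q) && ((vW2 t == w2) && (vV t == v2) && (vX2 t == x2))).
by rewrite -andbA andbA.
Qed.

Let Ex_p1 q (f : W1U -> R) : 0 < pQ q ->
  Ex (p1 q) f = Ex (k1 q) (fun w1 => Ex (k2 q w1) (fun ux => f (w1, ux.1, ux.2))).
Proof.
move=> q0; rewrite Ex_pair /Ex.
rewrite (reindex (fun x : W1 * (U1 * X1) => (x.1, x.2.1, x.2.2))) /=; last first.
  by exists (fun x : W1U => (x.1.1, (x.1.2, x.2))) => [[w1 [u1 x1]]|[[w1 u1] x1]].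
by apply: eq_bigr => -[w1 [u1 x1]] _ /=; rewrite p1E.
Qed.

Let Ex_p2 q (f : W2V -> R) : 0 < pQ q ->
  Ex (p2 q) f = Ex (k1' q) (fun w2 => Ex (k2' q w2) (fun vx => f (w2, vx.1, vx.2))).
Proof.
move=> q0; rewrite Ex_pair /Ex.
rewrite (reindex (fun x : W2 * (V2 * X2) => (x.1, x.2.1, x.2.2))) /=; last first.
  by exists (fun x : W2V => (x.1.1, (x.1.2, x.2))) => [[w1 [u1 x1]]|[[w1 u1] x1]].
by apply: eq_bigr => -[w1 [u1 x1]] _ /=; rewrite p2E.
Qed.

Lemma Ex_kernels (F : Q -> W1U -> W2V -> R) :
  Ex pQ (fun q => Ex (p1 q) (fun a => Ex (p2 q) (F q a))) =
  Ex (law mu vQ) (fun q => Ex (k1 q) (fun w1 => Ex (k1' q) (fun w2 =>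
    Ex (k2 q w1) (fun ux => Ex (k2' q w2) (fun vx =>
      F q (w1, ux.1, ux.2) (w2, vx.1, vx.2)))))).
Proof.
transitivity (Ex pQ (fun q => Ex (k1 q) (fun w1 => Ex (k1' q) (fun w2 =>
    Ex (k2 q w1) (fun ux => Ex (k2' q w2) (fun vx =>
      F q (w1, ux.1, ux.2) (w2, vx.1, vx.2))))))); last first.
  by apply: eq_bigr => q _ /=; rewrite prv_Q.
apply: eq_Ex_supp => q q0; rewrite Ex_p1 //; apply: eq_Ex => w1.
under eq_Ex do rewrite Ex_p2 //.
by rewrite Ex_swap.
Qed.

(** Identifies the single-letter target law, averaged over [Q], with the given joint law, so that
    the expected log-densities are the mutual informations of the region. *)
Lemma truth_with_outputs
    (F : Q -> W1 -> W2 -> U1 * X1 -> V2 * X2 -> WB -> UB -> VB -> XB -> Y1 * Y2 -> R) :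
  Ex (law mu vQ) (fun q => truth W (k1 q) (k1' q) (k2 q) (k2' q) snd snd
    (fun w1 w2 ux vx wB uB vB => pB w1 ux.1 w2 vx.1 q (wB, uB, vB))
    (fun w1 w2 ux vx wB uB vB => pXB ux.2 vx.2 vB uB wB ux.1 w1 vx.1 w2 q) (F q)) =
  Ex mu (fun t => F (vQ t) (vW1 t) (vW2 t) (vU t, vX1 t) (vV t, vX2 t) (vWB t) (vUB t)
    (vVB t) (vXB t) (vY t)).
Proof.
rewrite Ex_with_outputs (Ex_kernels (fun q a b => Ex (pB a.1.1 a.1.2 b.1.1 b.1.2 q) (fun c =>
    Ex (pXB a.2 b.2 c.2 c.1.2 c.1.1 a.1.2 a.1.1 b.1.2 b.1.1 q) (fun xB =>
    Ex (W a.2 xB b.2) (fun y =>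
      F q a.1.1 b.1.1 (a.1.2, a.2) (b.1.2, b.2) c.1.1 c.1.2 c.2 xB y))))).
apply: eq_Ex => q; apply: eq_Ex => w1; apply: eq_Ex => w2.
apply: eq_Ex => -[u x1]; apply: eq_Ex => -[v x2] /=.
rewrite pair_bigA pair_bigA /=.
by apply: eq_bigr => -[[wB uB] vB] _.
Qed.

Lemma prv_W1W2_BCCR q w1 w2 :
  prv [% vQ, vW1, vW2] (q, w1, w2) = prv vQ q * k1 q w1 * k1' q w2.
Proof.
rewrite prv_Ex (eq_Ex _ (g := fun t => (vQ t == q)%:R *
    (((vA t).1.1 == w1)%:R * ((vD t).1.1 == w2)%:R))); last first.
  by move=> t; rewrite -!natrM !mulnb; congr (nat_of_bool _)%:R; rewrite !andbA.
rewrite (Ex_transmitters (fun q' a' b' =>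
  (q' == q)%:R * ((a'.1.1 == w1)%:R * (b'.1.1 == w2)%:R))) Ex_kernels /=.
under eq_Ex do under eq_Ex do under eq_Ex do under eq_Ex do rewrite Ex_cst.
under eq_Ex do under eq_Ex do under eq_Ex do rewrite Ex_cst.
under eq_Ex do under eq_Ex do rewrite ExZl ExZl Ex_eq.
under eq_Ex do rewrite ExZl (Ex_ind _ w1 (fun=> k1' _ w2)).
by rewrite (Ex_ind _ q (fun q => k1 q w1 * k1' q w2)) mulrA.
Qed.

Lemma prv_U_BCCR q w1 w2 u : prv [% vQ, vW1, vW2, vU] (q, w1, w2, u) =
  prv [% vQ, vW1, vW2] (q, w1, w2) * \sum_x k2 q w1 (u, x).
Proof.
rewrite prv_W1W2_BCCR prv_Ex (eq_Ex _ (g := fun t => (vQ t == q)%:R *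
    (((vA t).1.1 == w1)%:R * (((vD t).1.1 == w2)%:R * ((vA t).1.2 == u)%:R)))); last first.
  by move=> t; rewrite -!natrM !mulnb; congr (nat_of_bool _)%:R; rewrite !andbA.
rewrite (Ex_transmitters (fun q' a' b' =>
  (q' == q)%:R * ((a'.1.1 == w1)%:R * ((b'.1.1 == w2)%:R * (a'.1.2 == u)%:R)))) Ex_kernels /=.
under eq_Ex do under eq_Ex do under eq_Ex do under eq_Ex do rewrite Ex_cst.
have kE q' w1' : Ex (k2 q' w1') (fun ux => (ux.1 == u)%:R) = \sum_x k2 q' w1' (u, x).
  rewrite (Ex_fst _ (fun u' => (u' == u)%:R)) (bigD1 u) //= eqxx mulr1 [X in _ + X]big1 ?addr0 //.
  by move=> u' /negbTE->; rewrite mulr0.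
under eq_Ex do under eq_Ex do under eq_Ex do rewrite !ExZl kE.
under eq_Ex do under eq_Ex do rewrite !ExZl (Ex_ind _ w2).
under eq_Ex do rewrite ExZl (Ex_ind _ w1 (fun w1 => k1' _ w2 * \sum_x k2 _ w1 (u, x))).
rewrite (Ex_ind _ q (fun q => k1 q w1 * (k1' q w2 * \sum_x k2 q w1 (u, x)))).
by rewrite !mulrA.
Qed.

Lemma prv_V_BCCR q w1 w2 v : prv [% vQ, vW1, vW2, vV] (q, w1, w2, v) =
  prv [% vQ, vW1, vW2] (q, w1, w2) * \sum_x k2' q w2 (v, x).
Proof.
rewrite prv_W1W2_BCCR prv_Ex (eq_Ex _ (g := fun t => (vQ t == q)%:R *
    (((vA t).1.1 == w1)%:R * (((vD t).1.1 == w2)%:R * ((vD t).1.2 == v)%:R)))); last first.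
  by move=> t; rewrite -!natrM !mulnb; congr (nat_of_bool _)%:R; rewrite !andbA.
rewrite (Ex_transmitters (fun q' a' b' =>
  (q' == q)%:R * ((a'.1.1 == w1)%:R * ((b'.1.1 == w2)%:R * (b'.1.2 == v)%:R)))) Ex_kernels /=.
have kE q' w2' : Ex (k2' q' w2') (fun vx => (vx.1 == v)%:R) = \sum_x k2' q' w2' (v, x).
  rewrite (Ex_fst _ (fun u' => (u' == v)%:R)) (bigD1 v) //= eqxx mulr1 [X in _ + X]big1 ?addr0 //.
  by move=> u' /negbTE->; rewrite mulr0.
under eq_Ex do under eq_Ex do under eq_Ex do under eq_Ex do rewrite !ExZl kE.
under eq_Ex do under eq_Ex do under eq_Ex do rewrite Ex_cst.
under eq_Ex do under eq_Ex do rewrite !ExZl (Ex_ind _ w2 (fun w2 => \sum_x k2' _ w2 (v, x))).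
under eq_Ex do rewrite ExZl (Ex_ind _ w1 (fun w1 => k1' _ w2 * \sum_x k2' _ w2 (v, x))).
rewrite (Ex_ind _ q (fun q => k1 q w1 * (k1' q w2 * \sum_x k2' q w2 (v, x)))).
by rewrite !mulrA.
Qed.

(** The kernel [pB] is a function of the auxiliary letters alone, so it is not disturbed by summing
    out the relay inputs. *)
Lemma prv_B_BCCR q w1 w2 u v wB ub vb :
  prv [% vQ, vW1, vW2, vU, vV, vWB, vUB, vVB] (q, w1, w2, u, v, wB, ub, vb) =
  prv [% vQ, vW1, vW2, vU, vV] (q, w1, w2, u, v) * pB w1 u w2 v q (wB, ub, vb).
Proof.
pose G q' (a' : W1U) (b' : W2V) : R := ((q' == q) && (a'.1.1 == w1) && (b'.1.1 == w2) &&
   (a'.1.2 == u) && (b'.1.2 == v))%:R.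
have -> : prv [% vQ, vW1, vW2, vU, vV] (q, w1, w2, u, v) =
    Ex pQ (fun q => Ex (p1 q) (fun a => Ex (p2 q) (G q a))).
  by rewrite -Ex_transmitters prv_Ex.
rewrite prv_Ex (eq_Ex _ (g := fun t => G (vQ t) (vA t) (vD t) *
    ((vWB t, vUB t, vVB t) == (wB, ub, vb))%:R)); last first.
  by move=> t; rewrite /G -natrM mulnb /pairrv !xpair_eqE !andbA.
rewrite Ex_with_outputs -ExZr; apply: eq_Ex => q'.
rewrite -ExZr; apply: eq_Ex => -[[w1' u'] x1'].
rewrite -ExZr; apply: eq_Ex => -[[w2' v'] x2'].
transitivity (G q' (w1', u', x1') (w2', v', x2') * pB w1' u' w2' v' q' (wB, ub, vb)).
  rewrite -Ex_eq -ExZl; apply: eq_Ex => -[[a b] c].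
  by apply: Ex_const => xB; exact: Ex_const.
rewrite /G /=.
by do 5 (case: eqP => [->|_] /=; last by rewrite !mul0r).
Qed.

Lemma support_BCCR q w1 w2 ux vx wB ub vb xB y :
  0 < law mu vQ q -> 0 < k1 q w1 -> 0 < k1' q w2 -> 0 < k2 q w1 ux -> 0 < k2' q w2 vx ->
  0 < pB w1 ux.1 w2 vx.1 q (wB, ub, vb) ->
  0 < pXB ux.2 vx.2 vb ub wB ux.1 w1 vx.1 w2 q xB -> 0 < W ux.2 xB vx.2 y ->
  0 < mu (q, w1, ux.1, w2, vx.1, wB, ub, vb, ux.2, vx.2, xB, y).
Proof.
case: ux vx => [u x1] [v x2] /= h1 h2 h3 h4 h5 h6 h7 h8.
rewrite prv_Q in h1.
rewrite /with_outputs_pmf /= PE p1E // p2E //.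
by rewrite !mulr_gt0.
Qed.

End JointLaw.

(** * Sequences bounded above by null sequences *)

Section Vanishing.
Variable R : realType.
Local Open Scope classical_set_scope.

(** One-sided, so that bounds compose without tracking signs of the sequences; nonnegativity enters
    once, in [vanishing_cvg]. *)
Definition vanishing (u : nat -> R) : Prop :=
  exists2 v : nat -> R, v @ \oo --> (0 : R) & forall n, u n <= v n.

Lemma vanishing_le u v : (forall n, u n <= v n) -> vanishing v -> vanishing u.
Proof. by move=> uv [w w0 vw]; exists w => // n; exact: le_trans (uv n) (vw n). Qed.

Lemma vanishingD u v : vanishing u -> vanishing v -> vanishing (fun n => u n + v n).
Proof.
move=> [u' u0 uu'] [v' v0 vv']; exists (fun n => u' n + v' n).
  by rewrite -[0]addr0; exact: cvgD.
by move=> n; rewrite lerD.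
Qed.

Lemma vanishingZ a u : 0 <= a -> vanishing u -> vanishing (fun n => a * u n).
Proof.
move=> a0 [u' u0 uu']; exists (fun n => a * u' n).
  by rewrite -(mulr0 a); apply: cvgM => //; exact: cvg_cst.
by move=> n; rewrite ler_wpM2l.
Qed.

Lemma vanishing_geometric a r : 0 <= r < 1 -> vanishing (fun n => a * r ^+ n).
Proof.
move=> /andP[r0 r1]; exists (fun n => a * r ^+ n) => //.
rewrite -(mulr0 a); apply: cvgM; first exact: cvg_cst.
by apply: cvg_expr; rewrite ger0_norm.
Qed.

Lemma vanishing_sum (I : eqType) (s : seq I) (u : I -> nat -> R) :
  (forall i, i \in s -> vanishing (u i)) -> vanishing (fun n => \sum_(i <- s) u i n).
Proof.
elim: s => [|i s IHs] h.
  apply: (@vanishing_le _ (fun n => 0 * 0 ^+ n)); last first.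
    by apply: vanishing_geometric; rewrite lexx ltr01.
  by move=> n; rewrite big_nil mul0r.
apply: (@vanishing_le _ (fun n => u i n + \sum_(i <- s) u i n)).
  by move=> n; rewrite big_cons.
apply: vanishingD; first by apply: h; rewrite mem_head.
by apply: IHs => j js; apply: h; rewrite in_cons js orbT.
Qed.

Lemma vanishing_cvg u : (forall n, 0 <= u n) -> vanishing u -> u @ \oo --> (0 : R).
Proof.
move=> u0 [v v0 uv]; apply: (@squeeze_cvgr _ _ _ _ (fun=> 0) v) => //.
- by apply: nearW => n; rewrite u0 uv.
- exact: cvg_cst.
Qed.

End Vanishing.

(** * Sizes of message sets *)

Section MessageSize.
Variable R : realType.

Lemma card_message (n : nat) (r : R) : #|message n r| = absz (Num.ceil (2 `^ (n%:R * r))).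
Proof. by rewrite card_ord. Qed.

Lemma powR_natl (n : nat) (r : R) : 2 `^ (n%:R * r) = (2 `^ r) ^+ n.
Proof. by rewrite mulrC powRrM powR_mulrn // powR_ge0. Qed.

Lemma ceil_powR_gt0 (n : nat) (r : R) : 0 < Num.ceil (2 `^ (n%:R * r)).
Proof. by rewrite ceil_gt0 powR_gt0. Qed.

Lemma card_messageR (n : nat) (r : R) :
  #|message n r|%:R = (Num.ceil (2 `^ (n%:R * r)))%:~R :> R.
Proof.
rewrite card_message -[RHS](_ : (absz (Num.ceil (2 `^ (n%:R * r))))%:Z%:~R = _) //.
by rewrite gez0_abs // ltW // ceil_powR_gt0.
Qed.

Lemma card_message_gt0 (n : nat) (r : R) : (0 < #|message n r|)%N.
Proof. by rewrite card_message absz_gt0 gt_eqF // ceil_powR_gt0. Qed.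

Lemma card_message_ge (n : nat) (r : R) : (2 `^ r) ^+ n <= #|message n r|%:R :> R.
Proof. by rewrite card_messageR -powR_natl ceil_ge. Qed.

(** A ceiling is below [x + 1], hence below [2 * x], as [x >= 1] for a nonnegative rate. *)
Lemma card_message_le (n : nat) (r : R) : 0 <= r ->
  #|message n r|%:R <= 2 * (2 `^ r) ^+ n :> R.
Proof.
move=> r0; rewrite card_messageR -powR_natl.
have h1 : 1 <= 2 `^ (n%:R * r) :> R.
  by rewrite -[leLHS](powRr0 (2 : R)) ler_powR ?mulr_ge0 // ler1n.
have : (Num.ceil (2 `^ (n%:R * r)))%:~R < 2 `^ (n%:R * r) + 1 :> R.
  by have /andP[] := ceil_itv (2 `^ (n%:R * r)); rewrite intrB ltrBlDr.
lra.
Qed.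

Lemma message_pair (n : nat) (r s : R) :
  exists f : message n (r + s) -> message n r * message n s, injective f.
Proof.
have le : (#|message n (r + s)| <= #|{: message n r * message n s}|)%N.
  rewrite -(ler_nat R) card_prod natrM !card_messageR -intrM ler_int ceil_le_int intrM.
  rewrite mulrDr powRD ?pnatr_eq0 ?implybT // ler_pM ?powR_ge0 ?ceil_ge //.
pose f (m : message n (r + s)) : message n r * message n s :=
  enum_val (widen_ord le (enum_rank m)).
exists f => m m' /enum_val_inj/(congr1 val) /= /val_inj/enum_rank_inj.
exact.
Qed.

End MessageSize.

Lemma truth_sum (R : realType) (W1 W2 U V WB UB VB X1 X2 XB Y1 Y2 : finType)
    (ch : X1 -> XB -> X2 -> fdist R (Y1 * Y2)%type)
    (k1 : fdist R W1) (k1' : fdist R W2) (k2 : W1 -> fdist R U) (k2' : W2 -> fdist R V)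
    (x1 : U -> X1) (x2 : V -> X2) (pB : W1 -> W2 -> U -> V -> WB -> UB -> VB -> R)
    (kX : W1 -> W2 -> U -> V -> WB -> UB -> VB -> fdist R XB)
    (I : finType) (F : I -> _) :
  truth ch k1 k1' k2 k2' x1 x2 pB kX (fun w1 w2 u v wB ub vb xB y =>
    \sum_i F i w1 w2 u v wB ub vb xB y) =
  \sum_i truth ch k1 k1' k2 k2' x1 x2 pB kX (F i).
Proof.
rewrite /truth; do 4 (rewrite -Ex_sum; apply: eq_Ex => ?).
do 3 (rewrite [RHS]exchange_big /=; apply: eq_bigr => ? _).
rewrite -mulr_sumr; congr (_ * _).
by rewrite -Ex_sum; apply: eq_Ex => ?; rewrite Ex_sum.
Qed.

Lemma indicator_not_forall_le (R : realType) (K : finType) (p : pred K) :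
  (~~ [forall k, p k])%:R <= \sum_k (~~ p k)%:R :> R.
Proof.
have [_|/forallPn[k pk]] := boolP [forall k, p k]; first by apply: sumr_ge0.
by rewrite (bigD1 k) //= pk lerDl; apply: sumr_ge0.
Qed.

(** * Rates *)

Section Assembly.
Variables (R : realType) (X1 XB X2 Y1 Y2 : finType) (ch : channel R X1 XB X2 Y1 Y2).
Variables (T : finType) (mu : fdist R T).
Variables (Q W1 W2 U V WB UB VB : finType).
Variables (vQ : T -> Q) (vW1 : T -> W1) (vW2 : T -> W2) (vU : T -> U) (vV : T -> V).
Variables (vWB : T -> WB) (vUB : T -> UB) (vVB : T -> VB).
Variables (vX1 : T -> X1) (vX2 : T -> X2) (vXB : T -> XB) (vY : T -> Y1 * Y2).
Variables (k1 : Q -> fdist R W1) (k1' : Q -> fdist R W2).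
Variable k2 : Q -> W1 -> fdist R (U * X1)%type.
Variable k2' : Q -> W2 -> fdist R (V * X2)%type.
Variable k4 : Q -> W1 -> W2 -> fdist R WB.
Variable k5 : Q -> W1 -> W2 -> WB -> U -> fdist R UB.
Variable k6 : Q -> W1 -> W2 -> WB -> V -> fdist R VB.
Variable pB : Q -> W1 -> W2 -> U -> V -> WB -> UB -> VB -> R.
Variable kX : Q -> W1 -> W2 -> U * X1 -> V * X2 -> WB -> UB -> VB -> fdist R XB.
Hypothesis pB_ge0 : forall q w1 w2 u v wB ub vb, 0 <= pB q w1 w2 u v wB ub vb.
Hypothesis pB_sum1 : forall q w1 w2 u v,
  \sum_wB \sum_ub \sum_vb pB q w1 w2 u v wB ub vb = 1.

(** The one-shot letters [U] and [V] are instantiated with [U * X1] and [V * X2], the relay inputs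
    being read off by [snd]. *)
Let pBx q w1 w2 (ux : U * X1) (vx : V * X2) wB ub vb := pB q w1 w2 ux.1 vx.1 wB ub vb.

Let values t := (vQ t, vW1 t, vW2 t, (vU t, vX1 t), (vV t, vX2 t), vWB t, vUB t, vVB t,
  vXB t, vY t).

Let supp q w1 w2 ux vx wB ub vb xB y :=
  exists2 t, 0 < mu t & values t = (q, w1, w2, ux, vx, wB, ub, vb, xB, y).

Hypothesis suppP : forall q w1 w2 ux vx wB ub vb xB y,
  0 < law mu vQ q -> 0 < k1 q w1 -> 0 < k1' q w2 -> 0 < k2 q w1 ux -> 0 < k2' q w2 vx ->
  0 < pBx q w1 w2 ux vx wB ub vb -> 0 < kX q w1 w2 ux vx wB ub vb xB ->
  0 < ch ux.2 xB vx.2 y -> supp q w1 w2 ux vx wB ub vb xB y.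

Hypothesis truth_mu :
  forall F : Q -> W1 -> W2 -> U * X1 -> V * X2 -> WB -> UB -> VB -> XB -> Y1 * Y2 -> R,
  Ex (law mu vQ) (fun q => truth ch (k1 q) (k1' q) (k2 q) (k2' q) snd snd
    (pBx q) (kX q) (F q)) =
  Ex mu (fun t => F (vQ t) (vW1 t) (vW2 t) (vU t, vX1 t) (vV t, vX2 t) (vWB t) (vUB t)
    (vVB t) (vXB t) (vY t)).

Local Notation trn q := (truthn ch (fun j => k1 (q j)) (fun j => k1' (q j))
  (fun j => k2 (q j)) (fun j => k2' (q j)) snd snd (fun j => pBx (q j)) (fun j => kX (q j))).

(** Averaged over the time-sharing word, the coordinates are independent copies of [mu], so the
    exponential bound is the power [rr ^+ n] of one number below [1], supplied by
    [chernoff_base]. *)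
Lemma fail_vanishing
    (r : Q -> W1 -> W2 -> U * X1 -> V * X2 -> WB -> UB -> VB -> XB -> Y1 * Y2 -> R) (g : R)
    (F : forall n, {ffun 'I_n -> Q} -> {ffun 'I_n -> W1} -> {ffun 'I_n -> W2} ->
         {ffun 'I_n -> U * X1} -> {ffun 'I_n -> V * X2} ->
         {ffun 'I_n -> WB} -> {ffun 'I_n -> UB} -> {ffun 'I_n -> VB} -> {ffun 'I_n -> XB} ->
         {ffun 'I_n -> Y1} * {ffun 'I_n -> Y2} -> R) :
  (forall q w1 w2 ux vx wB ub vb xB y, supp q w1 w2 ux vx wB ub vb xB y ->
     0 < r q w1 w2 ux vx wB ub vb xB y) ->
  g < Ex mu (fun t => log2 (r (vQ t) (vW1 t) (vW2 t) (vU t, vX1 t) (vV t, vX2 t) (vWB t)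
     (vUB t) (vVB t) (vXB t) (vY t))) ->
  (forall n (q : {ffun 'I_n -> Q}) (w1 : {ffun 'I_n -> W1}) (w2 : {ffun 'I_n -> W2})
      (u : {ffun 'I_n -> U * X1}) (v : {ffun 'I_n -> V * X2})
      (wB : {ffun 'I_n -> WB}) (ub : {ffun 'I_n -> UB}) (vb : {ffun 'I_n -> VB})
      (xB : {ffun 'I_n -> XB}) (y : {ffun 'I_n -> Y1} * {ffun 'I_n -> Y2}),
    (forall j, supp (q j) (w1 j) (w2 j) (u j) (v j) (wB j) (ub j) (vb j) (xB j)
       (y.1 j, y.2 j)) ->
    F n q w1 w2 u v wB ub vb xB y <= (\prod_j r (q j) (w1 j) (w2 j) (u j) (v j) (wB j)
       (ub j) (vb j) (xB j) (y.1 j, y.2 j) <= (2 `^ g) ^+ n)%R%:R) ->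
  vanishing (fun n => Ex (fam (fun _ : 'I_n => law mu vQ)) (fun q => trn q (F n q))).
Proof.
move=> r_gt0 g_lt FE.
pose rt t := r (vQ t) (vW1 t) (vW2 t) (vU t, vX1 t) (vV t, vX2 t) (vWB t)
     (vUB t) (vVB t) (vXB t) (vY t).
have ln2 : 0 < ln 2 :> R by rewrite ln_gt0 // ltr1n.
pose z t := ln (rt t) - ln (2 `^ g).
have z_gt0 : 0 < Ex mu z.
  have -> : Ex mu z = ln 2 * (Ex mu (fun t => log2 (rt t)) - g).
    rewrite mulrBr -ExZl -[in RHS](Ex_cst mu (ln 2 * g)) -[- Ex _ _]mulN1r -ExZl -ExD.
    apply: eq_Ex => t; rewrite /z /log2 ln_powR mulN1r [g * _]mulrC; congr (_ - _).
    by rewrite mulrCA divff ?gt_eqF // mulr1.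
  by rewrite mulr_gt0 // subr_gt0.
have [l l0 hl] := chernoff_base z_gt0.
set rr := Ex _ _ in hl.
have rr0 : 0 <= rr by apply: Ex_ge0 => t; exact: expR_ge0.
apply: (@vanishing_le _ _ (fun n => 1 * rr ^+ n)); last first.
  by apply: vanishing_geometric; rewrite rr0 hl.
move=> n; rewrite mul1r.
have -> : rr ^+ n = Ex (fam (fun _ : 'I_n => law mu vQ)) (fun q => \prod_j
    truth ch (k1 (q j)) (k1' (q j)) (k2 (q j)) (k2' (q j)) snd snd (pBx (q j)) (kX (q j))
    (fun w1 w2 u v wB ub vb xB y =>
       expR (- (l * (ln (r (q j) w1 w2 u v wB ub vb xB y) - ln (2 `^ g)))))).
  rewrite (Ex_fam_prod (fun=> law mu vQ) (fun _ q =>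
    truth ch (k1 q) (k1' q) (k2 q) (k2' q) snd snd (pBx q) (kX q)
    (fun w1 w2 u v wB ub vb xB y =>
       expR (- (l * (ln (r q w1 w2 u v wB ub vb xB y) - ln (2 `^ g))))))).
  by rewrite prodr_const card_ord (truth_mu (fun q w1 w2 u v wB ub vb xB y =>
       expR (- (l * (ln (r q w1 w2 u v wB ub vb xB y) - ln (2 `^ g)))))).
apply: le_Ex_supp => q hq.
apply: (@truthn_chernoff R W1 W2 (U * X1)%type (V * X2)%type WB UB VB X1 X2 XB Y1 Y2 ch
  'I_n (fun j => k1 (q j)) (fun j => k1' (q j))
  (fun j => k2 (q j)) (fun j => k2' (q j)) snd snd (fun j => pBx (q j)) _
  (fun j => kX (q j)) (fun j => r (q j)) l (2 `^ g) l0 (fun j => supp (q j))).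
- by move=> *; exact: pB_ge0.
- exact: powR_gt0.
- move=> j *; apply: suppP => //; exact: (fam_gt0 j hq).
- by move=> j *; exact: r_gt0.
- by move=> *; rewrite card_ord; exact: FE.
Qed.

Hypothesis prv_W1W2 : forall q w1 w2,
  prv mu [% vQ, vW1, vW2] (q, w1, w2) = prv mu vQ q * k1 q w1 * k1' q w2.
Hypothesis prv_U : forall q w1 w2 u,
  prv mu [% vQ, vW1, vW2, vU] (q, w1, w2, u) =
  prv mu [% vQ, vW1, vW2] (q, w1, w2) * \sum_x k2 q w1 (u, x).
Hypothesis prv_V : forall q w1 w2 v,
  prv mu [% vQ, vW1, vW2, vV] (q, w1, w2, v) =
  prv mu [% vQ, vW1, vW2] (q, w1, w2) * \sum_x k2' q w2 (v, x).
Hypothesis prv_WB : forall q w1 w2 wB,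
  prv mu [% vQ, vW1, vW2, vWB] (q, w1, w2, wB) =
  prv mu [% vQ, vW1, vW2] (q, w1, w2) * k4 q w1 w2 wB.
Hypothesis prv_UB : forall q w1 w2 u wB ub,
  prv mu [% vQ, vW1, vW2, vU, vWB, vUB] (q, w1, w2, u, wB, ub) =
  prv mu [% vQ, vW1, vW2, vU, vWB] (q, w1, w2, u, wB) * k5 q w1 w2 wB u ub.
Hypothesis prv_VB : forall q w1 w2 v wB vb,
  prv mu [% vQ, vW1, vW2, vV, vWB, vVB] (q, w1, w2, v, wB, vb) =
  prv mu [% vQ, vW1, vW2, vV, vWB] (q, w1, w2, v, wB) * k6 q w1 w2 wB v vb.
Hypothesis prv_B : forall q w1 w2 u v wB ub vb,
  prv mu [% vQ, vW1, vW2, vU, vV, vWB, vUB, vVB] (q, w1, w2, u, v, wB, ub, vb) =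
  prv mu [% vQ, vW1, vW2, vU, vV] (q, w1, w2, u, v) * pB q w1 w2 u v wB ub vb.

Let k4' q w2 w1 := k4 q w1 w2.
Let k6' q w2 w1 := k6 q w1 w2.
Let vY1 t := (vY t).1.
Let vY2 t := (vY t).2.

Lemma prv_W2W1 q w2 w1 :
  prv mu [% vQ, vW2, vW1] (q, w2, w1) = prv mu vQ q * k1' q w2 * k1 q w1.
Proof. by rewrite mulrAC -prv_W1W2; apply: eq_prv; eq_events. Qed.

Lemma prv_V' q w2 w1 v : prv mu [% vQ, vW2, vW1, vV] (q, w2, w1, v) =
  prv mu [% vQ, vW2, vW1] (q, w2, w1) * \sum_x k2' q w2 (v, x).
Proof.
transitivity (prv mu [% vQ, vW1, vW2, vV] (q, w1, w2, v)); first by apply: eq_prv; eq_events.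
by rewrite prv_V; congr (_ * _); apply: eq_prv; eq_events.
Qed.

Lemma prv_WB' q w2 w1 wB : prv mu [% vQ, vW2, vW1, vWB] (q, w2, w1, wB) =
  prv mu [% vQ, vW2, vW1] (q, w2, w1) * k4' q w2 w1 wB.
Proof.
transitivity (prv mu [% vQ, vW1, vW2, vWB] (q, w1, w2, wB)).
  by apply: eq_prv; eq_events.
by rewrite prv_WB; congr (_ * _); apply: eq_prv; eq_events.
Qed.

Lemma prv_VB' q w2 w1 v wB vb :
  prv mu [% vQ, vW2, vW1, vV, vWB, vVB] (q, w2, w1, v, wB, vb) =
  prv mu [% vQ, vW2, vW1, vV, vWB] (q, w2, w1, v, wB) * k6' q w2 w1 wB v vb.
Proof.
transitivity (prv mu [% vQ, vW1, vW2, vV, vWB, vVB] (q, w1, w2, v, wB, vb)).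
  by apply: eq_prv; eq_events.
by rewrite prv_VB; congr (_ * _); apply: eq_prv; eq_events.
Qed.

Definition rhos1 := rhos mu vQ vW1 vW2 vU vWB vUB vY1 k1 k1' k2 k4 k5.
Definition rhos2 := rhos mu vQ vW2 vW1 vV vWB vVB vY2 k1' k1 k2' k4' k6'.

Variables (g1 g2 : nat -> R) (t0 t1 t2 t3 : R).

Section FixedLength.
Variables (n : nat) (q : {ffun 'I_n -> Q}).

(** A tuple must pass seven tests, one for each kind of confusion, because each kind is excluded by
    its own density. *)
Definition pass1 (w1 : {ffun 'I_n -> W1}) (w2 : {ffun 'I_n -> W2}) (wB : {ffun 'I_n -> WB})
    (u : {ffun 'I_n -> U * X1}) (ub : {ffun 'I_n -> UB}) (y : {ffun 'I_n -> Y1}) : bool :=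
  [forall k : 'I_7, (2 `^ g1 k) ^+ n <
    \prod_j rhos1 k (q j) (w1 j) (w2 j) (wB j) (u j).1 (ub j) (y j)].

Definition pass2 (w2 : {ffun 'I_n -> W2}) (w1 : {ffun 'I_n -> W1}) (wB : {ffun 'I_n -> WB})
    (v : {ffun 'I_n -> V * X2}) (vb : {ffun 'I_n -> VB}) (y : {ffun 'I_n -> Y2}) : bool :=
  [forall k : 'I_7, (2 `^ g2 k) ^+ n <
    \prod_j rhos2 k (q j) (w2 j) (w1 j) (wB j) (v j).1 (vb j) (y j)].

(** The four covering conditions are stated without quotients, in the form of the hypotheses [A_T0]
    to [A_T3] of the one-shot bound; this form also makes sense where a law vanishes. *)
Definition covered0 (w1 : {ffun 'I_n -> W1}) (w2 : {ffun 'I_n -> W2})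
    (u : {ffun 'I_n -> U * X1}) (v : {ffun 'I_n -> V * X2}) (wB : {ffun 'I_n -> WB}) : bool :=
  \prod_j marg0 pB (q j) (w1 j) (w2 j) (u j).1 (v j).1 (wB j) <=
  ((2 `^ t0) ^+ n)^-1 * \prod_j k4 (q j) (w1 j) (w2 j) (wB j).

Definition covered1 (w1 : {ffun 'I_n -> W1}) (w2 : {ffun 'I_n -> W2})
    (u : {ffun 'I_n -> U * X1}) (v : {ffun 'I_n -> V * X2}) (wB : {ffun 'I_n -> WB})
    (ub : {ffun 'I_n -> UB}) : bool :=
  \prod_j marg1 pB (q j) (w1 j) (w2 j) (u j).1 (v j).1 (wB j) (ub j) <=
  ((2 `^ t1) ^+ n)^-1 * (\prod_j k4 (q j) (w1 j) (w2 j) (wB j) *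
    \prod_j k5 (q j) (w1 j) (w2 j) (wB j) (u j).1 (ub j)).

Definition covered2 (w1 : {ffun 'I_n -> W1}) (w2 : {ffun 'I_n -> W2})
    (u : {ffun 'I_n -> U * X1}) (v : {ffun 'I_n -> V * X2}) (wB : {ffun 'I_n -> WB})
    (vb : {ffun 'I_n -> VB}) : bool :=
  \prod_j marg2 pB (q j) (w1 j) (w2 j) (u j).1 (v j).1 (wB j) (vb j) <=
  ((2 `^ t2) ^+ n)^-1 * (\prod_j k4 (q j) (w1 j) (w2 j) (wB j) *
    \prod_j k6 (q j) (w1 j) (w2 j) (wB j) (v j).1 (vb j)).

Definition covered3 (w1 : {ffun 'I_n -> W1}) (w2 : {ffun 'I_n -> W2})
    (u : {ffun 'I_n -> U * X1}) (v : {ffun 'I_n -> V * X2}) (wB : {ffun 'I_n -> WB})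
    (ub : {ffun 'I_n -> UB}) (vb : {ffun 'I_n -> VB}) : bool :=
  \prod_j pB (q j) (w1 j) (w2 j) (u j).1 (v j).1 (wB j) (ub j) (vb j) <=
  ((2 `^ t3) ^+ n)^-1 * (\prod_j k4 (q j) (w1 j) (w2 j) (wB j) *
    \prod_j k5 (q j) (w1 j) (w2 j) (wB j) (u j).1 (ub j) *
    \prod_j k6 (q j) (w1 j) (w2 j) (wB j) (v j).1 (vb j)).

Definition covered w1 w2 u v wB ub vb : bool :=
  [&& covered0 w1 w2 u v wB, covered1 w1 w2 u v wB ub, covered2 w1 w2 u v wB vb &
      covered3 w1 w2 u v wB ub vb].

Definition fail1 : R :=
  trn q (fun w1 w2 u v wB ub vb xB y => (~~ pass1 w1 w2 wB u ub y.1)%:R).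

Definition fail2 : R :=
  trn q (fun w1 w2 u v wB ub vb xB y => (~~ pass2 w2 w1 wB v vb y.2)%:R).

Definition uncovered : R :=
  trn q (fun w1 w2 u v wB ub vb xB y => (~~ covered w1 w2 u v wB ub vb)%:R).

End FixedLength.

Hypothesis g1_lt : forall k : 'I_7, g1 k < Ex mu (fun t => log2
  (rhos1 k (vQ t) (vW1 t) (vW2 t) (vWB t) (vU t) (vUB t) (vY1 t))).
Hypothesis g2_lt : forall k : 'I_7, g2 k < Ex mu (fun t => log2
  (rhos2 k (vQ t) (vW2 t) (vW1 t) (vWB t) (vV t) (vVB t) (vY2 t))).
Hypothesis t0_lt : t0 < Ex mu (fun t => log2
  (beta0 k4 pB (vQ t) (vW1 t) (vW2 t) (vU t) (vV t) (vWB t))).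
Hypothesis t1_lt : t1 < Ex mu (fun t => log2
  (beta1 k4 k5 pB (vQ t) (vW1 t) (vW2 t) (vU t) (vV t) (vWB t) (vUB t))).
Hypothesis t2_lt : t2 < Ex mu (fun t => log2
  (beta2 k4 k6 pB (vQ t) (vW1 t) (vW2 t) (vU t) (vV t) (vWB t) (vVB t))).
Hypothesis t3_lt : t3 < Ex mu (fun t => log2
  (beta3 k4 k5 k6 pB (vQ t) (vW1 t) (vW2 t) (vU t) (vV t) (vWB t) (vUB t) (vVB t))).

Local Notation Eq n := (Ex (fam (fun _ : 'I_n => law mu vQ))).

Lemma fail1_vanishing : vanishing (fun n => Eq n (@fail1 n)).
Proof.
apply: (@vanishing_le _ _ (fun n => \sum_(k : 'I_7) Eq n (fun q =>
  trn q (fun w1 w2 u v wB ub vb xB y => (~~ ((2 `^ g1 k) ^+ n <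
    \prod_j rhos1 k (q j) (w1 j) (w2 j) (wB j) (u j).1 (ub j) (y.1 j))%R)%:R)))).
  move=> n; rewrite -Ex_sum; apply: le_Ex => q; rewrite -truth_sum.
  apply: le_truth => [*|w1 w2 u v wB ub vb xB y *]; first by apply: pBn_ge0 => *; exact: pB_ge0.
  exact: indicator_not_forall_le.
apply: vanishing_sum => k _.
apply: (@fail_vanishing (fun q w1 w2 ux vx wB ub vb xB y => rhos1 k q w1 w2 wB ux.1 ub y.1)
  (g1 k)).
- move=> q w1 w2 ux vx wB ub vb xB y [t mut]; case=> *; subst.
  exact: (rhos_gt0 vY1 prv_W1W2 prv_U prv_WB prv_UB).
- exact: g1_lt.
- by move=> n q w1 w2 u v wB ub vb xB y _; rewrite -leNgt.
Qed.

Lemma fail2_vanishing : vanishing (fun n => Eq n (@fail2 n)).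
Proof.
apply: (@vanishing_le _ _ (fun n => \sum_(k : 'I_7) Eq n (fun q =>
  trn q (fun w1 w2 u v wB ub vb xB y => (~~ ((2 `^ g2 k) ^+ n <
    \prod_j rhos2 k (q j) (w2 j) (w1 j) (wB j) (v j).1 (vb j) (y.2 j))%R)%:R)))).
  move=> n; rewrite -Ex_sum; apply: le_Ex => q; rewrite -truth_sum.
  apply: le_truth => [*|w1 w2 u v wB ub vb xB y *]; first by apply: pBn_ge0 => *; exact: pB_ge0.
  exact: indicator_not_forall_le.
apply: vanishing_sum => k _.
apply: (@fail_vanishing (fun q w1 w2 ux vx wB ub vb xB y => rhos2 k q w2 w1 wB vx.1 vb y.2)
  (g2 k)).
- move=> q w1 w2 ux vx wB ub vb xB y [t mut]; case=> *; subst.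
  exact: (rhos_gt0 vY2 prv_W2W1 prv_V' prv_WB' prv_VB').
- exact: g2_lt.
- by move=> n q w1 w2 u v wB ub vb xB y _; rewrite -leNgt.
Qed.

Lemma prod_ratio_le (J : finType) (k m : J -> R) (c : R) :
  0 < c -> (forall j, 0 < m j) ->
  (~~ (\prod_j m j <= c^-1 * \prod_j k j)%R)%:R <= (\prod_j (k j / m j) <= c)%R%:R :> R.
Proof.
move=> c0 m0; rewrite -ltNge big_split /= prodfV.
have M0 : 0 < \prod_j m j by apply: prodr_gt0.
have [h|//] := ltP (c^-1 * \prod_j k j) (\prod_j m j).
have -> : \prod_j k j / \prod_j m j <= c; last exact: lexx.
by rewrite ler_pdivrMr // -ler_pdivrMl // ltW.
Qed.

Lemma uncovered_vanishing : vanishing (fun n => Eq n (@uncovered n)).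
Proof.
apply: (@vanishing_le _ _ (fun n =>
  Eq n (fun q => trn q (fun w1 w2 u v wB ub vb xB y => (~~ covered0 q w1 w2 u v wB)%:R)) +
  (Eq n (fun q => trn q (fun w1 w2 u v wB ub vb xB y => (~~ covered1 q w1 w2 u v wB ub)%:R)) +
  (Eq n (fun q => trn q (fun w1 w2 u v wB ub vb xB y => (~~ covered2 q w1 w2 u v wB vb)%:R)) +
   Eq n (fun q => trn q (fun w1 w2 u v wB ub vb xB y =>
     (~~ covered3 q w1 w2 u v wB ub vb)%:R)))))).
  move=> n; rewrite -!ExD; apply: le_Ex => q; rewrite /truthn -!truthD.
  apply: le_truth => [*|w1 w2 u v wB ub vb xB y *]; first by apply: pBn_ge0 => *; exact: pB_ge0.
  rewrite /covered; case: (covered0 _ _ _ _ _ _); case: (covered1 _ _ _ _ _ _ _);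
    case: (covered2 _ _ _ _ _ _ _); case: (covered3 _ _ _ _ _ _ _ _);
    rewrite /= ?(add0r, addr0) ?lexx ?lerDl ?addr_ge0 ?ler01 //.
apply: vanishingD; last apply: vanishingD; last apply: vanishingD.
- apply: (@fail_vanishing (fun q w1 w2 ux vx wB ub vb xB y =>
    beta0 k4 pB q w1 w2 ux.1 vx.1 wB) t0) => //.
  + move=> q w1 w2 ux vx wB ub vb xB y [t mut]; case=> *; subst.
    by rewrite divr_gt0 // ?(k4_gt0 prv_WB mut) // (marg0_gt0 pB_ge0 prv_B mut).
  + move=> n q w1 w2 u v wB ub vb xB y h.
    apply: prod_ratio_le; first by rewrite exprn_gt0 // powR_gt0.
    move=> j; have [t mut] := h j; case=> <- <- <- <- <- <- *.
    exact: (marg0_gt0 pB_ge0 prv_B mut).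
- apply: (@fail_vanishing (fun q w1 w2 ux vx wB ub vb xB y =>
    beta1 k4 k5 pB q w1 w2 ux.1 vx.1 wB ub) t1) => //.
  + move=> q w1 w2 ux vx wB ub vb xB y [t mut]; case=> *; subst.
    by rewrite divr_gt0 ?mulr_gt0 ?(k4_gt0 prv_WB mut) ?(k5_gt0 prv_UB mut)
      ?(marg1_gt0 pB_ge0 prv_B mut).
  + move=> n q w1 w2 u v wB ub vb xB y h; rewrite /covered1 -big_split.
    apply: prod_ratio_le; first by rewrite exprn_gt0 // powR_gt0.
    move=> j; have [t mut] := h j; case=> <- <- <- <- <- <- <- *.
    exact: (marg1_gt0 pB_ge0 prv_B mut).
- apply: (@fail_vanishing (fun q w1 w2 ux vx wB ub vb xB y =>
    beta2 k4 k6 pB q w1 w2 ux.1 vx.1 wB vb) t2) => //.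
  + move=> q w1 w2 ux vx wB ub vb xB y [t mut]; case=> *; subst.
    by rewrite divr_gt0 ?mulr_gt0 ?(k4_gt0 prv_WB mut) ?(k6_gt0 prv_VB mut)
      ?(marg2_gt0 pB_ge0 prv_B mut).
  + move=> n q w1 w2 u v wB ub vb xB y h; rewrite /covered2 -big_split.
    apply: prod_ratio_le; first by rewrite exprn_gt0 // powR_gt0.
    move=> j; have [t mut] := h j; case=> <- <- <- <- <- <- _ <- *.
    exact: (marg2_gt0 pB_ge0 prv_B mut).
- apply: (@fail_vanishing (fun q w1 w2 ux vx wB ub vb xB y =>
    beta3 k4 k5 k6 pB q w1 w2 ux.1 vx.1 wB ub vb) t3) => //.
  + move=> q w1 w2 ux vx wB ub vb xB y [t mut]; case=> *; subst.
    by rewrite divr_gt0 ?mulr_gt0 ?(k4_gt0 prv_WB mut) ?(k5_gt0 prv_UB mut)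
      ?(k6_gt0 prv_VB mut) ?(pB_gt0 pB_ge0 prv_B mut).
  + move=> n q w1 w2 u v wB ub vb xB y h; rewrite /covered3 -!big_split.
    apply: prod_ratio_le; first by rewrite exprn_gt0 // powR_gt0.
    move=> j; have [t mut] := h j; case=> <- <- <- <- <- <- <- <- *.
    exact: (pB_gt0 pB_ge0 prv_B mut).
Qed.

Variables r0 r10 r11 r20 r22 b0 b1 b2 : R.

Let size n (r : R) : R := #|message n r|%:R.
Let D1 n k : R := ((2 `^ g1 k) ^+ n)^-1.
Let D2 n k : R := ((2 `^ g2 k) ^+ n)^-1.
Let T_ n t : R := ((2 `^ t) ^+ n)^-1.

Definition confusions1 n : R := size n b1 *
  (size n r11 * D1 n 0 + size n r0 * size n b0 * D1 n 1 +
   size n r20 * (size n r0 * size n b0) * D1 n 2 +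
   size n r0 * size n b0 * size n r11 * D1 n 3 +
   size n r20 * (size n r0 * size n b0) * size n r11 * D1 n 4 +
   size n r10 * (size n r0 * size n b0) * size n r11 * D1 n 5 +
   size n r10 * size n r20 * (size n r0 * size n b0) * size n r11 * D1 n 6).

Definition confusions2 n : R := size n b2 *
  (size n r22 * D2 n 0 + size n r0 * size n b0 * D2 n 1 +
   size n r10 * (size n r0 * size n b0) * D2 n 2 +
   size n r0 * size n b0 * size n r22 * D2 n 3 +
   size n r10 * (size n r0 * size n b0) * size n r22 * D2 n 4 +
   size n r20 * (size n r0 * size n b0) * size n r22 * D2 n 5 +
   size n r10 * size n r20 * (size n r0 * size n b0) * size n r22 * D2 n 6).

Definition covering_variance n : R :=
  T_ n t0 / size n b0 + T_ n t1 / (size n b0 * size n b1) +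
  T_ n t2 / (size n b0 * size n b2) + T_ n t3 / (size n b0 * size n b1 * size n b2).

Let D_ge0 n (g : R) : 0 <= ((2 `^ g) ^+ n)^-1.
Proof. by rewrite invr_ge0 exprn_ge0 // powR_ge0. Qed.

Section CoveringN.
Variables (n : nat) (q : {ffun 'I_n -> Q}) (w1 : {ffun 'I_n -> W1}) (w2 : {ffun 'I_n -> W2}).
Variables (u : {ffun 'I_n -> U * X1}) (v : {ffun 'I_n -> V * X2}).
Let pBxn := pBn (fun j => pBx (q j)) w1 w2 u v.

Let pBxn_ge0 wB ub vb : 0 <= pBxn wB ub vb.
Proof. by apply: pBn_ge0 => *; exact: pB_ge0. Qed.

Let sum_marg1 wB ub : \sum_vb pBxn wB ub vb =
  \prod_j marg1 pB (q j) (w1 j) (w2 j) (u j).1 (v j).1 (wB j) (ub j).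
Proof.
exact: (sum_ffun_prod (fun j vb => pB (q j) (w1 j) (w2 j) (u j).1 (v j).1 (wB j) (ub j) vb)).
Qed.

Let sum_marg2 wB vb : \sum_ub pBxn wB ub vb =
  \prod_j marg2 pB (q j) (w1 j) (w2 j) (u j).1 (v j).1 (wB j) (vb j).
Proof.
exact: (sum_ffun_prod (fun j ub => pB (q j) (w1 j) (w2 j) (u j).1 (v j).1 (wB j) ub (vb j))).
Qed.

Let sum_marg0 wB : \sum_ub \sum_vb pBxn wB ub vb =
  \prod_j marg0 pB (q j) (w1 j) (w2 j) (u j).1 (v j).1 (wB j).
Proof.
under [LHS]eq_bigr do rewrite sum_marg1.
exact: (sum_ffun_prod (fun j ub => marg1 pB (q j) (w1 j) (w2 j) (u j).1 (v j).1 (wB j) ub)).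
Qed.

Let pBxn_sum1 : \sum_wB \sum_ub \sum_vb pBxn wB ub vb = 1.
Proof.
under [LHS]eq_bigr do rewrite sum_marg0.
rewrite (sum_ffun_prod (fun j wB => marg0 pB (q j) (w1 j) (w2 j) (u j).1 (v j).1 wB)).
by rewrite big1 // => j _; rewrite pB_sum1.
Qed.

Let k4n := fam (fun j => k4 (q j) (w1 j) (w2 j)).
Let k5n (wB : {ffun 'I_n -> WB}) := fam (fun j => k5 (q j) (w1 j) (w2 j) (wB j) (u j).1).
Let k6n (wB : {ffun 'I_n -> WB}) := fam (fun j => k6 (q j) (w1 j) (w2 j) (wB j) (v j).1).

Let covered_T0 wB ub vb : covered q w1 w2 u v wB ub vb ->
  \sum_ub' \sum_vb' pBxn wB ub' vb' <= T_ n t0 * k4n wB.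
Proof. by case/and4P => h _ _ _; rewrite sum_marg0. Qed.

Let covered_T1 wB ub vb : covered q w1 w2 u v wB ub vb ->
  \sum_vb' pBxn wB ub vb' <= T_ n t1 * (k4n wB * k5n wB ub).
Proof. by case/and4P => _ h _ _; rewrite sum_marg1. Qed.

Let covered_T2 wB ub vb : covered q w1 w2 u v wB ub vb ->
  \sum_ub' pBxn wB ub' vb <= T_ n t2 * (k4n wB * k6n wB vb).
Proof. by case/and4P => _ _ h _; rewrite sum_marg2. Qed.

Let covered_T3 wB ub vb : covered q w1 w2 u v wB ub vb ->
  pBxn wB ub vb <= T_ n t3 * (k4n wB * k5n wB ub * k6n wB vb).
Proof. by case/and4P. Qed.

(** The facts about [pB] and the covered words that the one-shot bound asks for, bundled so that
    they can be projected out for all relay words. *)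
Definition coveringN := ((pBxn_ge0, pBxn_sum1),
  ((covered_T0, covered_T1), (covered_T2, covered_T3))).

End CoveringN.

Let pass1_lt n (q : {ffun 'I_n -> Q}) (k : nat) (k7 : (k < 7)%N) w1 w2 wB u ub y :
  pass1 q w1 w2 wB u ub y -> (2 `^ g1 k) ^+ #|'I_n| <
    \prod_j rhos1 k (q j) (w1 j) (w2 j) (wB j) (u j).1 (ub j) (y j).
Proof. by move=> /forallP/(_ (Ordinal k7)); rewrite card_ord. Qed.

Let pass2_lt n (q : {ffun 'I_n -> Q}) (k : nat) (k7 : (k < 7)%N) w2 w1 wB v vb y :
  pass2 q w2 w1 wB v vb y -> (2 `^ g2 k) ^+ #|'I_n| <
    \prod_j rhos2 k (q j) (w2 j) (w1 j) (wB j) (v j).1 (vb j) (y j).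
Proof. by move=> /forallP/(_ (Ordinal k7)); rewrite card_ord. Qed.

Lemma code_exists n (q : {ffun 'I_n -> Q}) :
  exists c : code X1 XB X2 Y1 Y2 n r0 (r10 + r11) (r20 + r22),
    error_prob ch c <= 2 * (fail1 q + fail2 q + (confusions1 n + confusions2 n)) +
      (16 * covering_variance n + 4 * uncovered q).
Proof.
have [iota1 iota1_inj] := message_pair n r10 r11.
have [iota2 iota2_inj] := message_pair n r20 r22.
have /card_gt0P[n0 _] := card_message_gt0 n r0.
have /card_gt0P[n1 _] := card_message_gt0 n (r10 + r11).
have /card_gt0P[n2 _] := card_message_gt0 n (r20 + r22).
(* A sample point supplies the default letter of [XB] from which the search for the best input
   starts. *)
have [s _] := pmf_inhabited mu.
have pos g : 0 < 2 `^ g :> R by exact: powR_gt0.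
have cle1 k : (2 `^ g1 k) ^- #|'I_n| <= D1 n k by rewrite card_ord.
have cle2 k : (2 `^ g2 k) ^- #|'I_n| <= D2 n k by rewrite card_ord.
pose r1 k (y : {ffun 'I_n -> Y1}) (j : 'I_n) w1 w2 wB (ux : U * X1) ub :=
  rhos1 k (q j) w1 w2 wB ux.1 ub (y j).
pose r2 k (y : {ffun 'I_n -> Y2}) (j : 'I_n) w2 w1 wB (vx : V * X2) vb :=
  rhos2 k (q j) w2 w1 wB vx.1 vb (y j).
pose k5x j w1 w2 wB (ux : U * X1) := k5 (q j) w1 w2 wB ux.1.
pose k6x j w2 w1 wB (vx : V * X2) := k6' (q j) w2 w1 wB vx.1.
have r1_ge0 k y j w1 w2 wB ux ub : 0 <= r1 k y j w1 w2 wB ux ub by exact: rhos_ge0.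
have r2_ge0 k y j w2 w1 wB vx vb : 0 <= r2 k y j w2 w1 wB vx vb by exact: rhos_ge0.
have pass1_r k (k7 : (k < 7)%N) y w1 w2 wB u ub (h : pass1 q w1 w2 wB u ub y) :
    (2 `^ g1 k) ^+ #|'I_n| < \prod_j r1 k y j (w1 j) (w2 j) (wB j) (u j) (ub j) :=
  pass1_lt k7 h.
have pass2_r k (k7 : (k < 7)%N) y w2 w1 wB v vb (h : pass2 q w2 w1 wB v vb y) :
    (2 `^ g2 k) ^+ #|'I_n| < \prod_j r2 k y j (w2 j) (w1 j) (wB j) (v j) (vb j) :=
  pass2_lt k7 h.
(* The words [q] and [y] are fixed here, so their letters make the single-letter densities depend on
   the coordinate. *)
have conf1_1 (y : {ffun 'I_n -> Y1}) := confusionn1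
  (k2 := fun j => k2 (q j)) (k5 := k5x)
  (r1_ge0 0 y) (pos _) (@pass1_r 0 isT y)
  (fun j => rho_sum1 vU vUB vY1 k2 k5 prv_W1W2 prv_WB (q j) (y j)).
have conf1_2 (y : {ffun 'I_n -> Y1}) := confusionn2
  (k4 := fun j => k4 (q j)) (k5 := k5x)
  (r1_ge0 1 y) (pos _) (@pass1_r 1 isT y)
  (fun j a b c => rho_sum2 vWB vUB vY1 k4 k5 prv_W1W2 prv_U (q j) (y j) a b c.1).
have conf1_3 (y : {ffun 'I_n -> Y1}) := confusionn3
  (k1' := fun j => k1' (q j)) (k4 := fun j => k4 (q j)) (k5 := k5x)
  (r1_ge0 2 y) (pos _) (@pass1_r 2 isT y)
  (fun j a b => rho_sum3 vWB vUB vY1 k4 k5 prv_W1W2 prv_U (q j) (y j) a b.1).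
have conf1_4 (y : {ffun 'I_n -> Y1}) := confusionn4
  (k2 := fun j => k2 (q j)) (k4 := fun j => k4 (q j)) (k5 := k5x)
  (r1_ge0 3 y) (pos _) (@pass1_r 3 isT y)
  (fun j => rho_sum4 vU vWB vUB vY1 k2 k4 k5 prv_W1W2 (q j) (y j)).
have conf1_5 (y : {ffun 'I_n -> Y1}) := confusionn5
  (k1' := fun j => k1' (q j)) (k2 := fun j => k2 (q j)) (k4 := fun j => k4 (q j)) (k5 := k5x)
  (r1_ge0 4 y) (pos _) (@pass1_r 4 isT y)
  (fun j => rho_sum5 vU vWB vUB vY1 k2 k4 k5 prv_W1W2 (q j) (y j)).
have conf1_6 (y : {ffun 'I_n -> Y1}) := confusionn6
  (k1 := fun j => k1 (q j)) (k2 := fun j => k2 (q j)) (k4 := fun j => k4 (q j)) (k5 := k5x)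
  (r1_ge0 5 y) (pos _) (@pass1_r 5 isT y)
  (fun j => rho_sum6 vU vWB vUB vY1 k2 k4 k5 prv_W1W2 (q j) (y j)).
have conf1_7 (y : {ffun 'I_n -> Y1}) := confusionn7
  (k1 := fun j => k1 (q j)) (k1' := fun j => k1' (q j)) (k2 := fun j => k2 (q j))
    (k4 := fun j => k4 (q j)) (k5 := k5x)
  (r1_ge0 6 y) (pos _) (@pass1_r 6 isT y)
  (fun j => rho_sum7 mu vQ vW1 vW2 vU vWB vUB vY1 k1 k1' k2 k4 k5 (q j) (y j)).
(* The second receiver, with the relays exchanged. *)
have conf2_1 (y : {ffun 'I_n -> Y2}) := confusionn1
  (k2 := fun j => k2' (q j)) (k5 := k6x)
  (r2_ge0 0 y) (pos _) (@pass2_r 0 isT y)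
  (fun j => rho_sum1 vV vVB vY2 k2' k6' prv_W2W1 prv_WB' (q j) (y j)).
have conf2_2 (y : {ffun 'I_n -> Y2}) := confusionn2
  (k4 := fun j => k4' (q j)) (k5 := k6x)
  (r2_ge0 1 y) (pos _) (@pass2_r 1 isT y)
  (fun j a b c => rho_sum2 vWB vVB vY2 k4' k6' prv_W2W1 prv_V' (q j) (y j) a b c.1).
have conf2_3 (y : {ffun 'I_n -> Y2}) := confusionn3
  (k1' := fun j => k1 (q j)) (k4 := fun j => k4' (q j)) (k5 := k6x)
  (r2_ge0 2 y) (pos _) (@pass2_r 2 isT y)
  (fun j a b => rho_sum3 vWB vVB vY2 k4' k6' prv_W2W1 prv_V' (q j) (y j) a b.1).
have conf2_4 (y : {ffun 'I_n -> Y2}) := confusionn4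
  (k2 := fun j => k2' (q j)) (k4 := fun j => k4' (q j)) (k5 := k6x)
  (r2_ge0 3 y) (pos _) (@pass2_r 3 isT y)
  (fun j => rho_sum4 vV vWB vVB vY2 k2' k4' k6' prv_W2W1 (q j) (y j)).
have conf2_5 (y : {ffun 'I_n -> Y2}) := confusionn5
  (k1' := fun j => k1 (q j)) (k2 := fun j => k2' (q j)) (k4 := fun j => k4' (q j)) (k5 := k6x)
  (r2_ge0 4 y) (pos _) (@pass2_r 4 isT y)
  (fun j => rho_sum5 vV vWB vVB vY2 k2' k4' k6' prv_W2W1 (q j) (y j)).
have conf2_6 (y : {ffun 'I_n -> Y2}) := confusionn6
  (k1 := fun j => k1' (q j)) (k2 := fun j => k2' (q j)) (k4 := fun j => k4' (q j)) (k5 := k6x)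
  (r2_ge0 5 y) (pos _) (@pass2_r 5 isT y)
  (fun j => rho_sum6 vV vWB vVB vY2 k2' k4' k6' prv_W2W1 (q j) (y j)).
have conf2_7 (y : {ffun 'I_n -> Y2}) := confusionn7
  (k1 := fun j => k1' (q j)) (k1' := fun j => k1 (q j)) (k2 := fun j => k2' (q j))
    (k4 := fun j => k4' (q j)) (k5 := k6x)
  (r2_ge0 6 y) (pos _) (@pass2_r 6 isT y)
  (fun j => rho_sum7 mu vQ vW2 vW1 vV vWB vVB vY2 k1' k1 k2' k4' k6' (q j) (y j)).
have cov w1 w2 u v := @coveringN n q w1 w2 u v.
have := @one_shot R _ _ _ _ _ _ _ _ _ _ _ _ (@memoryless R X1 X2 XB Y1 Y2 ch 'I_n)
  (fam (fun j => k1 (q j))) (fam (fun j => k1' (q j)))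
  (fun w1 : {ffun 'I_n -> W1} => fam (fun j => k2 (q j) (w1 j)))
  (fun w2 : {ffun 'I_n -> W2} => fam (fun j => k2' (q j) (w2 j)))
  (fun (w1 : {ffun 'I_n -> W1}) (w2 : {ffun 'I_n -> W2}) =>
     fam (fun j => k4 (q j) (w1 j) (w2 j)))
  (fun (w1 : {ffun 'I_n -> W1}) (w2 : {ffun 'I_n -> W2}) (wB : {ffun 'I_n -> WB})
     (u : {ffun 'I_n -> U * X1}) => fam (fun j => k5 (q j) (w1 j) (w2 j) (wB j) (u j).1))
  (fun (w1 : {ffun 'I_n -> W1}) (w2 : {ffun 'I_n -> W2}) (wB : {ffun 'I_n -> WB})
     (v : {ffun 'I_n -> V * X2}) => fam (fun j => k6 (q j) (w1 j) (w2 j) (wB j) (v j).1))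
  (fun u : {ffun 'I_n -> U * X1} => [ffun j => (u j).2])
  (fun v : {ffun 'I_n -> V * X2} => [ffun j => (v j).2])
  (pBn (fun j => pBx (q j)))
  (fun w1 w2 u v => (cov w1 w2 u v).1.1) (fun w1 w2 u v => (cov w1 w2 u v).1.2)
  (fun (w1 : {ffun 'I_n -> W1}) (w2 : {ffun 'I_n -> W2}) (u : {ffun 'I_n -> U * X1})
    (v : {ffun 'I_n -> V * X2}) (wB : {ffun 'I_n -> WB}) (ub : {ffun 'I_n -> UB})
    (vb : {ffun 'I_n -> VB}) =>
    fam (fun j => kX (q j) (w1 j) (w2 j) (u j) (v j) (wB j) (ub j) (vb j)))
  (covered q) (T_ n t0) (T_ n t1) (T_ n t2) (T_ n t3)
  (D_ge0 _ _) (D_ge0 _ _) (D_ge0 _ _) (D_ge0 _ _)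
  (fun w1 w2 u v => (cov w1 w2 u v).2.1.1) (fun w1 w2 u v => (cov w1 w2 u v).2.1.2)
  (fun w1 w2 u v => (cov w1 w2 u v).2.2.1) (fun w1 w2 u v => (cov w1 w2 u v).2.2.2)
  _ _ _ _ _ _ _ (message n b0) (message n b1) (message n b2) iota1 iota2 iota1_inj iota2_inj
  n0 n1 n2 (card_message_gt0 n b0) (card_message_gt0 n b1) (card_message_gt0 n b2)
  (pass1 q) (pass2 q) (D1 n 0) (D1 n 1) (D1 n 2) (D1 n 3) (D1 n 4) (D1 n 5) (D1 n 6)
  (fun y a b c => le_trans (conf1_1 y a b c) (cle1 0))
  (fun y a b c => le_trans (conf1_2 y a b c) (cle1 1))
  (fun y a b => le_trans (conf1_3 y a b) (cle1 2))
  (fun y a b => le_trans (conf1_4 y a b) (cle1 3))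
  (fun y a => le_trans (conf1_5 y a) (cle1 4))
  (fun y a => le_trans (conf1_6 y a) (cle1 5))
  (fun y  => le_trans (conf1_7 y ) (cle1 6))
  (D_ge0 _ _) (D_ge0 _ _) (D_ge0 _ _) (D_ge0 _ _) (D_ge0 _ _) (D_ge0 _ _) (D_ge0 _ _)
  (D2 n 0) (D2 n 1) (D2 n 2) (D2 n 3) (D2 n 4) (D2 n 5) (D2 n 6)
  (fun y a b c => le_trans (conf2_1 y a b c) (cle2 0))
  (fun y a b c => le_trans (conf2_2 y a b c) (cle2 1))
  (fun y a b => le_trans (conf2_3 y a b) (cle2 2))
  (fun y a b => le_trans (conf2_4 y a b) (cle2 3))
  (fun y a => le_trans (conf2_5 y a) (cle2 4))
  (fun y a => le_trans (conf2_6 y a) (cle2 5))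
  (fun y  => le_trans (conf2_7 y ) (cle2 6))
  (D_ge0 _ _) (D_ge0 _ _) (D_ge0 _ _) (D_ge0 _ _) (D_ge0 _ _) (D_ge0 _ _) (D_ge0 _ _)
  [ffun=> vXB s].
move=> [enc1 [enc2 [encB [dec1 [dec2 h]]]]].
exists (Code enc1 enc2 encB dec1 dec2); rewrite /error_prob ler_pdivrMr; last first.
  by rewrite ltr0n !muln_gt0 !card_message_gt0.
rewrite mulrC; apply: le_trans _ h; apply: le_of_eq.
apply: eq_bigr => m0 _; apply: eq_bigr => m1 _; apply: eq_bigr => m2 _ /=.
rewrite /Ex -(pair_bigA _ (fun y1 y2 =>
  memoryless ch (enc1 m1) (encB m0 m1 m2) (enc2 m2) (y1, y2) *
  ((dec1 y1 != (m0, m1)) || (dec2 y2 != (m0, m2)))%:R)) /=.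
apply: eq_bigr => y1 _; rewrite big_mkcond; apply: eq_bigr => y2 _.
by case: ifP => _; rewrite ?mulr1 ?mulr0.
Qed.

Hypothesis r0_ge0 : 0 <= r0.
Hypothesis r10_ge0 : 0 <= r10.
Hypothesis r11_ge0 : 0 <= r11.
Hypothesis r20_ge0 : 0 <= r20.
Hypothesis r22_ge0 : 0 <= r22.
Hypothesis b0_ge0 : 0 <= b0.
Hypothesis b1_ge0 : 0 <= b1.
Hypothesis b2_ge0 : 0 <= b2.

Let two_neq0 : (2 : R) != 0.
Proof. by rewrite pnatr_eq0. Qed.

Let powD (x y : R) : 2 `^ (x + y) = 2 `^ x * 2 `^ y.
Proof. by rewrite powRD // two_neq0 implybT. Qed.

Let pow_gt0 (x : R) : 0 < 2 `^ x.
Proof. exact: powR_gt0. Qed.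

Let pow_lt (x y : R) : x < y -> 2 `^ x < 2 `^ y.
Proof. by move=> xy; rewrite -ltr_ln ?posrE // !ln_powR ltr_pM2r // ln_gt0 // ltr1n. Qed.

Let sizes_le n (rs : seq R) : all (fun r => 0 <= r) rs ->
  \prod_(r <- rs) size n r <= 2 ^+ seq.size rs * (2 `^ (\sum_(r <- rs) r)) ^+ n.
Proof.
elim: rs => [_|r rs IHrs /= /andP[r_ge0 /IHrs h]].
  by rewrite !big_nil powRr0 expr1n mulr1.
rewrite !big_cons powD exprMn exprS mulrACA.
apply: ler_pM => //; first by apply: prodr_ge0 => i _; exact: ler0n.
exact: card_message_le.
Qed.

Let sizes_ge n (rs : seq R) : (2 `^ (\sum_(r <- rs) r)) ^+ n <= \prod_(r <- rs) size n r.
Proof.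
elim: rs => [|r rs IHrs]; first by rewrite !big_nil powRr0 expr1n.
rewrite !big_cons powD exprMn; apply: ler_pM; last exact: IHrs.
- by apply: exprn_ge0; exact: ltW.
- by apply: exprn_ge0; exact: ltW.
- exact: card_message_ge.
Qed.

(** Rounding costs a factor [2] per message set, a constant in [n], and the remaining ratio is a
    power of [2] with negative exponent. *)
Let sizes_vanishing (rs : seq R) (g : R) : all (fun r => 0 <= r) rs ->
  \sum_(r <- rs) r < g ->
  vanishing (fun n => \prod_(r <- rs) size n r * ((2 `^ g) ^+ n)^-1).
Proof.
move=> rs0 rsg; apply: (@vanishing_le _ _ (fun n => 2 ^+ seq.size rs *
  (2 `^ (\sum_(r <- rs) r) / 2 `^ g) ^+ n)).
  by move=> n; rewrite expr_div_n mulrA ler_wpM2r ?sizes_le // invr_ge0 exprn_ge0 // ltW.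
apply: vanishing_geometric; rewrite divr_ge0 ?ltW //=.
by rewrite ltr_pdivrMr // mul1r; exact: pow_lt.
Qed.

(** Rounding up only enlarges the bins, so it helps here; the geometric ratio has exponent minus
    [t + \sum_(b <- bs) b]. *)
Let cover_vanishing (bs : seq R) (t : R) : - t < \sum_(b <- bs) b ->
  vanishing (fun n => T_ n t / \prod_(b <- bs) size n b).
Proof.
move=> tb; apply: (@vanishing_le _ _ (fun n => 1 *
  ((2 `^ t * 2 `^ (\sum_(b <- bs) b))^-1) ^+ n)).
  move=> n; rewrite mul1r exprVn exprMn invfM /T_ ler_wpM2l ?D_ge0 //.
  have h : 0 < (2 `^ (\sum_(b <- bs) b)) ^+ n by rewrite exprn_gt0.
  by rewrite lef_pV2 ?posrE // (lt_le_trans h) // sizes_ge.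
apply: vanishing_geometric; rewrite invr_ge0 mulr_ge0 ?ltW //=.
rewrite invf_lt1 ?mulr_gt0 // -powD -[ltLHS](powRr0 (2 : R)); apply: pow_lt.
by rewrite -ltrBlDl sub0r.
Qed.

Hypothesis g1_gt0 : r11 + b1 < g1 0.
Hypothesis g1_gt1 : r0 + b0 + b1 < g1 1.
Hypothesis g1_gt2 : r20 + r0 + b0 + b1 < g1 2.
Hypothesis g1_gt3 : r0 + b0 + r11 + b1 < g1 3.
Hypothesis g1_gt4 : r20 + r0 + b0 + r11 + b1 < g1 4.
Hypothesis g1_gt5 : r10 + r0 + b0 + r11 + b1 < g1 5.
Hypothesis g1_gt6 : r10 + r20 + r0 + b0 + r11 + b1 < g1 6.
Hypothesis g2_gt0 : r22 + b2 < g2 0.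
Hypothesis g2_gt1 : r0 + b0 + b2 < g2 1.
Hypothesis g2_gt2 : r10 + r0 + b0 + b2 < g2 2.
Hypothesis g2_gt3 : r0 + b0 + r22 + b2 < g2 3.
Hypothesis g2_gt4 : r10 + r0 + b0 + r22 + b2 < g2 4.
Hypothesis g2_gt5 : r20 + r0 + b0 + r22 + b2 < g2 5.
Hypothesis g2_gt6 : r10 + r20 + r0 + b0 + r22 + b2 < g2 6.
Hypothesis t0_gt : - t0 < b0.
Hypothesis t1_gt : - t1 < b0 + b1.
Hypothesis t2_gt : - t2 < b0 + b2.
Hypothesis t3_gt : - t3 < b0 + b1 + b2.

Let rates_ge0 := (r0_ge0, r10_ge0, r11_ge0, r20_ge0, r22_ge0, (b0_ge0, b1_ge0, b2_ge0)).

Lemma confusions1_vanishing : vanishing confusions1.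
Proof.
pose t rs k n := \prod_(r <- rs) size n r * D1 n k.
apply: (@vanishing_le _ _ (fun n => t [:: r11; b1] 0%N n + (t [:: r0; b0; b1] 1%N n +
  (t [:: r20; r0; b0; b1] 2%N n + (t [:: r0; b0; r11; b1] 3%N n +
  (t [:: r20; r0; b0; r11; b1] 4%N n + (t [:: r10; r0; b0; r11; b1] 5%N n +
   t [:: r10; r20; r0; b0; r11; b1] 6%N n))))))).
  move=> n; rewrite /confusions1 /t !big_cons !big_nil; apply: le_of_eq.
  by ring.
do 6 (apply: vanishingD; first by
  apply: sizes_vanishing; rewrite /= ?rates_ge0 ?big_cons ?big_nil ?addr0 ?addrA).
by apply: sizes_vanishing; rewrite /= ?rates_ge0 ?big_cons ?big_nil ?addr0 ?addrA.
Qed.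

Lemma confusions2_vanishing : vanishing confusions2.
Proof.
pose t rs k n := \prod_(r <- rs) size n r * D2 n k.
apply: (@vanishing_le _ _ (fun n => t [:: r22; b2] 0%N n + (t [:: r0; b0; b2] 1%N n +
  (t [:: r10; r0; b0; b2] 2%N n + (t [:: r0; b0; r22; b2] 3%N n +
  (t [:: r10; r0; b0; r22; b2] 4%N n + (t [:: r20; r0; b0; r22; b2] 5%N n +
   t [:: r10; r20; r0; b0; r22; b2] 6%N n))))))).
  move=> n; rewrite /confusions2 /t !big_cons !big_nil; apply: le_of_eq.
  by ring.
do 6 (apply: vanishingD; first by
  apply: sizes_vanishing; rewrite /= ?rates_ge0 ?big_cons ?big_nil ?addr0 ?addrA).
by apply: sizes_vanishing; rewrite /= ?rates_ge0 ?big_cons ?big_nil ?addr0 ?addrA.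
Qed.

Lemma covering_variance_vanishing : vanishing covering_variance.
Proof.
pose t bs g n := T_ n g / \prod_(b <- bs) size n b.
apply: (@vanishing_le _ _ (fun n => t [:: b0] t0 n + (t [:: b0; b1] t1 n +
  (t [:: b0; b2] t2 n + t [:: b0; b1; b2] t3 n)))).
  move=> n; rewrite /covering_variance /t !big_cons !big_nil !mulr1 !mulrA !addrA.
  exact: lexx.
do 3 (apply: vanishingD; first by
  apply: cover_vanishing; rewrite ?big_cons ?big_nil ?addr0 ?addrA).
by apply: cover_vanishing; rewrite ?big_cons ?big_nil ?addr0 ?addrA.
Qed.

Let error_prob_ge0 n (c : code X1 XB X2 Y1 Y2 n r0 (r10 + r11) (r20 + r22)) :
  0 <= error_prob ch c.
Proof.
apply: divr_ge0; last exact: ler0n.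
by do 5 (apply: sumr_ge0 => ? _); apply: prodr_ge0 => ? _; exact: pmf_ge0.
Qed.

Theorem random_code_achievable : achievable ch (r0, r10 + r11, r20 + r22).
Proof.
split; [by []|exact: addr_ge0|exact: addr_ge0|].
pose bound n := 2 * (Eq n (@fail1 n) + Eq n (@fail2 n) + (confusions1 n + confusions2 n)) +
  (16 * covering_variance n + 4 * Eq n (@uncovered n)).
have bound_vanishing : vanishing bound.
  apply: vanishingD; first apply: vanishingZ => //.
    apply: vanishingD; first exact: vanishingD fail1_vanishing fail2_vanishing.
    exact: vanishingD confusions1_vanishing confusions2_vanishing.
  apply: vanishingD; apply: vanishingZ => //; first exact: covering_variance_vanishing.
  exact: uncovered_vanishing.
have codes n : exists c : code X1 XB X2 Y1 Y2 n r0 (r10 + r11) (r20 + r22),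
    error_prob ch c <= bound n.
  (* The error bound is linear in the quantities that depend on [q], so some time-sharing word does
     no worse than the average. *)
  have : Eq n (fun q => 2 * (fail1 q + fail2 q + (confusions1 n + confusions2 n)) +
      (16 * covering_variance n + 4 * uncovered q)) <= bound n.
    by rewrite ExD ExZl !ExD !Ex_cst !ExZl.
  move=> /Ex_exists_le[q hq]; have [c hc] := code_exists q.
  by exists c; exact: le_trans hc hq.
exists (fun n => projT1 (cid (codes n))); apply: vanishing_cvg => [n|].
  exact: error_prob_ge0.
by apply: vanishing_le bound_vanishing => n; exact: projT2 (cid (codes n)).
Qed.

End Assembly.

(** * Achievability of the region *)

Section Region.
Variables (R : realType) (X1 XB X2 Y1 Y2 : finType) (W : channel R X1 XB X2 Y1 Y2).
Variables (Q W1 U1 W2 V2 WB UB VB : finType).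
Variable P : fdist R (joint_space X1 XB X2 Q W1 U1 W2 V2 WB UB VB).
Variable pQ : fdist R Q.
Variable p1 : Q -> fdist R (W1 * U1 * X1)%type.
Variable p2 : Q -> fdist R (W2 * V2 * X2)%type.
Variable pB : W1 -> U1 -> W2 -> V2 -> Q -> fdist R (WB * UB * VB)%type.
Variable pXB : X1 -> X2 -> VB -> UB -> WB -> U1 -> W1 -> V2 -> W2 -> Q -> fdist R XB.
Hypothesis PE : forall q w1 u1 w2 v2 wB uB vB x1 x2 xB,
  P (q, w1, u1, w2, v2, wB, uB, vB, x1, x2, xB) =
  pQ q * p1 q (w1, u1, x1) * p2 q (w2, v2, x2) *
  pB w1 u1 w2 v2 q (wB, uB, vB) * pXB x1 x2 vB uB wB u1 w1 v2 w2 q xB.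

Local Notation T := (sample_space X1 XB X2 Y1 Y2 Q W1 U1 W2 V2 WB UB VB).

Let mu : fdist R T := with_outputs W P.
Let vQ : T -> Q := @rvQ X1 XB X2 Y1 Y2 Q W1 U1 W2 V2 WB UB VB.
Let vW1 : T -> W1 := @rvW1 X1 XB X2 Y1 Y2 Q W1 U1 W2 V2 WB UB VB.
Let vW2 : T -> W2 := @rvW2 X1 XB X2 Y1 Y2 Q W1 U1 W2 V2 WB UB VB.
Let vU : T -> U1 := @rvU1 X1 XB X2 Y1 Y2 Q W1 U1 W2 V2 WB UB VB.
Let vV : T -> V2 := @rvV2 X1 XB X2 Y1 Y2 Q W1 U1 W2 V2 WB UB VB.
Let vWB : T -> WB := @rvWB X1 XB X2 Y1 Y2 Q W1 U1 W2 V2 WB UB VB.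
Let vUB : T -> UB := @rvUB X1 XB X2 Y1 Y2 Q W1 U1 W2 V2 WB UB VB.
Let vVB : T -> VB := @rvVB X1 XB X2 Y1 Y2 Q W1 U1 W2 V2 WB UB VB.
Let vY1 : T -> Y1 := @rvY1 X1 XB X2 Y1 Y2 Q W1 U1 W2 V2 WB UB VB.
Let vY2 : T -> Y2 := @rvY2 X1 XB X2 Y1 Y2 Q W1 U1 W2 V2 WB UB VB.
Let vY : T -> Y1 * Y2 := snd.
Let vX1 : T -> X1 := @rvX1 X1 XB X2 Y1 Y2 Q W1 U1 W2 V2 WB UB VB.
Let vX2 : T -> X2 := @rvX2 X1 XB X2 Y1 Y2 Q W1 U1 W2 V2 WB UB VB.
Let vXB : T -> XB := @rvXB X1 XB X2 Y1 Y2 Q W1 U1 W2 V2 WB UB VB.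

Let k1 q := cond mu vQ vW1 q.
Let k1' q := cond mu vQ vW2 q.
Let k2 q w1 := cond mu [% vQ, vW1] [% vU, vX1] (q, w1).
Let k2' q w2 := cond mu [% vQ, vW2] [% vV, vX2] (q, w2).
Let k4 q w1 w2 := cond mu [% vQ, vW1, vW2] vWB (q, w1, w2).
Let k5 q w1 w2 wB u := cond mu [% vQ, vW1, vW2, vU, vWB] vUB (q, w1, w2, u, wB).
Let k6 q w1 w2 wB v := cond mu [% vQ, vW1, vW2, vV, vWB] vVB (q, w1, w2, v, wB).
Let kB q w1 w2 u v wB ub vb := pB w1 u w2 v q (wB, ub, vb).
Let kX q w1 w2 (ux : U1 * X1) (vx : V2 * X2) wB ub vb :=
  pXB ux.2 vx.2 vb ub wB ux.1 w1 vx.1 w2 q.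

Let kB_ge0 q w1 w2 u v wB ub vb : 0 <= kB q w1 w2 u v wB ub vb.
Proof. exact: pmf_ge0. Qed.

Let kB_sum1 q w1 w2 u v : \sum_wB \sum_ub \sum_vb kB q w1 w2 u v wB ub vb = 1.
Proof.
rewrite -[RHS](pmf_sum1 (pB w1 u w2 v q)) pair_bigA pair_bigA /=.
by apply: eq_bigr => -[[wB ub] vb].
Qed.

Let kW1W2 : forall q w1 w2,
  prv mu [% vQ, vW1, vW2] (q, w1, w2) = prv mu vQ q * k1 q w1 * k1' q w2.
Proof. exact: (prv_W1W2_BCCR W PE). Qed.

Let kU : forall q w1 w2 u,
  prv mu [% vQ, vW1, vW2, vU] (q, w1, w2, u) =
  prv mu [% vQ, vW1, vW2] (q, w1, w2) * \sum_x k2 q w1 (u, x).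
Proof. exact: (prv_U_BCCR W PE). Qed.

Let kV : forall q w1 w2 v,
  prv mu [% vQ, vW1, vW2, vV] (q, w1, w2, v) =
  prv mu [% vQ, vW1, vW2] (q, w1, w2) * \sum_x k2' q w2 (v, x).
Proof. exact: (prv_V_BCCR W PE). Qed.

Let kWB : forall q w1 w2 wB,
  prv mu [% vQ, vW1, vW2, vWB] (q, w1, w2, wB) =
  prv mu [% vQ, vW1, vW2] (q, w1, w2) * k4 q w1 w2 wB.
Proof. by move=> *; exact: condE. Qed.

Let kUB : forall q w1 w2 u wB ub,
  prv mu [% vQ, vW1, vW2, vU, vWB, vUB] (q, w1, w2, u, wB, ub) =
  prv mu [% vQ, vW1, vW2, vU, vWB] (q, w1, w2, u, wB) * k5 q w1 w2 wB u ub.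
Proof. by move=> *; exact: condE. Qed.

Let kVB : forall q w1 w2 v wB vb,
  prv mu [% vQ, vW1, vW2, vV, vWB, vVB] (q, w1, w2, v, wB, vb) =
  prv mu [% vQ, vW1, vW2, vV, vWB] (q, w1, w2, v, wB) * k6 q w1 w2 wB v vb.
Proof. by move=> *; exact: condE. Qed.

Let kB_prv : forall q w1 w2 u v wB ub vb,
  prv mu [% vQ, vW1, vW2, vU, vV, vWB, vUB, vVB] (q, w1, w2, u, v, wB, ub, vb) =
  prv mu [% vQ, vW1, vW2, vU, vV] (q, w1, w2, u, v) * kB q w1 w2 u v wB ub vb.
Proof. exact: (prv_B_BCCR W PE). Qed.

Let E1 k := Ex mu (fun t => log2 (rhos1 mu vQ vW1 vW2 vU vWB vUB vY k1 k1' k2 k4 k5 k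
  (vQ t) (vW1 t) (vW2 t) (vWB t) (vU t) (vUB t) (vY1 t))).
Let E2 k := Ex mu (fun t => log2 (rhos2 mu vQ vW1 vW2 vV vWB vVB vY k1 k1' k2' k4 k6 k
  (vQ t) (vW2 t) (vW1 t) (vWB t) (vV t) (vVB t) (vY2 t))).

(** [Ex_log_rho] identifies the right-hand sides of the constraints with the expected logarithms of
    the tested densities; the list of rates follows the order of [rhos]. *)
Lemma decoding_rate1_lt (r0 r10 r11 r20 b0 b1 : R) (k : 'I_7) :
  decoding_constraints1 W P r0 r10 r11 r20 b0 b1 ->
  nth 0 [:: r11 + b1; r0 + b0 + b1; r20 + r0 + b0 + b1; r0 + b0 + r11 + b1;
     r20 + r0 + b0 + r11 + b1; r10 + r0 + b0 + r11 + b1;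
     r10 + r20 + r0 + b0 + r11 + b1] k < E1 k.
Proof.
have lt_eq (x y z : R) : x < y -> z = y -> x < z by move=> ? ->.
pose E := Ex_log_rho vY1 kW1W2 kU kWB kUB.
case=> h0 [h1 [h2 [h3 [h4 [h5 h6]]]]].
case: k => -[|[|[|[|[|[|[|//]]]]]]] _ /=.
- by apply: lt_eq h0 _; apply: (E _ _ _ _ [% vQ, vW1, vW2, vWB]); eq_events.
- by apply: lt_eq h1 _; apply: (E _ _ _ _ [% vQ, vW1, vW2, vU]); eq_events.
- by apply: lt_eq h2 _; apply: (E _ _ _ _ [% vQ, vW1, vU]); eq_events.
- by apply: lt_eq h3 _; apply: (E _ _ _ _ [% vQ, vW1, vW2]); eq_events.
- by apply: lt_eq h4 _; apply: (E _ _ _ _ [% vQ, vW1]); eq_events.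
- by apply: lt_eq h5 _; apply: (E _ _ _ _ [% vQ, vW2]); eq_events.
- by apply: lt_eq h6 _; apply: (E _ _ _ _ vQ) => //; eq_events.
Qed.

Lemma decoding_rate2_lt (r0 r10 r20 r22 b0 b2 : R) (k : 'I_7) :
  decoding_constraints2 W P r0 r10 r20 r22 b0 b2 ->
  nth 0 [:: r22 + b2; r0 + b0 + b2; r10 + r0 + b0 + b2; r0 + b0 + r22 + b2;
     r10 + r0 + b0 + r22 + b2; r20 + r0 + b0 + r22 + b2;
     r10 + r20 + r0 + b0 + r22 + b2] k < E2 k.
Proof.
have lt_eq (x y z : R) : x < y -> z = y -> x < z by move=> ? ->.
pose E := Ex_log_rho vY2 (prv_W2W1 kW1W2) (prv_V' kV) (prv_WB' kWB) (prv_VB' kVB).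
case=> h0 [h1 [h2 [h3 [h4 [h5 h6]]]]].
case: k => -[|[|[|[|[|[|[|//]]]]]]] _ /=.
- by apply: lt_eq h0 _; apply: (E _ _ _ _ [% vQ, vW2, vW1, vWB]); eq_events.
- by apply: lt_eq h1 _; apply: (E _ _ _ _ [% vQ, vW2, vW1, vV]); eq_events.
- by apply: lt_eq h2 _; apply: (E _ _ _ _ [% vQ, vW2, vV]); eq_events.
- by apply: lt_eq h3 _; apply: (E _ _ _ _ [% vQ, vW2, vW1]); eq_events.
- by apply: lt_eq h4 _; apply: (E _ _ _ _ [% vQ, vW2]); eq_events.
- by apply: lt_eq h5 _; apply: (E _ _ _ _ [% vQ, vW1]); eq_events.
- by apply: lt_eq h6 _; apply: (E _ _ _ _ vQ) => //; eq_events.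
Qed.

Let midpoint_lt (x y : R) : x < y -> x < (x + y) / 2 /\ (x + y) / 2 < y.
Proof. by move=> xy; split; rewrite midf_lt. Qed.

Let supported q w1 w2 (ux : U1 * X1) (vx : V2 * X2) wB ub vb xB (y : Y1 * Y2) :
  0 < law mu vQ q -> 0 < k1 q w1 -> 0 < k1' q w2 -> 0 < k2 q w1 ux -> 0 < k2' q w2 vx ->
  0 < kB q w1 w2 ux.1 vx.1 wB ub vb -> 0 < kX q w1 w2 ux vx wB ub vb xB ->
  0 < W ux.2 xB vx.2 y ->
  exists2 t, 0 < mu t & (vQ t, vW1 t, vW2 t, (vU t, vX1 t), (vV t, vX2 t), vWB t, vUB t,
    vVB t, vXB t, vY t) = (q, w1, w2, ux, vx, wB, ub, vb, xB, y).
Proof.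
move=> h1 h2 h3 h4 h5 h6 h7 h8.
exists (q, w1, ux.1, w2, vx.1, wB, ub, vb, ux.2, vx.2, xB, y).
  exact: (support_BCCR PE h1 h2 h3 h4 h5 h6 h7 h8).
by case: ux vx {h4 h5 h6 h7 h8} => [u x1] [v x2].
Qed.

Lemma region_at_achievable r : region_at W P r -> achievable W r.
Proof.
case: r => [[r0 r1] r2] [r0_ge0 _ _ [b0 [b1 [b2 [r10 [r11 [r20 [r22]]]]]]]].
case=> -[b0_ge0 [b1_ge0 [b2_ge0 [r10_ge0 [r11_ge0 [r20_ge0 r22_ge0]]]]]].
case=> -> [-> [[hb0 [hb1 [hb2 hb3]]] [hd1 hd2]]].
pose s1 := [:: r11 + b1; r0 + b0 + b1; r20 + r0 + b0 + b1; r0 + b0 + r11 + b1;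
     r20 + r0 + b0 + r11 + b1; r10 + r0 + b0 + r11 + b1;
     r10 + r20 + r0 + b0 + r11 + b1].
pose s2 := [:: r22 + b2; r0 + b0 + b2; r10 + r0 + b0 + b2; r0 + b0 + r22 + b2;
     r10 + r0 + b0 + r22 + b2; r20 + r0 + b0 + r22 + b2;
     r10 + r20 + r0 + b0 + r22 + b2].
(* Thresholds midway between rate and information leave strict room on both sides: the true tuple
   passes with high probability, and the wrong ones are too few to pass. *)
have m1 (k : 'I_7) := midpoint_lt (decoding_rate1_lt k hd1).
have m2 (k : 'I_7) := midpoint_lt (decoding_rate2_lt k hd2).
(* The covering exponents are negated because [beta0] to [beta3] are reciprocals: they lie between
   minus the bin rate and minus the information. *)
have beta_mid (e b l : R) : e < b -> l = - e -> (- b + l) / 2 < l /\ - ((- b + l) / 2) < b.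
  move=> eb ->; have /midpoint_lt[h1 h2] : - b < - e by rewrite ltrN2.
  by split; rewrite // ltrNl.
have [l0 g0] := beta_mid _ _ _ hb0 (Ex_log_beta0 kB_ge0 kWB kB_prv).
have [l1 g1] := beta_mid _ _ _ hb1 (Ex_log_beta1 kB_ge0 kWB kUB kB_prv).
have [l2 g2] := beta_mid _ _ _ hb2 (Ex_log_beta2 kB_ge0 kWB kVB kB_prv).
have [l3 g3] := beta_mid _ _ _ hb3 (Ex_log_beta3 kB_ge0 kWB kUB kVB kB_prv).
exact: (random_code_achievable (ch := W) kB_ge0 kB_sum1 supported (truth_with_outputs W PE)
  kW1W2 kU kV kWB kUB kVB kB_prv
  (g1 := fun k => (nth 0 s1 k + E1 k) / 2) (g2 := fun k => (nth 0 s2 k + E2 k) / 2)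
  (fun k => (m1 k).2) (fun k => (m2 k).2) l0 l1 l2 l3
  r0_ge0 r10_ge0 r11_ge0 r20_ge0 r22_ge0 b0_ge0 b1_ge0 b2_ge0
  (m1 0).1 (m1 1).1 (m1 2%:R).1 (m1 3%:R).1 (m1 4%:R).1 (m1 5%:R).1 (m1 6%:R).1
  (m2 0).1 (m2 1).1 (m2 2%:R).1 (m2 3%:R).1 (m2 4%:R).1 (m2 5%:R).1 (m2 6%:R).1
  g0 g1 g2 g3).
Qed.

End Region.

Theorem theorem1 (R : realType) (X1 XB X2 Y1 Y2 : finType)
    (W : channel R X1 XB X2 Y1 Y2) :
  inner_bound W (rate_region W).
Proof.
have sub : (rate_region W `<=` achievable W)%classic.
  move=> r [Q [W1 [U1 [W2 [V2 [WB [UB [VB [P [[pQ [p1 [p2 [pB [pXB PE]]]]] hr]]]]]]]]]].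
  exact: region_at_achievable PE _ hr.
by split=> //; apply: subset_trans sub _; exact: subset_closure.
Qed.
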